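(* Let $f,g\colon\mathbb{R}^3\to\mathbb{R}$ be globally bounded and globally Lipschitz continuous (with Lipschitz constant $\lambda$), with $|f(x,y,z)|,|g(x,y,z)|<M$ for all $(x,y,z)$. Consider, for $\varepsilon>0$, the system \[ \dot x = f(x,y,z),\qquad \dot y = g(x,y,z),\qquad \varepsilon\dot z = x+|z|. \] Assume $f(0,0,0)=0$, $g(0,0,0)>0$, and $y\cdot f(0,y,0)<0$ for all $y\neq 0$. Let $w_a^*(t)=(x_a^*(t),y_a^*(t))$ be the solution of $\dot x=f_a(x,y):=f(x,y,x)$, $\dot y=g_a(x,y):=g(x,y,x)$ with $x(0)=y(0)=0$, and $w_r^*(t)=(x_r^*(t),y_r^*(t))$ the solution of $\dot x=f_r(x,y):=f(x,y,-x)$, $\dot y=g_r(x,y):=g(x,y,-x)$ with $x(0)=y(0)=0$. Let $T_a<0<T_r$ be such that $x_a^*(t)<0$ for $T_a<t<0$ and $x_r^*(t)<0$ for $0<t<T_r$. Assume there exist $\tau,\sigma$ with $T_a<\tau<0<\sigma<T_r$ and $x_a^*(\tau)=x_r^*(\sigma)=x^*$, $y_a^*(\tau)=y_r^*(\sigma)=y^*$, and that \[ A=f_a(x^*,y^* )g_r(x^*,y^* )-f_r(x^*,y^* )g_a(x^*,y^* )\neq 0 . \] Then for every sufficiently small $\varepsilon>0$ the system has a periodic solution, and its minimal period $T_{\min}(\varepsilon)$ satisfies $T_{\min}(\varepsilon)\to\sigma-\tau$ as $\varepsilon\to 0$. *)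

(* Defs.v *)
From Stdlib Require Import Reals.
From Coquelicot Require Import Coquelicot.
Open Scope R_scope.

Definition norm3 (a b c : R) : R := sqrt (a ^ 2 + b ^ 2 + c ^ 2).

Definition lipschitz3 (F : R -> R -> R -> R) (lam : R) : Prop :=
  forall x1 y1 z1 x2 y2 z2 : R,
    Rabs (F x1 y1 z1 - F x2 y2 z2) <= lam * norm3 (x1 - x2) (y1 - y2) (z1 - z2).

Definition planar_solution (P Q : R -> R -> R) (x y : R -> R) : Prop :=
  forall t : R, is_derive x t (P (x t) (y t)) /\ is_derive y t (Q (x t) (y t)).

Definition slowfast_solution (f g : R -> R -> R -> R) (eps : R)
  (x y z : R -> R) : Prop :=
  forall t : R,
    is_derive x t (f (x t) (y t) (z t)) /\
    is_derive y t (g (x t) (y t) (z t)) /\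
    is_derive z t ((x t + Rabs (z t)) / eps).

Definition is_period3 (x y z : R -> R) (T : R) : Prop :=
  forall t : R, x (t + T) = x t /\ y (t + T) = y t /\ z (t + T) = z t.

Definition minimal_period3 (x y z : R -> R) (T : R) : Prop :=
  0 < T /\ is_period3 x y z T /\
  forall T' : R, 0 < T' < T -> ~ is_period3 x y z T'.

(* Main.v *)
(** Replace [z] by its truncation to [|z| <= |x| + k] in [f] and [g]. For [eps M < k]
    a periodic solution of the truncated system satisfies [|z| <= |x| + k] anyway: as soon
    as [z > 0] and [x + z > k], [z] grows forever, and dually backwards in time for
    [z < 0]. So it is enough to find periodic orbits of the truncated system.

    For small [u], [v] the planar [a]-trajectory that meets [y = 0] at [(u, 0)] and the
    planar [r]-trajectory that meets it at [(v, 0)] intersect transversally at a point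
    [P(u, v)] near the crossing of the two given trajectories. Follow the truncated flow
    from [(P, 0)] forwards to [y = 0], reaching [(Xa, 0, Za)], and backwards to [y = 0],
    reaching [(Xr, 0, Zr)]; the orbit closes up when [Xa = Xr] and [Za = Zr]. Forwards, [z]
    stays close to [x] as long as [z <= 0]. Hence for [u < 0] the point hit is close to
    [(u, 0, u)], whereas for [u > 0] the trajectory enters [x > 0] while [y < 0], stays
    there because [f(0, y, 0) > 0], and [z] explodes. The backward flow is the forward flow
    of the system obtained from [(t, y, z) -> (-t, -y, -z)], so [Xr] is close to [v] and
    [Zr] to [-v] for [v < 0], and [Zr] is very negative for [v > 0]. On the boundary of the
    square [[-d, d]^2] this forces [(Za - Zr, Xa - Xr)] to wind around the origin, so it
    vanishes inside. One may take [d] as small as one likes before letting [eps] go to [0],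
    which brings the period close to [sigma - tau]. It is minimal because on the orbit [z]
    vanishes away from the origin only at [(P, 0)]. *)

Require Import Defs.
From Stdlib Require Import Reals Lra Lia Classical IndefiniteDescription.
From Coquelicot Require Import Coquelicot.
Open Scope R_scope.

(** * Real induction, mean value estimates, Gronwall *)

(** No expansion of the flow at the fold of [x + |z| = 0] is made. Near the origin only two facts
    are used: [g] is close to [g(0, 0, 0) > 0], so that [y = 0] is crossed exactly once in a short
    time window [[-h, H]], and [f(0, y, 0)] has a known sign. That sign controls [x] only if [z] is
    small whenever [x] is, whereas [z] may become huge within the window. This is the purpose of the
    truncation: afterwards [f] differs from [f(0, y, 0)] by at most [L * (2 * |x| + k)], whatever
    [z] does. The window is fixed before [d], [d] before [k] and [k] before [eps]: [k] has to be
    small against the minimum of [f(0, y, 0)] over values of [y] kept away from [0] by a multiple of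
    [d], and [eps] has to satisfy [eps * M < k]. The quantitative estimates are uniform in [eps],
    because the rate [1 / eps] enters them only as a contraction. Constants that blow up with
    [1 / eps] serve only for continuity in [(u, v)], where [eps] is fixed. *)

Lemma real_induction (P : R -> Prop) (a b : R) :
  P a ->
  (forall t, a <= t < b -> (forall s, a <= s <= t -> P s) ->
     exists del, 0 < del /\ forall s, t < s < t + del -> P s) ->
  (forall t, a < t <= b -> (forall s, a <= s < t -> P s) -> P t) ->
  forall t, a <= t <= b -> P t.
Proof.
  intros Pa Pext Plim t0 Ht0.
  destruct (classic (P t0)) as [H|Hn]; [exact H|exfalso].
  (* The supremum [m] of [E] lies in [E] by the limit hypothesis; if [m < t0], the extension
     hypothesis produces a larger element. *)
  set (E := fun s => a <= s <= t0 /\ forall r, a <= r <= s -> P r).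
  assert (Ea : E a).
  { split; [lra|]. intros r Hr. replace r with a by lra. exact Pa. }
  assert (Eb : bound E) by (exists t0; intros s [Hs _]; lra).
  destruct (completeness E Eb (ex_intro _ a Ea)) as [m [Hm1 Hm2]].
  assert (Ham : a <= m) by (apply Hm1; exact Ea).
  assert (Hmt : m <= t0) by (apply Hm2; intros s [Hs _]; lra).
  assert (Hlt : forall s, a <= s < m -> P s).
  { intros s Hs. apply NNPP; intro Hns.
    assert (m <= s); [|lra].
    apply Hm2. intros r [Hr1 Hr2].
    destruct (Rle_lt_dec r s); [assumption|]. exfalso; apply Hns, Hr2; lra. }
  assert (Pm : P m).
  { destruct (Req_dec a m) as [<-|Hne]; [exact Pa|]. apply Plim; [lra|exact Hlt]. }
  assert (Hle : forall s, a <= s <= m -> P s).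
  { intros s Hs. destruct (Req_dec s m) as [->|Hne]; [exact Pm|apply Hlt; lra]. }
  destruct (Req_dec m t0) as [->|Hne]; [exact (Hn Pm)|].
  destruct (Pext m ltac:(lra) Hle) as [del [Hdel Hd]].
  set (m' := Rmin t0 (m + del / 2)).
  assert (m < m' <= t0 /\ m' < m + del).
  { unfold m', Rmin; destruct Rle_dec; lra. }
  assert (E m').
  { split; [lra|]. intros r Hr.
    destruct (Rle_lt_dec r m); [apply Hle; lra|apply Hd; lra]. }
  specialize (Hm1 m' H0). lra.
Qed.

Lemma is_derive_eps (w : R -> R) t l :
  is_derive w t l -> forall e, 0 < e -> exists del, 0 < del /\
  forall s, Rabs (s - t) < del -> Rabs (w s - w t - l * (s - t)) <= e * Rabs (s - t).
Proof.
  intros H e He.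
  destruct H as [_ H]. specialize (H t (fun P Q => Q)).
  destruct (H (mkposreal e He)) as [del Hd].
  exists del; split; [apply cond_pos|]. intros s Hs.
  specialize (Hd s Hs). unfold norm, minus, plus, opp, scal in Hd; simpl in Hd.
  unfold abs, mult in Hd; simpl in Hd.
  replace (w s - w t - l * (s - t)) with (w s + - w t + - ((s + - t) * l)) by ring.
  exact Hd.
Qed.

Lemma is_derive_cont (w : R -> R) t l :
  is_derive w t l -> forall e, 0 < e -> exists del, 0 < del /\
  forall s, Rabs (s - t) < del -> Rabs (w s - w t) < e.
Proof.
  intros H e He.
  assert (C : continuity_pt w t).
  { apply derivable_continuous_pt. exists l. apply is_derive_Reals, H. }
  destruct (C e He) as [del [Hd1 Hd2]].
  exists del; split; [lra|]. intros s Hs.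
  destruct (Req_dec s t) as [->|Hne].
  { replace (w t - w t) with 0 by ring. rewrite Rabs_R0; lra. }
  apply (Hd2 s). split; [split; [exact I|lra]|exact Hs].
Qed.

(** At a zero the negative derivative pushes [w] back below [0], elsewhere continuity suffices. The
    derivative condition may use that [w <= 0] held so far; this clause is what allows estimates
    valid only while [z <= 0] to be used for proving that [z <= 0] persists. *)
Lemma barrier_nonpos (w dw : R -> R) (a b : R) :
  (forall t, a <= t <= b -> is_derive w t (dw t)) -> w a <= 0 ->
  (forall t, a <= t < b -> w t = 0 -> (forall s, a <= s <= t -> w s <= 0) -> dw t < 0) ->
  forall t, a <= t <= b -> w t <= 0.
Proof.
  intros Hd Ha Hb. apply real_induction; [exact Ha| |].
  - intros t Ht Hle.
    destruct (Req_dec (w t) 0) as [H0|H0].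
    + specialize (Hb t Ht H0 Hle).
      destruct (is_derive_eps w t _ (Hd t ltac:(lra)) (- dw t / 2) ltac:(lra)) as [del [Hdel Hs]].
      exists del; split; [exact Hdel|]. intros s Hs'.
      specialize (Hs s). rewrite (Rabs_pos_eq (s - t)) in Hs by lra.
      specialize (Hs ltac:(lra)). apply Rabs_le_between in Hs. nra.
    + assert (w t < 0) by (specialize (Hle t ltac:(lra)); lra).
      destruct (is_derive_cont w t _ (Hd t ltac:(lra)) (- w t) ltac:(lra)) as [del [Hdel Hs]].
      exists del; split; [exact Hdel|]. intros s Hs'.
      specialize (Hs s). rewrite (Rabs_pos_eq (s - t)) in Hs by lra.
      specialize (Hs ltac:(lra)). apply Rabs_def2 in Hs. lra.
  - intros t Ht Hlt. destruct (Rle_lt_dec (w t) 0) as [H|H]; [exact H|exfalso].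
    destruct (is_derive_cont w t _ (Hd t ltac:(lra)) (w t) H) as [del [Hdel Hs]].
    set (s := Rmax a (t - del / 2)).
    assert (a <= s < t /\ t - del < s) by (unfold s, Rmax; destruct Rle_dec; lra).
    specialize (Hs s ltac:(rewrite Rabs_left; lra)). apply Rabs_def2 in Hs.
    specialize (Hlt s ltac:(lra)). lra.
Qed.

(** Without a first zero, strict negativity would propagate up to [b] by real induction. *)
Lemma first_nonneg (x dx : R -> R) (a b : R) :
  (forall t, a <= t <= b -> is_derive x t (dx t)) -> a <= b -> x a < 0 -> 0 <= x b ->
  exists t1, a < t1 <= b /\ x t1 = 0 /\ forall t, a <= t < t1 -> x t < 0.
Proof.
  intros Hd Hab Ha Hb. apply NNPP; intro Hno.
  assert (H : forall t, a <= t <= b -> x t < 0).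
  { apply real_induction; [exact Ha| |].
    - intros t Ht Hle. specialize (Hle t ltac:(lra)).
      destruct (is_derive_cont x t _ (Hd t ltac:(lra)) (- x t) ltac:(lra)) as [del [Hdel Hs]].
      exists del; split; [exact Hdel|]. intros s Hs'.
      specialize (Hs s). rewrite (Rabs_pos_eq (s - t)) in Hs by lra.
      specialize (Hs ltac:(lra)). apply Rabs_def2 in Hs. lra.
    - intros t Ht Hlt. destruct (Rlt_le_dec (x t) 0) as [H|H]; [exact H|exfalso].
      destruct (Req_dec (x t) 0) as [H0|H0].
      + apply Hno. exists t. split; [lra|split; [exact H0|exact Hlt]].
      + destruct (is_derive_cont x t _ (Hd t ltac:(lra)) (x t) ltac:(lra)) as [del [Hdel Hs]].
        set (s := Rmax a (t - del / 2)).
        assert (a <= s < t /\ t - del < s) by (unfold s, Rmax; destruct Rle_dec; lra).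
        specialize (Hs s ltac:(rewrite Rabs_left; lra)). apply Rabs_def2 in Hs.
        specialize (Hlt s ltac:(lra)). lra. }
  specialize (H b ltac:(lra)). lra.
Qed.

Lemma mean_value (w dw : R -> R) (a b : R) :
  a <= b -> (forall t, a <= t <= b -> is_derive w t (dw t)) ->
  exists c, a <= c <= b /\ w b - w a = dw c * (b - a).
Proof.
  intros Hab Hd.
  destruct (MVT_gen w a b dw) as [c [Hc1 Hc2]].
  - rewrite Rmin_left, Rmax_right by lra. intros x Hx. apply Hd; lra.
  - rewrite Rmin_left, Rmax_right by lra. intros x Hx.
    apply derivable_continuous_pt. exists (dw x). apply is_derive_Reals, Hd; lra.
  - rewrite Rmin_left, Rmax_right in Hc1 by lra. exists c; split; assumption.
Qed.

Lemma mean_value_lower (w dw : R -> R) (a b c : R) :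
  a <= b -> (forall t, a <= t <= b -> is_derive w t (dw t)) ->
  (forall t, a <= t <= b -> c <= dw t) -> c * (b - a) <= w b - w a.
Proof.
  intros Hab Hd Hc. destruct (mean_value w dw a b Hab Hd) as [m [Hm ->]].
  apply Rmult_le_compat_r; [lra|apply Hc, Hm].
Qed.

Lemma mean_value_upper (w dw : R -> R) (a b c : R) :
  a <= b -> (forall t, a <= t <= b -> is_derive w t (dw t)) ->
  (forall t, a <= t <= b -> dw t <= c) -> w b - w a <= c * (b - a).
Proof.
  intros Hab Hd Hc. destruct (mean_value w dw a b Hab Hd) as [m [Hm ->]].
  apply Rmult_le_compat_r; [lra|apply Hc, Hm].
Qed.

Lemma mean_value_abs (w dw : R -> R) (c : R) :
  (forall t, is_derive w t (dw t)) -> (forall t, Rabs (dw t) <= c) ->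
  forall a b, Rabs (w b - w a) <= c * Rabs (b - a).
Proof.
  intros Hd Hc.
  assert (H : forall a b, a <= b -> Rabs (w b - w a) <= c * Rabs (b - a)).
  { intros a b Hab. destruct (mean_value w dw a b Hab (fun t _ => Hd t)) as [m [Hm ->]].
    rewrite Rabs_mult. apply Rmult_le_compat_r; [apply Rabs_pos|apply Hc]. }
  intros a b. destruct (Rle_lt_dec a b) as [Hab|Hab]; [apply H, Hab|].
  rewrite Rabs_minus_sym, (Rabs_minus_sym b a). apply H; lra.
Qed.

(** The function [(E + c / K) * exp (- K * t)] is nonincreasing. Negative [K] is allowed: the fast
    contraction is exploited with [K = - / eps]. *)
Lemma gronwall (E dE : R -> R) (K c a b : R) :
  K <> 0 -> a <= b -> (forall t, a <= t <= b -> is_derive E t (dE t)) ->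
  (forall t, a <= t <= b -> dE t <= K * E t + c) ->
  E b + c / K <= (E a + c / K) * exp (K * (b - a)).
Proof.
  intros HK Hab Hd Hle.
  assert (H : (E b + c / K) * exp (- K * b) - (E a + c / K) * exp (- K * a) <= 0 * (b - a)).
  { apply (mean_value_upper (fun t => (E t + c / K) * exp (- K * t))
     (fun t => (dE t - K * E t - c) * exp (- K * t))); [exact Hab| |].
    - intros t Ht. specialize (Hd t Ht).
      auto_derive; [exists (dE t); exact Hd|].
      replace (Derive (fun x => E x) t) with (dE t) by (symmetry; apply is_derive_unique, Hd).
      field. lra.
    - intros t Ht. specialize (Hle t Ht). pose proof (exp_pos (- K * t)). nra. }
  replace (exp (K * (b - a))) with (exp (- K * a) * / exp (- K * b)).
  - pose proof (exp_pos (- K * b)). 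
    apply Rmult_le_reg_r with (exp (- K * b)); [assumption|].
    replace ((E a + c / K) * (exp (- K * a) * / exp (- K * b)) * exp (- K * b))
      with ((E a + c / K) * exp (- K * a)) by (field; lra). lra.
  - rewrite <- exp_Ropp, <- exp_plus. f_equal. ring.
Qed.

(** * The Poincare-Miranda theorem in the plane *)

(** A cubical form of Sperner's lemma. [a] and [b] are the signs of two functions at grid points,
    and the conclusion is a cell on whose corners neither sign is constant. *)
Lemma parity_columns (N : nat) (a b : nat -> nat -> bool) :
  (forall j, a 0%nat j = false) -> (forall j, a N j = true) ->
  (forall i, b i 0%nat = false) -> (forall i, b i N = true) ->
  exists i j, (i < N)%nat /\ (j < N)%nat /\
   ~ (a i j = a (S i) j /\ a i j = a i (S j) /\ a i j = a (S i) (S j)) /\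
   ~ (b i j = b (S i) j /\ b i j = b i (S j) /\ b i j = b (S i) (S j)).
Proof.
  intros Ha0 HaN Hb0 HbN. apply NNPP; intro Hno.
  (* Doors are edges whose endpoints satisfy [a] and differ in [b]. Every cell has an even
     number of them on its boundary, so all columns have the same parity of doors. *)
  set (door := fun i j i' j' => andb (andb (a i j) (a i' j')) (xorb (b i j) (b i' j'))).
  assert (Hcell : forall i j, (i < N)%nat -> (j < N)%nat ->
    xorb (xorb (door i j i (S j)) (door (S i) j (S i) (S j)))
         (xorb (door i j (S i) j) (door i (S j) (S i) (S j))) = false).
  { intros i j Hi Hj. 
    destruct (classic ((a i j = a (S i) j /\ a i j = a i (S j) /\ a i j = a (S i) (S j)) \/
      (b i j = b (S i) j /\ b i j = b i (S j) /\ b i j = b (S i) (S j)))) as [H|H].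
    - unfold door.
      destruct H as [[H1 [H2 H3]]|[H1 [H2 H3]]];
      destruct (a i j), (a (S i) j), (a i (S j)), (a (S i) (S j)),
       (b i j), (b (S i) j), (b i (S j)), (b (S i) (S j)); simpl; congruence.
    - exfalso. apply Hno. exists i, j. tauto. }
  (* [col i j] is the parity of the doors on the vertical grid line [i] up to height [j]. Summing
     the cell identity over a strip leaves only its top edge, the bottom edge being no door because
     [b] is false there. *)
  set (col := fun i => fix col j := match j with O => false
     | S j => xorb (col j) (door i j i (S j)) end).
  assert (Hstrip : forall i j, (i < N)%nat -> (j <= N)%nat ->
     xorb (col i j) (col (S i) j) = door i j (S i) j).
  { intros i j Hi. induction j as [|j IH]; intro Hj.
    - simpl. unfold door. rewrite !Hb0. simpl. rewrite Bool.andb_false_r. reflexivity.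
    - specialize (IH ltac:(lia)). specialize (Hcell i j Hi ltac:(lia)). simpl.
      destruct (col i j), (col (S i) j), (door i j i (S j)), (door (S i) j (S i) (S j)),
        (door i j (S i) j), (door i (S j) (S i) (S j)); simpl in *; congruence. }
  assert (Hcol : forall i, (i <= N)%nat -> col i N = false).
  { intros i. induction i as [|i IH]; intro Hi.
    - assert (forall j, col 0%nat j = false) as ->; [|reflexivity].
      intro j; induction j as [|j IHj]; [reflexivity|]. simpl. rewrite IHj.
      unfold door. rewrite !Ha0. reflexivity.
    - specialize (IH ltac:(lia)). specialize (Hstrip i N ltac:(lia) ltac:(lia)).
      unfold door in Hstrip. rewrite !HbN, Bool.andb_false_r, IH in Hstrip.
      destruct (col (S i) N); simpl in *; congruence. }
  (* On the last line [a] is true throughout, so doors are the changes of [b]. Since [b] passes from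
     false to true their number is odd, against the even count inherited from line [0]. *)
  assert (HN : forall j, col N j = b N j).
  { intro j; induction j as [|j IHj]; [simpl; rewrite Hb0; reflexivity|].
    simpl. rewrite IHj. unfold door. rewrite !HaN. simpl.
    destruct (b N j), (b N (S j)); reflexivity. }
  specialize (Hcol N (le_n _)). rewrite HN, HbN in Hcol. discriminate.
Qed.

Definition cont_square (H : R -> R -> R) : Prop :=
  forall x y, 0 <= x <= 1 -> 0 <= y <= 1 -> forall e, 0 < e ->
  exists del, 0 < del /\ forall x' y', 0 <= x' <= 1 -> 0 <= y' <= 1 ->
    Rabs (x' - x) < del -> Rabs (y' - y) < del -> Rabs (H x' y' - H x y) < e.

(** Without a common zero every point has a neighbourhood where [H1] or [H2] keeps its positivity or
    nonpositivity. A grid finer than a Lebesgue number of this covering then contradicts the parity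
    lemma. *)
Lemma poincare_miranda (H1 H2 : R -> R -> R) :
  cont_square H1 -> cont_square H2 ->
  (forall y, 0 <= y <= 1 -> H1 0 y < 0) -> (forall y, 0 <= y <= 1 -> 0 < H1 1 y) ->
  (forall x, 0 <= x <= 1 -> H2 x 0 < 0) -> (forall x, 0 <= x <= 1 -> 0 < H2 x 1) ->
  exists x y, 0 <= x <= 1 /\ 0 <= y <= 1 /\ H1 x y = 0 /\ H2 x y = 0.
Proof.
  intros C1 C2 Hl Hr Hb Ht. apply NNPP; intro Hno.
  set (good := fun (x y : R) (del : posreal) => 0 <= x <= 1 -> 0 <= y <= 1 ->
    (forall x' y' x'' y'', 0 <= x' <= 1 -> 0 <= y' <= 1 -> 0 <= x'' <= 1 -> 0 <= y'' <= 1 ->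
     Rabs (x' - x) < del -> Rabs (y' - y) < del -> Rabs (x'' - x) < del -> Rabs (y'' - y) < del ->
     0 < H1 x' y' -> 0 < H1 x'' y'') \/
    (forall x' y' x'' y'', 0 <= x' <= 1 -> 0 <= y' <= 1 -> 0 <= x'' <= 1 -> 0 <= y'' <= 1 ->
     Rabs (x' - x) < del -> Rabs (y' - y) < del -> Rabs (x'' - x) < del -> Rabs (y'' - y) < del ->
     0 < H2 x' y' -> 0 < H2 x'' y'')).
  assert (Hgood : forall H, cont_square H -> forall x y, 0 <= x <= 1 -> 0 <= y <= 1 -> H x y <> 0 ->
    exists del : posreal,
    (forall x' y' x'' y'', 0 <= x' <= 1 -> 0 <= y' <= 1 -> 0 <= x'' <= 1 -> 0 <= y'' <= 1 ->
     Rabs (x' - x) < del -> Rabs (y' - y) < del -> Rabs (x'' - x) < del -> Rabs (y'' - y) < del ->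
     0 < H x' y' -> 0 < H x'' y'')).
  { intros H HC x y Hx Hy Hne.
    destruct (HC x y Hx Hy (Rabs (H x y)) (Rabs_pos_lt _ Hne)) as [del [Hdel Hd]].
    exists (mkposreal del Hdel). simpl. intros x' y' x'' y'' ? ? ? ? ? ? ? ? Hpos.
    pose proof (Hd x' y' ltac:(assumption) ltac:(assumption) ltac:(assumption) ltac:(assumption)) as K1.
    pose proof (Hd x'' y'' ltac:(assumption) ltac:(assumption) ltac:(assumption) ltac:(assumption)) as K2.
    apply Rabs_def2 in K1. apply Rabs_def2 in K2.
    destruct (Rle_lt_dec 0 (H x y)).
    - rewrite Rabs_pos_eq in K1, K2 by assumption. lra.
    - rewrite Rabs_left in K1, K2 by assumption. lra. }
  assert (Hex : forall x y, exists del, good x y del).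
  { intros x y. unfold good.
    destruct (classic (0 <= x <= 1 /\ 0 <= y <= 1)) as [[Hx Hy]|Hn].
    2:{ exists (mkposreal 1 Rlt_0_1). tauto. }
    destruct (Req_dec (H1 x y) 0) as [E1|E1].
    - destruct (Hgood H2 C2 x y Hx Hy) as [del Hd].
      { intro E2. apply Hno. exists x, y. tauto. }
      exists del. intros _ _. right. exact Hd.
    - destruct (Hgood H1 C1 x y Hx Hy E1) as [del Hd].
      exists del. intros _ _. left. exact Hd. }
  destruct (functional_choice (fun p del => good (fst p) (snd p) del)
    (fun p => Hex (fst p) (snd p))) as [D0 HD0].
  set (D := fun x y => D0 (x, y)).
  assert (HD : forall x y, good x y (D x y)) by (intros x y; exact (HD0 (x, y))).
  (* Half of the radius locates one corner of a cell, the other half pays for the mesh, so that all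
     four corners fall into the same neighbourhood. *)
  assert (HDp : forall x y, 0 < D x y / 2) by (intros; pose proof (cond_pos (D x y)); lra).
  destruct (compactness_value_2d 0 1 0 1 (fun x y => mkposreal _ (HDp x y))) as [d Hd].
  destruct (archimed_cor1 d (cond_pos d)) as [N [HN1 HN2]].
  assert (HNp : 0 < INR N) by (apply lt_0_INR, HN2).
  (* Capping the index at [N] keeps [p i] in [[0, 1]] for every [i]. *)
  set (p := fun i => INR (min i N) / INR N).
  assert (Hp : forall i, 0 <= p i <= 1).
  { intro i. unfold p. pose proof (pos_INR (min i N)).
    assert (INR (min i N) <= INR N) by (apply le_INR; lia).
    split; [apply Rdiv_le_0_compat; lra|apply Rle_div_l; lra]. }
  assert (Hp0 : p 0%nat = 0) by (unfold p; simpl; field; lra).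
  assert (HpN : p N = 1) by (unfold p; rewrite Nat.min_id; field; lra).
  assert (Hstep : forall i, Rabs (p (S i) - p i) < d).
  { intro i. unfold p. destruct (Nat.le_gt_cases N i).
    - rewrite !Nat.min_r by lia. rewrite Rminus_diag, Rabs_R0. apply cond_pos.
    - rewrite !Nat.min_l by lia. rewrite S_INR.
      replace ((INR i + 1) / INR N - INR i / INR N) with (/ INR N) by (field; lra).
      rewrite Rabs_pos_eq; [exact HN1|]. left; apply Rinv_0_lt_compat, HNp. }
  set (sg := fun (H : R -> R -> R) i j => if Rlt_dec 0 (H (p i) (p j)) then true else false).
  assert (Hsg : forall H i j, sg H i j = true <-> 0 < H (p i) (p j)).
  { intros H i j. unfold sg. destruct Rlt_dec; split; intro; congruence || lra. }
  destruct (parity_columns N (sg H1) (sg H2)) as [i [j [Hi [Hj [NA NB]]]]].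
  - intro j. unfold sg. rewrite Hp0. destruct Rlt_dec; [|reflexivity]. specialize (Hl (p j) (Hp j)). lra.
  - intro j. unfold sg. rewrite HpN. destruct Rlt_dec; [reflexivity|]. specialize (Hr (p j) (Hp j)). lra.
  - intro i. unfold sg. rewrite Hp0. destruct Rlt_dec; [|reflexivity]. specialize (Hb (p i) (Hp i)). lra.
  - intro i. unfold sg. rewrite HpN. destruct Rlt_dec; [reflexivity|]. specialize (Ht (p i) (Hp i)). lra.
  - apply (Hd (p i) (p j) (Hp i) (Hp j)). intros (u & v & Hu & Hv & Hiu & Hjv & Hdd). simpl in *.
    pose proof (HDp u v) as HDuv.
    assert (Hnear : forall k m t, (m = k \/ m = S k) -> Rabs (p k - t) < D u v / 2 -> Rabs (p m - t) < D u v).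
    { intros k m t [->| ->] Hk; [lra|].
      replace (p (S k) - t) with ((p (S k) - p k) + (p k - t)) by ring.
      eapply Rle_lt_trans; [apply Rabs_triang|]. specialize (Hstep k). lra. }
    assert (HX : forall H,
     (forall x' y' x'' y'', 0 <= x' <= 1 -> 0 <= y' <= 1 -> 0 <= x'' <= 1 -> 0 <= y'' <= 1 ->
     Rabs (x' - u) < D u v -> Rabs (y' - v) < D u v -> Rabs (x'' - u) < D u v -> Rabs (y'' - v) < D u v ->
     0 < H x' y' -> 0 < H x'' y'') ->
     forall i1 j1, (i1 = i \/ i1 = S i) -> (j1 = j \/ j1 = S j) -> sg H i j = sg H i1 j1).
    { intros H HH i1 j1 Hi1 Hj1.
      apply Bool.eq_iff_eq_true. rewrite !Hsg.
      split; apply HH; auto; eapply Hnear; eauto. }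
    destruct (HD u v Hu Hv) as [G|G]; [apply NA|apply NB];
      repeat split; apply HX; auto.
Qed.

(** * Global solutions of Lipschitz systems *)

(** The sum norm keeps all estimates linear in the single differences. *)
Definition lip3 (F : R -> R -> R -> R) (L : R) : Prop :=
  forall x y z x' y' z',
  Rabs (F x y z - F x' y' z') <= L * (Rabs (x - x') + Rabs (y - y') + Rabs (z - z')).

Definition sol3 (F1 F2 F3 : R -> R -> R -> R) (x y z : R -> R) : Prop :=
  forall t, is_derive x t (F1 (x t) (y t) (z t)) /\
            is_derive y t (F2 (x t) (y t) (z t)) /\
            is_derive z t (F3 (x t) (y t) (z t)).

Lemma continuous_eps (f : R -> R) t :
  continuous f t <-> forall e, 0 < e -> exists del, 0 < del /\
    forall s, Rabs (s - t) < del -> Rabs (f s - f t) < e.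
Proof.
  split.
  - intros H e He. destruct (proj1 (filterlim_locally f (f t)) H (mkposreal e He)) as [del Hd].
    exists del. split; [apply cond_pos|]. intros s Hs. exact (Hd s Hs).
  - intros H. apply (proj2 (filterlim_locally f (f t))). intros [e He].
    destruct (H e He) as [del [Hdel Hd]]. exists (mkposreal del Hdel). intros s Hs. exact (Hd s Hs).
Qed.

Lemma lip3_continuous F L (x y z : R -> R) t : 0 < L -> lip3 F L ->
  continuous x t -> continuous y t -> continuous z t ->
  continuous (fun s => F (x s) (y s) (z s)) t.
Proof.
  intros HL HF Hx Hy Hz. apply continuous_eps. intros e He.
  assert (He3 : 0 < e / (3 * L)) by (apply Rdiv_lt_0_compat; lra).
  destruct (proj1 (continuous_eps x t) Hx _ He3) as [d1 [Hd1 H1]].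
  destruct (proj1 (continuous_eps y t) Hy _ He3) as [d2 [Hd2 H2]].
  destruct (proj1 (continuous_eps z t) Hz _ He3) as [d3 [Hd3 H3]].
  exists (Rmin d1 (Rmin d2 d3)). split; [repeat apply Rmin_pos; assumption|].
  intros s Hs. apply Rmin_Rgt in Hs. destruct Hs as [Hs1 Hs]. apply Rmin_Rgt in Hs. destruct Hs as [Hs2 Hs3].
  specialize (H1 s Hs1). specialize (H2 s Hs2). specialize (H3 s Hs3).
  eapply Rle_lt_trans; [apply HF|].
  replace e with (L * (e / (3 * L) + e / (3 * L) + e / (3 * L))) by (field; lra).
  apply Rmult_lt_compat_l; lra.
Qed.

Lemma exp_bound_pos (H h : R -> R) c K t :
  0 < K -> 0 <= t -> H 0 = 0 -> (forall s, is_derive H s (h s)) ->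
  (forall s, 0 <= s -> Rabs (h s) <= c * exp (K * s)) -> Rabs (H t) <= c / K * exp (K * t).
Proof.
  intros HK Ht H0 Hd Hb.
  assert (Hc : 0 <= c).
  { specialize (Hb 0 (Rle_refl _)). rewrite Rmult_0_r, exp_0 in Hb. pose proof (Rabs_pos (h 0)). lra. }
  assert (Hk : 0 <= c / K) by (apply Rdiv_le_0_compat; lra).
  assert (D : forall s, is_derive (fun s => c / K * exp (K * s)) s (c * exp (K * s))).
  { intro s. auto_derive; [exact I|]. field. lra. }
  assert (U : H t - c / K * exp (K * t) - (H 0 - c / K * exp (K * 0)) <= 0 * (t - 0)).
  { apply (mean_value_upper (fun s => H s - c / K * exp (K * s)) (fun s => h s - c * exp (K * s))); [lra| |].
    - intros s _. apply (is_derive_minus (V := R_NormedModule)); [apply Hd|apply D].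
    - intros s Hs. specialize (Hb s ltac:(lra)). apply Rabs_le_between in Hb. lra. }
  assert (U' : 0 * (t - 0) <= H t + c / K * exp (K * t) - (H 0 + c / K * exp (K * 0))).
  { apply (mean_value_lower (fun s => H s + c / K * exp (K * s)) (fun s => h s + c * exp (K * s))); [lra| |].
    - intros s _. apply (is_derive_plus (V := R_NormedModule)); [apply Hd|apply D].
    - intros s Hs. specialize (Hb s ltac:(lra)). apply Rabs_le_between in Hb. lra. }
  rewrite Rmult_0_r, exp_0 in U, U'. apply Rabs_le. lra.
Qed.

(** Integration from [0] gains the factor [1 / K] in the norm weighted by [exp (- K * |t|)]. With
    [K] large the Picard operator contracts on the whole line at once, and no local solutions have
    to be patched together. *)
Lemma RInt_exp_bound (h : R -> R) c K t :
  0 < K -> (forall s, continuous h s) ->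
  (forall s, Rabs (h s) <= c * exp (K * Rabs s)) ->
  Rabs (RInt h 0 t) <= c / K * exp (K * Rabs t).
Proof.
  intros HK Hc Hb.
  set (H := fun t => RInt h 0 t).
  assert (HH : forall s, is_derive H s (h s)).
  { intro s. apply (is_derive_RInt (V := R_CompleteNormedModule)) with 0; [|apply Hc].
    exists (mkposreal 1 Rlt_0_1). intros r _. apply RInt_correct.
    apply (ex_RInt_continuous (V := R_CompleteNormedModule)). intros; apply Hc. }
  assert (H0 : H 0 = 0) by (unfold H; rewrite RInt_point; reflexivity).
  destruct (Rle_lt_dec 0 t) as [Ht|Ht].
  - rewrite (Rabs_pos_eq t) by assumption. apply (exp_bound_pos H h); auto.
    intros s Hs. specialize (Hb s). rewrite (Rabs_pos_eq s) in Hb by assumption. exact Hb.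
  - rewrite (Rabs_left t) by assumption.
    pose proof (exp_bound_pos (fun s => H (- s)) (fun s => - h (- s)) c K (- t)) as Q.
    simpl in Q. rewrite Ropp_involutive in Q. apply Q; try lra.
    + rewrite Ropp_0; exact H0.
    + intro s. replace (- h (- s)) with (scal (-1) (h (- s))) by (unfold scal; simpl; unfold mult; simpl; ring).
      apply (is_derive_comp H (fun s => - s)); [apply HH|]. auto_derive; [exact I|ring].
    + intros s Hs. rewrite Rabs_Ropp. specialize (Hb (- s)). rewrite Rabs_Ropp, (Rabs_pos_eq s) in Hb by assumption. exact Hb.
Qed.

Lemma exp_mono a b : a <= b -> exp a <= exp b.
Proof. intros [H| ->]; [left; apply exp_increasing, H|lra]. Qed.

(** Indexing the components lets every Picard estimate be proved once for all three. *)
Inductive coord := C1 | C2 | C3.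

Section Picard.
Variables (F : coord -> R -> R -> R -> R) (L : R) (p : coord -> R).
Hypothesis HL : 0 < L.
Hypothesis HF : forall c, lip3 (F c) L.

Definition along (u : R -> coord -> R) (c : coord) (s : R) : R := F c (u s C1) (u s C2) (u s C3).

Definition integral (u : R -> coord -> R) (c : coord) (t : R) : R := RInt (along u c) 0 t.

Fixpoint picard (n : nat) (t : R) (c : coord) : R :=
  match n with
  | O => p c
  | S n => p c + integral (picard n) c t
  end.

Lemma along_continuous u : (forall c t, continuous (fun t => u t c) t) ->
  forall c t, continuous (along u c) t.
Proof.
  intros Hu c t. apply (lip3_continuous (F c) L (fun s => u s C1) (fun s => u s C2) (fun s => u s C3)); auto.
Qed.

Lemma integral_derive u : (forall c t, continuous (fun t => u t c) t) ->
  forall c t, is_derive (fun t => p c + integral u c t) t (along u c t).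
Proof.
  intros Hu c t.
  replace (along u c t) with (plus 0 (along u c t)) by (unfold plus; simpl; ring).
  apply (is_derive_plus (V := R_NormedModule)); [apply (is_derive_const (V := R_NormedModule))|].
  apply (is_derive_RInt (V := R_CompleteNormedModule)) with 0; [|apply along_continuous, Hu].
  exists (mkposreal 1 Rlt_0_1). intros r _. apply RInt_correct.
  apply (ex_RInt_continuous (V := R_CompleteNormedModule)). intros; apply along_continuous, Hu.
Qed.

Lemma picard_continuous n : forall c t, continuous (fun t => picard n t c) t.
Proof.
  induction n as [|n IH]; intros c t; simpl.
  - apply continuous_const.
  - apply (ex_derive_continuous (V := R_NormedModule)).
    exists (along (picard n) c t). apply integral_derive, IH.
Qed.

(** A difference of size [d] in each of the three components changes the field by at most
    [3 * L * d]; dividing by [6 * L] gives the contraction factor [1 / 2]. *)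
Definition picard_rate := 6 * L.
Definition picard_const := (Rabs (along (fun _ => p) C1 0) + Rabs (along (fun _ => p) C2 0)
   + Rabs (along (fun _ => p) C3 0)) / picard_rate.

Lemma picard_rate_pos : 0 < picard_rate. Proof. unfold picard_rate; lra. Qed.

Lemma picard_const_pos : 0 <= picard_const.
Proof.
  unfold picard_const. apply Rdiv_le_0_compat; [|apply picard_rate_pos].
  repeat apply Rplus_le_le_0_compat; apply Rabs_pos.
Qed.

Lemma RInt_along_diff u v d : (forall c t, continuous (fun t => u t c) t) ->
  (forall c t, continuous (fun t => v t c) t) ->
  (forall c t, Rabs (u t c - v t c) <= d * exp (picard_rate * Rabs t)) ->
  forall c t, Rabs (integral u c t - integral v c t) <= d / 2 * exp (picard_rate * Rabs t).
Proof.
  intros Hu Hv Hd c t.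
  replace (integral u c t - integral v c t)
    with (RInt (fun s => along u c s - along v c s) 0 t).
  - replace (d / 2) with (3 * L * d / picard_rate) by (unfold picard_rate; field; lra).
    apply RInt_exp_bound; [apply picard_rate_pos| |].
    + intro s. apply (continuous_minus (V := R_NormedModule)); apply along_continuous; assumption.
    + intro s. unfold along. eapply Rle_trans; [apply HF|].
      pose proof (Hd C1 s). pose proof (Hd C2 s). pose proof (Hd C3 s). nra.
  - apply (RInt_minus (V := R_CompleteNormedModule));
    apply (ex_RInt_continuous (V := R_CompleteNormedModule)); intros; apply along_continuous; assumption.
Qed.

Lemma picard_step n : forall c t,
  Rabs (picard (S n) t c - picard n t c) <= picard_const * (/ 2) ^ n * exp (picard_rate * Rabs t).
Proof.
  induction n as [|n IH]; intros c t.
  - simpl. rewrite Rmult_1_r.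
    rewrite Rplus_minus_l. change (fun (_ : R) (c : coord) => p c) with (fun _ : R => p).
    unfold picard_const at 1. apply RInt_exp_bound; [apply picard_rate_pos| |].
    + intro s. apply along_continuous. intros; apply continuous_const.
    + intro s. 
      assert (1 <= exp (picard_rate * Rabs s)).
      { pose proof (exp_ineq1_le (picard_rate * Rabs s)). pose proof picard_rate_pos. pose proof (Rabs_pos s). nra. }
      pose proof (Rabs_pos (along (fun _ => p) C1 0)). pose proof (Rabs_pos (along (fun _ => p) C2 0)).
      pose proof (Rabs_pos (along (fun _ => p) C3 0)).
      change (along (fun _ => p) c s) with (along (fun _ => p) c 0).
      destruct c; nra.
  - change (Rabs (p c + integral (picard (S n)) c t - (p c + integral (picard n) c t))
      <= picard_const * (/ 2 * (/ 2) ^ n) * exp (picard_rate * Rabs t)).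
    replace (p c + integral (picard (S n)) c t - (p c + integral (picard n) c t))
     with (integral (picard (S n)) c t - integral (picard n) c t) by ring.
    replace (picard_const * (/ 2 * (/ 2) ^ n)) with (picard_const * (/ 2) ^ n / 2) by field.
    apply RInt_along_diff; auto using picard_continuous.
Qed.

Lemma half_pow_pos n : 0 < (/ 2) ^ n.
Proof. apply pow_lt; lra. Qed.

Lemma picard_gap n k c t :
  Rabs (picard (n + k) t c - picard n t c) <= 2 * picard_const * (/ 2) ^ n * exp (picard_rate * Rabs t).
Proof.
  (* The sharper bound with the tail [(/ 2) ^ (n + k)] subtracted is the one that telescopes under
     induction on [k]. *)
  assert (H : Rabs (picard (n + k) t c - picard n t c)
    <= 2 * picard_const * ((/ 2) ^ n - (/ 2) ^ (n + k)) * exp (picard_rate * Rabs t)).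
  { induction k as [|k IH].
    - rewrite Nat.add_0_r, !Rminus_diag, Rabs_R0. lra.
    - rewrite Nat.add_succ_r.
      replace (picard (S (n + k)) t c - picard n t c) with
       ((picard (S (n + k)) t c - picard (n + k) t c) + (picard (n + k) t c - picard n t c)) by ring.
      eapply Rle_trans; [apply Rabs_triang|]. pose proof (picard_step (n + k) c t).
      simpl pow. lra. }
  eapply Rle_trans; [exact H|]. pose proof (half_pow_pos (n + k)). pose proof picard_const_pos.
  pose proof (exp_pos (picard_rate * Rabs t)).
  apply Rmult_le_compat_r; [lra|]. nra.
Qed.

Lemma half_pow_small A e : 0 < e -> exists n, A * (/ 2) ^ n < e.
Proof.
  intros He. 
  assert (H : is_lim_seq (fun n => A * (/ 2) ^ n) 0).
  { replace (Finite 0) with (Rbar_mult A 0) by (simpl; f_equal; ring).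
    apply is_lim_seq_scal_l, is_lim_seq_geom. rewrite Rabs_pos_eq; lra. }
  apply is_lim_seq_spec in H. destruct (H (mkposreal e He)) as [n Hn]. exists n.
  specialize (Hn n (le_n _)). simpl in Hn. apply Rabs_def2 in Hn. lra.
Qed.

Definition picard_lim (t : R) (c : coord) : R := real (Lim_seq (fun n => picard n t c)).

Lemma picard_lim_gap n t c :
  Rabs (picard_lim t c - picard n t c) <= 2 * picard_const * (/ 2) ^ n * exp (picard_rate * Rabs t).
Proof.
  assert (Hl : is_lim_seq (fun n => picard n t c) (picard_lim t c)).
  { apply Lim_seq_correct', ex_lim_seq_cauchy_corr. intro e.
    destruct (half_pow_small (4 * picard_const * exp (picard_rate * Rabs t)) e (cond_pos e)) as [N HN].
    exists N. intros m k Hm Hk.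
    replace m with (N + (m - N))%nat by lia. replace k with (N + (k - N))%nat by lia.
    pose proof (picard_gap N (m - N) c t). pose proof (picard_gap N (k - N) c t).
    replace (picard (N + (m - N)) t c - picard (N + (k - N)) t c) with
      ((picard (N + (m - N)) t c - picard N t c) - (picard (N + (k - N)) t c - picard N t c)) by ring.
    eapply Rle_lt_trans; [apply Rabs_triang|]. rewrite Rabs_Ropp. lra. }
  apply (is_lim_seq_incr_n _ n) in Hl.
  assert (H1 : is_lim_seq (fun k => Rabs (picard (k + n) t c - picard n t c)) (Rabs (picard_lim t c - picard n t c))).
  { apply (is_lim_seq_abs _ (Finite (picard_lim t c - picard n t c))).
    apply is_lim_seq_minus'; [exact Hl|apply is_lim_seq_const]. }
  apply (is_lim_seq_le _ (fun _ => 2 * picard_const * (/ 2) ^ n * exp (picard_rate * Rabs t)) _ _) with (2 := H1) (3 := is_lim_seq_const _).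
  intro k. rewrite Nat.add_comm. apply picard_gap.
Qed.

Lemma picard_lim_continuous c t : continuous (fun t => picard_lim t c) t.
Proof.
  apply continuous_eps. intros e He.
  destruct (half_pow_small (2 * picard_const * exp (picard_rate * (Rabs t + 1))) (e / 3) ltac:(lra)) as [n Hn].
  assert (Hcl : forall s, Rabs (s - t) < 1 -> Rabs (picard_lim s c - picard n s c) < e / 3).
  { intros s Hs. eapply Rle_lt_trans; [apply picard_lim_gap|]. eapply Rle_lt_trans; [|exact Hn].
    assert (exp (picard_rate * Rabs s) <= exp (picard_rate * (Rabs t + 1))).
    { apply exp_mono. apply Rmult_le_compat_l; [pose proof picard_rate_pos; lra|].
      replace s with (t + (s - t)) by ring. eapply Rle_trans; [apply Rabs_triang|]. lra. }
    pose proof picard_const_pos. pose proof (half_pow_pos n).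
    assert (0 <= picard_const * (/ 2) ^ n) by (apply Rmult_le_pos; lra). nra. }
  destruct (proj1 (continuous_eps _ _) (picard_continuous n c t) (e / 3) ltac:(lra)) as [del [Hdel Hd]].
  exists (Rmin 1 del). split; [apply Rmin_pos; lra|]. intros s Hs.
  apply Rmin_Rgt in Hs. destruct Hs as [Hs1 Hs2].
  specialize (Hd s Hs2). pose proof (Hcl s Hs1) as A1.
  pose proof (Hcl t ltac:(rewrite Rminus_diag, Rabs_R0; lra)) as A2.
  apply Rabs_def2 in Hd. apply Rabs_def2 in A1. apply Rabs_def2 in A2. apply Rabs_def1; lra.
Qed.

(** Both sides are compared with [picard (S n)]; the two errors add up to a multiple of
    [(/ 2) ^ n]. *)
Lemma picard_lim_integral c t : picard_lim t c = p c + integral picard_lim c t.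
Proof.
  apply Rminus_diag_uniq. apply NNPP; intro Hne. apply Rabs_pos_lt in Hne.
  destruct (half_pow_small (2 * picard_const * exp (picard_rate * Rabs t)) (Rabs (picard_lim t c - (p c + integral picard_lim c t))) Hne) as [n Hn].
  apply (Rlt_not_le _ _ Hn).
  pose proof (picard_lim_gap (S n) t c) as G.
  assert (G' : Rabs (integral (picard n) c t - integral picard_lim c t) <= 
     2 * picard_const * (/ 2) ^ n / 2 * exp (picard_rate * Rabs t)).
  { apply RInt_along_diff; [apply picard_continuous|apply picard_lim_continuous|].
    intros. rewrite Rabs_minus_sym. apply picard_lim_gap. }
  change (picard (S n) t c) with (p c + integral (picard n) c t) in G.
  replace (picard_lim t c - (p c + integral picard_lim c t)) with
    ((picard_lim t c - (p c + integral (picard n) c t)) + (integral (picard n) c t - integral picard_lim c t)) by ring.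
  eapply Rle_trans; [apply Rabs_triang|]. simpl pow in G. lra.
Qed.

Lemma picard_lim_derive c t : is_derive (fun t => picard_lim t c) t (along picard_lim c t).
Proof.
  apply (is_derive_ext (fun t => p c + integral picard_lim c t)).
  - intro s. symmetry. apply picard_lim_integral.
  - apply integral_derive, picard_lim_continuous.
Qed.

End Picard.

Theorem global_solution F1 F2 F3 L t0 x0 y0 z0 : 0 < L ->
  lip3 F1 L -> lip3 F2 L -> lip3 F3 L ->
  exists x y z, sol3 F1 F2 F3 x y z /\ x t0 = x0 /\ y t0 = y0 /\ z t0 = z0.
Proof.
  intros HL H1 H2 H3.
  set (F := fun c => match c with C1 => F1 | C2 => F2 | C3 => F3 end).
  set (p := fun c => match c with C1 => x0 | C2 => y0 | C3 => z0 end).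
  assert (HF : forall c, lip3 (F c) L) by (intros []; assumption).
  set (u := picard_lim F p).
  exists (fun t => u (t - t0) C1), (fun t => u (t - t0) C2), (fun t => u (t - t0) C3).
  assert (D : forall c t, is_derive (fun t => u (t - t0) c) t (along F u c (t - t0))).
  { intros c t. replace (along F u c (t - t0)) with (scal 1 (along F u c (t - t0)))
      by (unfold scal; simpl; unfold mult; simpl; ring).
    apply (is_derive_comp (fun t => u t c) (fun t => t - t0)).
    - apply (picard_lim_derive F L p HL HF).
    - auto_derive; [exact I|ring]. }
  split; [intro t; split; [apply (D C1)|split; [apply (D C2)|apply (D C3)]]|].
  assert (I : forall c, u (t0 - t0) c = p c).
  { intro c. rewrite Rminus_diag. unfold u. rewrite (picard_lim_integral F L p HL HF). unfold integral. rewrite RInt_point.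
    unfold zero; simpl. ring. }
  split; [apply (I C1)|split; [apply (I C2)|apply (I C3)]].
Qed.

(** * Continuous dependence on the state at a given time *)

Definition sqdist (x y z x' y' z' : R -> R) (t : R) : R :=
  (x t - x' t) ^ 2 + (y t - y' t) ^ 2 + (z t - z' t) ^ 2.

Lemma is_derive_sq (u v : R -> R) t u' v' : is_derive u t u' -> is_derive v t v' ->
  is_derive (fun t => (u t - v t) ^ 2) t (2 * (u t - v t) * (u' - v')).
Proof.
  intros Hu Hv.
  replace (2 * (u t - v t) * (u' - v')) with (scal (u' - v') (2 * (u t - v t)))
    by (unfold scal; simpl; unfold mult; simpl; ring).
  apply (is_derive_comp (fun r => r ^ 2) (fun t => u t - v t)).
  - auto_derive; [exact I|ring].
  - apply (is_derive_minus (V := R_NormedModule)); assumption.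
Qed.

Lemma lip_product_bound d1 d2 d3 e L : 0 <= L ->
  Rabs e <= L * (Rabs d1 + Rabs d2 + Rabs d3) ->
  Rabs (2 * d1 * e) <= 4 * L * (d1 ^ 2 + d2 ^ 2 + d3 ^ 2).
Proof.
  intros HL He. rewrite Rabs_mult, Rabs_mult, (Rabs_pos_eq 2) by lra.
  rewrite <- (pow2_abs d1), <- (pow2_abs d2), <- (pow2_abs d3).
  pose proof (Rabs_pos d1). pose proof (Rabs_pos d2). pose proof (Rabs_pos d3).
  set (a := Rabs d1) in *. set (b := Rabs d2) in *. set (c := Rabs d3) in *.
  apply Rle_trans with (2 * a * (L * (a + b + c))).
  - apply Rmult_le_compat_l; lra.
  - assert (0 <= (a - b) ^ 2) by apply pow2_ge_0. assert (0 <= (a - c) ^ 2) by apply pow2_ge_0.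
    assert (0 <= b ^ 2) by apply pow2_ge_0. assert (0 <= c ^ 2) by apply pow2_ge_0.
    assert (2 * a * (a + b + c) <= 4 * (a ^ 2 + b ^ 2 + c ^ 2)) by nra. nra.
Qed.

(** Gronwall for the squared distance, which is differentiable; each of the three terms of its
    derivative is at most [4 * L] times it. The case [b < a] is reduced to the other by reflecting
    time. Equal states give uniqueness. *)
Theorem solutions_dist F1 F2 F3 L x y z x' y' z' : 0 < L ->
  lip3 F1 L -> lip3 F2 L -> lip3 F3 L ->
  sol3 F1 F2 F3 x y z -> sol3 F1 F2 F3 x' y' z' ->
  forall a b, sqdist x y z x' y' z' b <= sqdist x y z x' y' z' a * exp (12 * L * Rabs (b - a)).
Proof.
  intros HL H1 H2 H3 S S' a b.
  set (E := sqdist x y z x' y' z').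
  set (dE := fun t => 2 * (x t - x' t) * (F1 (x t) (y t) (z t) - F1 (x' t) (y' t) (z' t))
    + 2 * (y t - y' t) * (F2 (x t) (y t) (z t) - F2 (x' t) (y' t) (z' t))
    + 2 * (z t - z' t) * (F3 (x t) (y t) (z t) - F3 (x' t) (y' t) (z' t))).
  assert (HE : forall t, is_derive E t (dE t)).
  { intro t. destruct (S t) as [D1 [D2 D3]]. destruct (S' t) as [D1' [D2' D3']].
    apply (is_derive_plus (V := R_NormedModule)); [apply (is_derive_plus (V := R_NormedModule))|];
    apply is_derive_sq; assumption. }
  assert (Hb : forall t, Rabs (dE t) <= 12 * L * E t).
  { intro t.
    pose proof (lip_product_bound _ _ _ _ _ (Rlt_le _ _ HL) (H1 (x t) (y t) (z t) (x' t) (y' t) (z' t))) as B1.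
    pose proof (lip_product_bound (y t - y' t) (x t - x' t) (z t - z' t) (F2 (x t) (y t) (z t) - F2 (x' t) (y' t) (z' t)) L (Rlt_le _ _ HL)) as B2.
    pose proof (lip_product_bound (z t - z' t) (x t - x' t) (y t - y' t) (F3 (x t) (y t) (z t) - F3 (x' t) (y' t) (z' t)) L (Rlt_le _ _ HL)) as B3.
    specialize (B2 ltac:(eapply Rle_trans; [apply H2|]; lra)).
    specialize (B3 ltac:(eapply Rle_trans; [apply H3|]; lra)).
    unfold dE, E, sqdist.
    eapply Rle_trans; [apply Rabs_triang|]. 
    eapply Rle_trans; [apply Rplus_le_compat_r, Rabs_triang|]. lra. }
  destruct (Rle_lt_dec a b) as [Hab|Hab].
  - rewrite Rabs_pos_eq by lra.
    pose proof (gronwall E dE (12 * L) 0 a b ltac:(lra) Hab (fun t _ => HE t)) as G.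
    unfold Rdiv in G. rewrite Rmult_0_l, !Rplus_0_r in G. apply G.
    intros t _. specialize (Hb t). apply Rabs_le_between in Hb. lra.
  - rewrite Rabs_left by lra.
    pose proof (gronwall (fun t => E (- t)) (fun t => - dE (- t)) (12 * L) 0 (- a) (- b) ltac:(lra) ltac:(lra)) as G.
    unfold Rdiv in G. rewrite Rmult_0_l, !Rplus_0_r, !Ropp_involutive in G.
    replace (- (b - a)) with (- b - - a) by ring. apply G.
    + intros t _. replace (- dE (- t)) with (scal (-1) (dE (- t))) by (unfold scal; simpl; unfold mult; simpl; ring).
      apply (is_derive_comp E (fun s => - s)); [apply HE|]. auto_derive; [exact I|ring].
    + intros t _. specialize (Hb (- t)). apply Rabs_le_between in Hb. lra.
Qed.

(** * Truncation and tracking of the attracting slow manifold *)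

Definition clip (z r : R) : R := Rmax (- r) (Rmin z r).

Definition clipf (k : R) (F : R -> R -> R -> R) (x y z : R) : R :=
  F x y (clip z (Rabs x + k)).

Definition fast (eps x y z : R) : R := (x + Rabs z) / eps.

Definition planar (f g : R -> R -> R -> R) (X Y : R -> R) : Prop :=
  planar_solution (fun x y => f x y x) (fun x y => g x y x) X Y.

Lemma clip_lip z r z' r' : Rabs (clip z r - clip z' r') <= Rabs (z - z') + Rabs (r - r').
Proof.
  unfold clip, Rmax, Rmin, Rabs.
  repeat (destruct Rle_dec || destruct Rcase_abs); lra.
Qed.

Lemma clip_id z r : Rabs z <= r -> clip z r = z.
Proof.
  intro H. apply Rabs_le_between in H. unfold clip, Rmax, Rmin.
  repeat destruct Rle_dec; lra.
Qed.

Lemma clip_bound z r : 0 <= r -> Rabs (clip z r) <= r.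
Proof.
  intro H. apply Rabs_le. unfold clip, Rmax, Rmin. repeat destruct Rle_dec; lra.
Qed.

Lemma clip_opp z r : 0 <= r -> clip (- z) r = - clip z r.
Proof.
  intro H. unfold clip, Rmax, Rmin. repeat destruct Rle_dec; lra.
Qed.

Lemma clipf_lip k F L : 0 <= L -> lip3 F L -> lip3 (clipf k F) (2 * L).
Proof.
  intros HL HF x y z x' y' z'. unfold clipf. eapply Rle_trans; [apply HF|].
  pose proof (clip_lip z (Rabs x + k) z' (Rabs x' + k)) as C.
  replace (Rabs x + k - (Rabs x' + k)) with (Rabs x - Rabs x') in C by ring.
  pose proof (Rabs_triang_inv2 x x'). pose proof (Rabs_pos (x - x')).
  pose proof (Rabs_pos (y - y')). pose proof (Rabs_pos (z - z')).
  nra.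
Qed.

(** The gain from truncating: close to [x = 0] the field is governed by its values on the [y]-axis,
    without any information on [z]. *)
Lemma clipf_axis k F L x y z : 0 <= L -> 0 <= k -> lip3 F L ->
  Rabs (clipf k F x y z - F 0 y 0) <= L * (2 * Rabs x + k).
Proof.
  intros HL Hk HF. unfold clipf. eapply Rle_trans; [apply HF|].
  pose proof (Rabs_pos x).
  pose proof (clip_bound z (Rabs x + k) ltac:(lra)).
  rewrite !Rminus_0_r, Rminus_diag, Rabs_R0. apply Rmult_le_compat_l; lra.
Qed.

Lemma clipf_origin k F L x y z : 0 <= L -> 0 <= k -> lip3 F L ->
  Rabs (clipf k F x y z - F 0 0 0) <= L * (2 * Rabs x + Rabs y + k).
Proof.
  intros HL Hk HF. unfold clipf. eapply Rle_trans; [apply HF|].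
  pose proof (Rabs_pos x).
  pose proof (clip_bound z (Rabs x + k) ltac:(lra)).
  rewrite !Rminus_0_r. apply Rmult_le_compat_l; lra.
Qed.

(** Hence planar trajectories of the attracting branch are unaffected by the truncation. *)
Lemma clipf_diag k F x y : 0 <= k -> clipf k F x y x = F x y x.
Proof. intro H. unfold clipf. rewrite clip_id; [reflexivity|lra]. Qed.

Lemma sq_le_abs a b : 0 <= b -> a ^ 2 <= b ^ 2 -> Rabs a <= b.
Proof.
  intros Hb H. rewrite <- (Rabs_pos_eq b Hb). apply Rsqr_le_abs_0. unfold Rsqr. lra.
Qed.

Lemma exp_neg_le r : 0 < r -> exp (- r) <= / r.
Proof.
  intro H. rewrite exp_Ropp. apply Rinv_le_contravar; [exact H|].
  pose proof (exp_ineq1 r ltac:(lra)). lra.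
Qed.

(** Here [a = x - X], [b = y - Y], [e = z - x], so that [e + a = z - X], and [D] is the difference
    of a field at [(x, y, z)] and at [(X, Y, X)]. *)
Lemma track_product_bound a b e D Lam : 0 <= Lam ->
  Rabs D <= Lam * (Rabs a + Rabs b + Rabs (e + a)) ->
  2 * a * D <= Lam * (6 * a ^ 2 + b ^ 2 + e ^ 2).
Proof.
  intros HL HD. pose proof (Rabs_triang e a).
  assert (HD' : Rabs D <= Lam * (2 * Rabs a + Rabs b + Rabs e)).
  { eapply Rle_trans; [exact HD|]. apply Rmult_le_compat_l; lra. }
  apply Rle_trans with (2 * Rabs a * Rabs D).
  - rewrite <- (Rabs_pos_eq 2) at 2 by lra. rewrite <- !Rabs_mult. apply Rle_abs.
  - rewrite <- (pow2_abs a), <- (pow2_abs b), <- (pow2_abs e).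
    pose proof (Rabs_pos a). pose proof (Rabs_pos b). pose proof (Rabs_pos e).
    set (p := Rabs a) in *. set (q := Rabs b) in *. set (r := Rabs e) in *.
    apply Rle_trans with (2 * p * (Lam * (2 * p + q + r))); [apply Rmult_le_compat_l; lra|].
    assert (0 <= (p - q) ^ 2) by apply pow2_ge_0. assert (0 <= (p - r) ^ 2) by apply pow2_ge_0.
    assert (2 * p * (2 * p + q + r) <= 6 * p ^ 2 + q ^ 2 + r ^ 2) by nra. nra.
Qed.

Lemma track_product_bound_snd a b e D Lam : 0 <= Lam ->
  Rabs D <= Lam * (Rabs a + Rabs b + Rabs (e + a)) ->
  2 * b * D <= Lam * (2 * a ^ 2 + 5 * b ^ 2 + e ^ 2).
Proof.
  intros HL HD. pose proof (Rabs_triang e a).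
  assert (HD' : Rabs D <= Lam * (2 * Rabs a + Rabs b + Rabs e)).
  { eapply Rle_trans; [exact HD|]. apply Rmult_le_compat_l; lra. }
  apply Rle_trans with (2 * Rabs b * Rabs D).
  - rewrite <- (Rabs_pos_eq 2) at 2 by lra. rewrite <- !Rabs_mult. apply Rle_abs.
  - rewrite <- (pow2_abs a), <- (pow2_abs b), <- (pow2_abs e).
    pose proof (Rabs_pos a). pose proof (Rabs_pos b). pose proof (Rabs_pos e).
    set (p := Rabs a) in *. set (q := Rabs b) in *. set (r := Rabs e) in *.
    apply Rle_trans with (2 * q * (Lam * (2 * p + q + r))); [apply Rmult_le_compat_l; lra|].
    assert (0 <= (p - q) ^ 2) by apply pow2_ge_0. assert (0 <= (q - r) ^ 2) by apply pow2_ge_0.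
    assert (2 * q * (2 * p + q + r) <= 2 * p ^ 2 + 5 * q ^ 2 + r ^ 2) by nra. nra.
Qed.

(* Gronwall for [(x - X)^2 + (y - Y)^2 + 2 Lam eps (z - x)^2]: the fast contraction of
   [z - x] absorbs the error made by replacing [z] with [x] in [F] and [G]. *)
Lemma slow_manifold_tracking F G Lam M eps X Y x y z a b :
  0 < Lam -> 0 <= M -> 0 < eps <= 1 -> a <= b ->
  lip3 F Lam -> lip3 G Lam -> (forall x y z, Rabs (F x y z) <= M) ->
  planar F G X Y -> sol3 F G (fast eps) x y z ->
  x a = X a -> y a = Y a -> z a = 0 -> (forall t, a <= t <= b -> z t <= 0) ->
  (x b - X b) ^ 2 + (y b - Y b) ^ 2 <= eps * (2 * Lam * (X a) ^ 2 + M ^ 2) * exp (8 * Lam * (b - a)) /\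
  (a < b -> (z b - x b) ^ 2 <= eps * (M ^ 2 + (X a) ^ 2 / (b - a))).
Proof.
  intros HLam HM Heps Hab HF HG HFM HP HS Hx0 Hy0 Hz0 Hz.
  assert (Dz : forall t, a <= t <= b -> is_derive z t ((x t - z t) / eps)).
  { intros t Ht. destruct (HS t) as [_ [_ D]]. unfold fast in D.
    specialize (Hz t Ht). rewrite Rabs_left1 in D by exact Hz. exact D. }
  assert (De : forall t, a <= t <= b -> is_derive (fun t => (z t - x t) ^ 2) t
     (2 * (z t - x t) * ((x t - z t) / eps - F (x t) (y t) (z t)))).
  { intros t Ht. apply is_derive_sq; [apply Dz, Ht|apply HS]. }
  (* After multiplication by [eps] this is [0 <= (e + eps * v) ^ 2], combined with [|v| <= M]. *)
  assert (Be : forall t, 2 * (z t - x t) * ((x t - z t) / eps - F (x t) (y t) (z t))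
     <= - / eps * (z t - x t) ^ 2 + eps * M ^ 2).
  { intro t. specialize (HFM (x t) (y t) (z t)). apply Rabs_le_between in HFM.
    set (e := z t - x t). set (v := F (x t) (y t) (z t)) in *.
    replace ((x t - z t) / eps) with (- (e / eps)) by (unfold e; field; lra).
    assert (Hv : v ^ 2 <= M ^ 2) by (apply pow_maj_Rabs, Rabs_le; lra).
    assert (Hs : 0 <= (e + eps * v) ^ 2) by apply pow2_ge_0.
    apply Rmult_le_reg_l with eps; [lra|].
    replace (eps * (2 * e * (- (e / eps) - v))) with (- 2 * e ^ 2 - 2 * e * (eps * v)) by (field; lra).
    replace (eps * (- / eps * e ^ 2 + eps * M ^ 2)) with (- e ^ 2 + eps ^ 2 * M ^ 2) by (field; lra).
    assert (eps ^ 2 * v ^ 2 <= eps ^ 2 * M ^ 2) by (apply Rmult_le_compat_l; [apply pow2_ge_0|lra]).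
    nra. }
  split.
  (* With the weight [2 * Lam * eps] the contraction contributes [- 2 * Lam * (z - x) ^ 2], exactly
     what the two product bounds cost. The rate [8 * Lam] is the sum [6 + 2] of the coefficients of
     [(x - X) ^ 2] in them. *)
  - set (V := fun t => (x t - X t) ^ 2 + (y t - Y t) ^ 2 + 2 * Lam * eps * (z t - x t) ^ 2).
    set (dV := fun t => 2 * (x t - X t) * (F (x t) (y t) (z t) - F (X t) (Y t) (X t))
      + 2 * (y t - Y t) * (G (x t) (y t) (z t) - G (X t) (Y t) (X t))
      + 2 * Lam * eps * (2 * (z t - x t) * ((x t - z t) / eps - F (x t) (y t) (z t)))).
    assert (G1 : V b + (2 * Lam * eps ^ 2 * M ^ 2) / (8 * Lam) <=
      (V a + (2 * Lam * eps ^ 2 * M ^ 2) / (8 * Lam)) * exp (8 * Lam * (b - a))).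
    { apply (gronwall V dV); [lra|exact Hab| |].
      - intros t Ht. destruct (HS t) as [D1 [D2 _]]. destruct (HP t) as [P1 P2].
        apply (is_derive_plus (V := R_NormedModule)).
        + apply (is_derive_plus (V := R_NormedModule)); apply is_derive_sq; assumption.
        + apply (is_derive_scal (fun t => (z t - x t) ^ 2)). apply De, Ht.
      - intros t Ht. unfold dV, V.
        pose proof (track_product_bound (x t - X t) (y t - Y t) (z t - x t)
          (F (x t) (y t) (z t) - F (X t) (Y t) (X t)) Lam) as T1.
        pose proof (track_product_bound_snd (x t - X t) (y t - Y t) (z t - x t)
          (G (x t) (y t) (z t) - G (X t) (Y t) (X t)) Lam) as T2.
        replace (z t - x t + (x t - X t)) with (z t - X t) in T1, T2 by ring.
        specialize (T1 ltac:(lra) (HF _ _ _ _ _ _)). specialize (T2 ltac:(lra) (HG _ _ _ _ _ _)).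
        assert (T3 : 2 * Lam * eps * (2 * (z t - x t) * ((x t - z t) / eps - F (x t) (y t) (z t)))
           <= 2 * Lam * eps * (- / eps * (z t - x t) ^ 2 + eps * M ^ 2)).
        { apply Rmult_le_compat_l; [|apply Be]. nra. }
        replace (2 * Lam * eps * (- / eps * (z t - x t) ^ 2 + eps * M ^ 2))
          with (- 2 * Lam * (z t - x t) ^ 2 + 2 * Lam * eps ^ 2 * M ^ 2) in T3 by (field; lra).
        pose proof (pow2_ge_0 (z t - x t)). pose proof (pow2_ge_0 (y t - Y t)).
        assert (0 <= Lam * (y t - Y t) ^ 2) by (apply Rmult_le_pos; lra).
        assert (0 <= 8 * Lam * (2 * Lam * eps * (z t - x t) ^ 2)).
        { apply Rmult_le_pos; [lra|]. apply Rmult_le_pos; [|lra].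
          apply Rmult_le_pos; lra. }
        lra. }
    assert (Va : V a = 2 * Lam * eps * (X a) ^ 2).
    { unfold V. rewrite Hx0, Hy0, Hz0. ring. }
    replace ((2 * Lam * eps ^ 2 * M ^ 2) / (8 * Lam)) with (eps ^ 2 * M ^ 2 / 4) in G1 by (field; lra).
    rewrite Va in G1. unfold V in G1.
    pose proof (pow2_ge_0 M) as HM2. pose proof (pow2_ge_0 (X a)). pose proof (pow2_ge_0 (z b - x b)).
    assert (0 <= 2 * Lam * eps * (z b - x b) ^ 2)
      by (apply Rmult_le_pos; [apply Rmult_le_pos|]; lra).
    assert (0 <= eps ^ 2 * M ^ 2) by (apply Rmult_le_pos; [apply pow2_ge_0|lra]).
    assert (eps ^ 2 * M ^ 2 <= eps * M ^ 2) by (apply Rmult_le_compat_r; [lra|nra]).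
    eapply Rle_trans; [|eapply Rle_trans; [exact G1|]]; [lra|].
    apply Rmult_le_compat_r; [left; apply exp_pos|]. lra.
  - intro Hlt.
    pose proof (gronwall (fun t => (z t - x t) ^ 2) _ (- / eps) (eps * M ^ 2) a b
      ltac:(pose proof (Rinv_0_lt_compat eps); lra) Hab De (fun t _ => Be t)) as G2.
    simpl in G2. rewrite Hz0, Hx0 in G2.
    replace (eps * (M * (M * 1)) / - / eps) with (- (eps ^ 2 * M ^ 2)) in G2 by (field; lra).
    (* The initial gap [z - x = - X a] is not small, but decays exponentially. This crude bound of
       the exponential makes its remainder linear in [eps], like the other error. *)
    assert (HE : exp (- / eps * (b - a)) <= eps / (b - a)).
    { replace (- / eps * (b - a)) with (- ((b - a) / eps)) by (field; lra).
      replace (eps / (b - a)) with (/ ((b - a) / eps)) by (field; lra).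
      apply exp_neg_le, Rdiv_lt_0_compat; lra. }
    pose proof (exp_pos (- / eps * (b - a))). pose proof (pow2_ge_0 M). pose proof (pow2_ge_0 (X a)).
    assert (0 <= eps ^ 2 * M ^ 2) by (apply Rmult_le_pos; [apply pow2_ge_0|lra]).
    assert (eps ^ 2 * M ^ 2 <= eps * M ^ 2) by (apply Rmult_le_compat_r; [lra|nra]).
    replace (eps * (M ^ 2 + X a ^ 2 / (b - a))) with (eps * M ^ 2 + X a ^ 2 * (eps / (b - a))) by (field; lra).
    assert (X a ^ 2 * exp (- / eps * (b - a)) <= X a ^ 2 * (eps / (b - a))) by (apply Rmult_le_compat_l; lra).
    nra.
Qed.

(** Since [|z| >= - z], the quantity [x - z] decays at least as in the linear case, whatever the
    sign of [z]. The bound therefore survives when [z] has become positive and tracking has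
    failed. *)
Lemma slow_manifold_lower F G M eps x y z a b :
  0 < eps -> a <= b -> (forall x y z, Rabs (F x y z) <= M) ->
  sol3 F G (fast eps) x y z -> x a <= z a -> - (eps * M) <= z b - x b.
Proof.
  intros Heps Hab HFM HS H0.
  pose proof (gronwall (fun t => x t - z t) (fun t => F (x t) (y t) (z t) - fast eps (x t) (y t) (z t))
    (- / eps) M a b ltac:(pose proof (Rinv_0_lt_compat eps); lra) Hab) as G1.
  simpl in G1. replace (M / - / eps) with (- (eps * M)) in G1 by (field; lra).
  assert (0 <= M) by (eapply Rle_trans; [apply Rabs_pos|apply (HFM 0 0 0)]).
  assert (0 <= eps * M) by (apply Rmult_le_pos; lra).
  pose proof (exp_pos (- / eps * (b - a))).
  assert (x b - z b + - (eps * M) <= (x a - z a + - (eps * M)) * exp (- / eps * (b - a))); [apply G1|nra].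
  - intros t _. apply (is_derive_minus (V := R_NormedModule)); apply HS.
  - intros t _. specialize (HFM (x t) (y t) (z t)). apply Rabs_le_between in HFM.
    unfold fast. pose proof (Rle_abs (- z t)) as Hz. rewrite Rabs_Ropp in Hz.
    assert (- (x t + Rabs (z t)) / eps <= - / eps * (x t - z t)); [|lra].
    replace (- / eps * (x t - z t)) with (- (x t - z t) / eps) by (field; lra).
    apply Rmult_le_compat_r; [left; apply Rinv_0_lt_compat, Heps|lra].
Qed.

(** * The forward flow up to the section y = 0 *)

Lemma no_touch_from_below (w : R -> R) dw a t :
  a < t -> is_derive w t dw -> w t = 0 -> dw < 0 -> (forall s, a <= s <= t -> w s <= 0) -> False.
Proof.
  intros Hat Hd H0 Hneg Hle.
  destruct (is_derive_eps w t _ Hd (- dw / 2) ltac:(lra)) as [del [Hdel Hs]].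
  set (s := Rmax a (t - del / 2)).
  assert (a <= s < t /\ t - del < s) by (unfold s, Rmax; destruct Rle_dec; lra).
  specialize (Hs s ltac:(rewrite Rabs_left; lra)). rewrite (Rabs_left (s - t)) in Hs by lra.
  apply Rabs_le_between in Hs. specialize (Hle s ltac:(lra)).
  assert (0 < - dw * (t - s)) by (apply Rmult_lt_0_compat; lra). lra.
Qed.

Section Window.
Variables (f g : R -> R -> R -> R) (L M : R).
Hypothesis HL : 0 < L.
Hypothesis HM : 0 < M.
Hypothesis Hfb : forall x y z, Rabs (f x y z) <= M.
Hypothesis Hgb : forall x y z, Rabs (g x y z) <= M.
Hypothesis Hfl : lip3 f L.
Hypothesis Hgl : lip3 g L.
Hypothesis Hf0 : f 0 0 0 = 0.
Variable g0 : R.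
Hypothesis Hg0 : 0 < g0.
Hypothesis Hg00 : g 0 0 0 = g0.
Hypothesis Hfneg : forall y, y < 0 -> 0 < f 0 y 0.

(** The planar curve [(X, Y)] meets [y = 0] at [(u, 0)] at time [0]; [[-h, H]] is the window around
    that time and [B] bounds both coordinates there. Before the window [X] stays below [- c]; [nu]
    is the accuracy of tracking and [kap] the truncation constant. [HLB] keeps [g >= g0 / 2] in the
    window, [HHh] makes it long enough for [y] to reach [0], [HLh] bounds the Lipschitz drift of [x]
    accumulated in it, and [HXB] places the start to the left of everything in it. *)
Variables (t0 h H B c d u kap eps nu : R) (X Y x y z : R -> R).
Hypothesis Hh : 0 < h.
Hypothesis HH : 0 < H.
Hypothesis Ht0 : t0 < - h.
Hypothesis HB : 3 * M * h + M * (h + H) <= B.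
Hypothesis HLB : 8 * (L * B) <= g0.
Hypothesis HLh : 8 * (L * (h + H)) <= 1.
Hypothesis HHh : 2 * M * h <= g0 / 2 * H.
Hypothesis Hd : 0 < d <= M * h.
Hypothesis Hu : - d <= u <= d.
Hypothesis Hkap : 0 < kap <= d.
Hypothesis Heps : 0 < eps.
Hypothesis Hnu : 0 < nu < c.
Hypothesis Hnud : nu <= d / 40.
Hypothesis Hnug : 40 * (M * nu) <= g0 * d.
Hypothesis HP : planar f g X Y.
Hypothesis HX0 : X 0 = u.
Hypothesis HY0 : Y 0 = 0.
Hypothesis HXc : forall t, t0 <= t <= - h -> X t <= - c.
Hypothesis HXB : X t0 <= - (2 * B).
Hypothesis HS : sol3 (clipf kap f) (clipf kap g) (fast eps) x y z.
Hypothesis Hx0 : x t0 = X t0.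
Hypothesis Hz0 : z t0 = 0.
Hypothesis Htrack : forall t1, t0 <= t1 <= H -> (forall t, t0 <= t <= t1 -> z t <= 0) ->
  Rabs (x t1 - X t1) <= nu /\ Rabs (y t1 - Y t1) <= nu /\
  (- h <= t1 -> Rabs (z t1 - x t1) <= nu).
Hypothesis Hlow : forall t, t0 <= t -> - nu <= z t - x t.

Lemma nu_small : nu <= M * h /\ 40 * nu <= g0 * h.
Proof.
  split; [lra|]. apply Rmult_le_reg_l with M; [exact HM|].
  assert (g0 * d <= g0 * (M * h)) by (apply Rmult_le_compat_l; lra). lra.
Qed.

Lemma B_pos : 0 < B.
Proof.
  assert (0 < M * h) by (apply Rmult_lt_0_compat; assumption).
  assert (0 < M * H) by (apply Rmult_lt_0_compat; assumption). lra.
Qed.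

Lemma MhB : 3 * (M * h) + M * h + M * H <= B. Proof. lra. Qed.
Lemma Mh_pos : 0 < M * h. Proof. apply Rmult_lt_0_compat; assumption. Qed.
Lemma MH_pos : 0 < M * H. Proof. apply Rmult_lt_0_compat; assumption. Qed.

Lemma x_speed a b : Rabs (x b - x a) <= M * Rabs (b - a).
Proof. apply (mean_value_abs x (fun t => clipf kap f (x t) (y t) (z t))); [intro; apply HS|intro; apply Hfb]. Qed.
Lemma y_speed a b : Rabs (y b - y a) <= M * Rabs (b - a).
Proof. apply (mean_value_abs y (fun t => clipf kap g (x t) (y t) (z t))); [intro; apply HS|intro; apply Hgb]. Qed.
Lemma X_speed a b : Rabs (X b - X a) <= M * Rabs (b - a).
Proof. apply (mean_value_abs X (fun t => f (X t) (Y t) (X t))); [intro; apply HP|intro; apply Hfb]. Qed.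
Lemma Y_speed a b : Rabs (Y b - Y a) <= M * Rabs (b - a).
Proof. apply (mean_value_abs Y (fun t => g (X t) (Y t) (X t))); [intro; apply HP|intro; apply Hgb]. Qed.

Lemma XY_window t : - h <= t <= H -> Rabs (X t) <= B /\ Rabs (Y t) <= B.
Proof.
  intro Ht. pose proof (X_speed 0 t) as K1. pose proof (Y_speed 0 t) as K2.
  rewrite HX0, Rminus_0_r in K1. rewrite HY0, !Rminus_0_r in K2.
  pose proof MhB. pose proof Mh_pos. pose proof MH_pos.
  assert (M * Rabs t <= M * h + M * H).
  { assert (Rabs t <= h + H) by (apply Rabs_le; lra). nra. }
  apply Rabs_le_between in K1.
  split; [apply Rabs_le; lra|lra].
Qed.

Lemma Y_slope a b : - h <= a -> a <= b -> b <= H -> g0 / 2 * (b - a) <= Y b - Y a.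
Proof.
  intros Ha Hab Hb.
  apply (mean_value_lower Y (fun t => g (X t) (Y t) (X t))); [exact Hab|intros; apply HP|].
  intros t Ht. destruct (XY_window t ltac:(lra)) as [K1 K2].
  pose proof (Hgl (X t) (Y t) (X t) 0 0 0) as K. rewrite !Rminus_0_r, Hg00 in K.
  apply Rabs_le_between in K. pose proof B_pos.
  assert (L * (Rabs (X t) + Rabs (Y t) + Rabs (X t)) <= L * (4 * B)) by (apply Rmult_le_compat_l; lra).
  lra.
Qed.

(** At a zero of [z] its derivative is [x / eps]. While [z <= 0] has held so far tracking is
    available, so that [X < - nu] gives [x < 0] there. *)
Lemma z_nonpos_until b : - h <= b <= H ->
  (forall t, - h <= t < b -> X t < - nu \/ x t < 0) -> forall t, t0 <= t <= b -> z t <= 0.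
Proof.
  intros Hb Hneg.
  apply (barrier_nonpos z (fun t => fast eps (x t) (y t) (z t))); [intros; apply HS|lra|].
  intros t Ht Hzt Hle.
  assert (Hx : x t < 0).
  { destruct (Htrack t ltac:(lra) Hle) as [T _]. apply Rabs_le_between in T.
    destruct (Rle_lt_dec t (- h)) as [C1|C1].
    - specialize (HXc t ltac:(lra)). lra.
    - destruct (Hneg t ltac:(lra)); lra. }
  unfold fast. rewrite Hzt, Rabs_R0, Rplus_0_r. apply Rdiv_neg_pos; assumption.
Qed.

Lemma z_nonpos_start t : t0 <= t <= - h -> z t <= 0.
Proof. apply z_nonpos_until; [lra|intros; lra]. Qed.

(** Strictness matters for the minimal period: [z] must not return to [0] on this stretch. *)
Lemma z_neg_start t : t0 < t <= - h -> z t < 0.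
Proof.
  intro Ht. destruct (Rle_lt_or_eq_dec (z t) 0 (z_nonpos_start t ltac:(lra))) as [K|K]; [exact K|exfalso].
  apply (no_touch_from_below z (fast eps (x t) (y t) (z t)) t0 t); [lra|apply HS|exact K| |].
  - destruct (Htrack t ltac:(lra)) as [T _]; [intros; apply z_nonpos_start; lra|].
    apply Rabs_le_between in T. specialize (HXc t ltac:(lra)).
    unfold fast. rewrite K, Rabs_R0, Rplus_0_r. apply Rdiv_neg_pos; lra.
  - intros; apply z_nonpos_start; lra.
Qed.

Lemma track_start : Rabs (x (- h) - X (- h)) <= nu /\ Rabs (y (- h) - Y (- h)) <= nu.
Proof.
  destruct (Htrack (- h) ltac:(lra)) as [T1 [T2 _]]; [apply z_nonpos_start|]. tauto.
Qed.

(** Origin of [B]: at time [- h] both coordinates are at most [d + M * h + nu <= 3 * M * h], and the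
    speed is at most [M] for a time [h + H]. No tracking inside the window is involved. *)
Lemma xy_window t : - h <= t <= H -> Rabs (x t) <= B /\ Rabs (y t) <= B.
Proof.
  intro Ht. pose proof (x_speed (- h) t) as K1. pose proof (y_speed (- h) t) as K2.
  pose proof (X_speed 0 (- h)) as K3. pose proof (Y_speed 0 (- h)) as K4.
  rewrite HX0, Rminus_0_r, (Rabs_left (- h)) in K3 by lra.
  rewrite HY0, !Rminus_0_r, (Rabs_left (- h)) in K4 by lra.
  rewrite (Rabs_pos_eq (t - - h)) in K1, K2 by lra.
  pose proof MhB. pose proof Mh_pos. pose proof MH_pos. pose proof nu_small.
  assert (M * (t - - h) <= M * h + M * H) by nra.
  destruct track_start as [T1 T2].
  apply Rabs_le_between in T1. apply Rabs_le_between in T2.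
  apply Rabs_le_between in K1. apply Rabs_le_between in K2. 
  apply Rabs_le_between in K3. apply Rabs_le_between in K4.
  split; apply Rabs_le; lra.
Qed.

Lemma y_slope a b : - h <= a -> a <= b -> b <= H -> g0 / 2 * (b - a) <= y b - y a.
Proof.
  intros Ha Hab Hb.
  apply (mean_value_lower y (fun t => clipf kap g (x t) (y t) (z t))); [exact Hab|intros; apply HS|].
  intros t Ht. destruct (xy_window t ltac:(lra)) as [K1 K2].
  pose proof (clipf_origin kap g L (x t) (y t) (z t) ltac:(lra) ltac:(lra) Hgl) as K.
  rewrite Hg00 in K. apply Rabs_le_between in K. pose proof MhB. pose proof MH_pos. pose proof Mh_pos.
  assert (L * (2 * Rabs (x t) + Rabs (y t) + kap) <= L * (4 * B)) by (apply Rmult_le_compat_l; lra).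
  lra.
Qed.

(** Tracking at [- h] gives [y < 0] there, and the slope [g0 / 2] carries [y] past [0] before [H].
    The last inequality later turns smallness of [y] into closeness of times, hence continuity of
    [ta] in the parameters. *)
Lemma hitting_time : exists ta, - h < ta < H /\ y ta = 0 /\
  forall t, - h <= t <= H -> g0 / 2 * Rabs (t - ta) <= Rabs (y t).
Proof.
  pose proof nu_small. pose proof Mh_pos. pose proof MH_pos.
  assert (0 < g0 * h) by (apply Rmult_lt_0_compat; assumption).
  destruct track_start as [_ T]. apply Rabs_le_between in T.
  pose proof (Y_slope (- h) 0 ltac:(lra) ltac:(lra) ltac:(lra)) as K1. rewrite HY0 in K1.
  pose proof (Y_speed 0 (- h)) as K4.
  rewrite HY0, !Rminus_0_r, (Rabs_left (- h)) in K4 by lra. apply Rabs_le_between in K4.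
  pose proof (y_slope (- h) H ltac:(lra) ltac:(lra) ltac:(lra)) as K2.
  assert (Hneg : y (- h) < 0) by lra.
  assert (Hpos : 0 < y H) by lra.
  destruct (first_nonneg y (fun t => clipf kap g (x t) (y t) (z t)) (- h) H) as [ta [Hta [Hyta _]]];
    [intros; apply HS|lra|exact Hneg|lra|].
  exists ta. repeat split; [lra| |exact Hyta|].
  - destruct (Req_dec ta H) as [->|]; lra.
  - intros t Ht. destruct (Rle_lt_dec ta t) as [C|C].
    + pose proof (y_slope ta t ltac:(lra) C ltac:(lra)).
      rewrite (Rabs_pos_eq (t - ta)) by lra. pose proof (Rle_abs (y t)). lra.
    + pose proof (y_slope t ta ltac:(lra) ltac:(lra) ltac:(lra)).
      rewrite (Rabs_left (t - ta)) by lra. pose proof (Rle_abs (- y t)). rewrite Rabs_Ropp in *. lra.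
Qed.

Variable ta : R.
Hypothesis Hta : - h < ta < H.
Hypothesis Hyta : y ta = 0.

(** Either alternative excludes a return to the starting state, where [z = 0]; this yields
    minimality of the period. *)
Lemma leaves_start t : t0 < t <= ta -> z t < 0 \/ x t0 < x t.
Proof.
  intro Ht. destruct (Rle_lt_dec t (- h)) as [C|C].
  - left. apply z_neg_start; lra.
  - right. destruct (xy_window t ltac:(lra)) as [K _]. apply Rabs_le_between in K.
    pose proof B_pos. lra.
Qed.

(** As [y ta = 0], tracking puts [Y ta] within [nu] of [0], so [|ta| <= 2 * nu / g0] and [X] is
    within [d / 20] of [u]. Two tracking errors of at most [d / 40] complete [d / 10]. *)
Lemma tracked_hit : (forall t, t0 <= t <= ta -> z t <= 0) ->
  Rabs (x ta - u) <= d / 10 /\ Rabs (z ta - u) <= d / 10.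
Proof.
  intro Hz. destruct (Htrack ta ltac:(lra) Hz) as [T1 [T2 T3]]. specialize (T3 ltac:(lra)).
  assert (Ht : g0 / 2 * Rabs ta <= nu).
  { rewrite Hyta in T2. apply Rabs_le_between in T2.
    destruct (Rle_lt_dec 0 ta) as [C|C].
    - rewrite Rabs_pos_eq by exact C. pose proof (Y_slope 0 ta ltac:(lra) C ltac:(lra)). lra.
    - rewrite Rabs_left by exact C. pose proof (Y_slope ta 0 ltac:(lra) ltac:(lra) ltac:(lra)). lra. }
  pose proof (X_speed 0 ta) as K. rewrite HX0, Rminus_0_r in K.
  assert (M * Rabs ta <= d / 20).
  { apply Rmult_le_reg_l with (g0 / 2); [lra|].
    replace (g0 / 2 * (M * Rabs ta)) with (M * (g0 / 2 * Rabs ta)) by ring.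
    assert (M * (g0 / 2 * Rabs ta) <= M * nu) by (apply Rmult_le_compat_l; lra). lra. }
  apply Rabs_le_between in K. apply Rabs_le_between in T1. apply Rabs_le_between in T3.
  split; apply Rabs_le; lra.
Qed.

Lemma f_axis x' y' : Rabs (f x' y' x' - f 0 y' 0) <= L * (2 * Rabs x').
Proof.
  eapply Rle_trans; [apply Hfl|]. rewrite !Rminus_0_r, Rminus_diag, Rabs_R0. apply Req_le. ring.
Qed.

(** Backwards from time [0] one has [Y < 0], where [f(0, Y, 0) > 0] pushes [X] down up to an error
    [L * d]. The barrier rising with slope [d / (4 * h)] absorbs this error, since
    [4 * L * h <= 1 / 2], and rises by only [d / 4]. *)
Lemma X_stays_negative t : u <= - d / 2 -> - h <= t <= 0 -> X t <= - d / 4.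
Proof.
  intros Hu2 Ht.
  assert (HLh' : 4 * (L * h) <= 1 / 2).
  { assert (0 < L * H) by (apply Rmult_lt_0_compat; assumption). lra. }
  assert (K : forall s, 0 <= s <= h -> X (- s) + (d / 2 - d / (4 * h) * s) <= 0).
  { apply (barrier_nonpos (fun s => X (- s) + (d / 2 - d / (4 * h) * s))
      (fun s => - f (X (- s)) (Y (- s)) (X (- s)) - d / (4 * h))).
    - intros s _. apply (is_derive_plus (V := R_NormedModule)).
      + replace (- f (X (- s)) (Y (- s)) (X (- s))) with (scal (-1) (f (X (- s)) (Y (- s)) (X (- s))))
          by (unfold scal; simpl; unfold mult; simpl; ring).
        apply (is_derive_comp X (fun s => - s)); [apply HP|]. auto_derive; [exact I|ring].
      + auto_derive; [exact I|ring].
    - rewrite Ropp_0, HX0. lra.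
    - intros s Hs Hw _.
      assert (Hr : 0 <= d / (4 * h) * s <= d / 4).
      { split; [apply Rmult_le_pos; [left; apply Rdiv_lt_0_compat|]; lra|].
        replace (d / 4) with (d / (4 * h) * h) by (field; lra).
        apply Rmult_le_compat_l; [left; apply Rdiv_lt_0_compat|]; lra. }
      assert (HXs : Rabs (X (- s)) <= d / 2) by (apply Rabs_le; lra).
      pose proof (f_axis (X (- s)) (Y (- s))) as F. apply Rabs_le_between in F.
      assert (Hf : 0 <= f 0 (Y (- s)) 0).
      { destruct (Req_dec s 0) as [->|]; [rewrite Ropp_0, HY0, Hf0; lra|].
        left. apply Hfneg. pose proof (Y_slope (- s) 0 ltac:(lra) ltac:(lra) ltac:(lra)) as K.
        rewrite HY0 in K. assert (0 < g0 / 2 * (0 - - s)) by (apply Rmult_lt_0_compat; lra). lra. }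
      assert (L * (2 * Rabs (X (- s))) <= L * d) by (apply Rmult_le_compat_l; lra).
      assert (L * d < d / (4 * h)); [|lra].
      apply Rmult_lt_reg_r with (4 * h); [lra|].
      replace (d / (4 * h) * (4 * h)) with d by (field; lra). nra. }
  specialize (K (- t) ltac:(lra)). rewrite Ropp_involutive in K.
  assert (d / (4 * h) * - t <= d / 4); [|lra].
  replace (d / 4) with (d / (4 * h) * h) by (field; lra).
  apply Rmult_le_compat_l; [left; apply Rdiv_lt_0_compat|]; lra.
Qed.

Lemma hit_below : u <= - d / 2 -> Rabs (x ta - u) <= d / 10 /\ Rabs (z ta - u) <= d / 10.
Proof.
  intro Hu2. apply tracked_hit.
  (* During the time [d / (4 * M)] after [0] the coordinate [X] moves by at most [d / 4], hence
     stays negative enough for tracking, while [y] has time to reach [0] because [nu] is small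
     against [g0 * d / M]. *)
  assert (Hb : 0 < d / (4 * M) <= h / 4).
  { split; [apply Rdiv_lt_0_compat; lra|]. apply Rle_div_l; [lra|]. lra. }
  assert (HhH : h <= H).
  { assert (g0 <= M).
    { specialize (Hgb 0 0 0). rewrite Hg00, Rabs_pos_eq in Hgb; lra. }
    apply Rmult_le_reg_l with M; [exact HM|]. pose proof Mh_pos.
    assert (g0 * H <= M * H) by (apply Rmult_le_compat_r; lra). lra. }
  assert (HX : forall t, - h <= t <= d / (4 * M) -> X t <= - d / 4).
  { intros t Ht. destruct (Rle_lt_dec t 0) as [C|C]; [apply X_stays_negative; lra|].
    pose proof (X_speed 0 t) as K. rewrite HX0, Rminus_0_r, (Rabs_pos_eq t) in K by lra.
    apply Rabs_le_between in K.
    assert (M * t <= d / 4); [|lra].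
    replace (d / 4) with (M * (d / (4 * M))) by (field; lra). apply Rmult_le_compat_l; lra. }
  assert (Hz : forall t, t0 <= t <= d / (4 * M) -> z t <= 0).
  { apply z_nonpos_until; [lra|]. intros t Ht. left. specialize (HX t ltac:(lra)). lra. }
  assert (Hlt : ta < d / (4 * M)).
  { destruct (Htrack (d / (4 * M)) ltac:(lra) Hz) as [_ [T _]].
    pose proof (Y_slope 0 (d / (4 * M)) ltac:(lra) ltac:(lra) ltac:(lra)) as K.
    rewrite HY0, !Rminus_0_r in K. apply Rabs_le_between in T.
    assert (5 * nu <= g0 / 2 * (d / (4 * M))).
    { apply Rmult_le_reg_l with (8 * M); [lra|].
      replace (8 * M * (g0 / 2 * (d / (4 * M)))) with (g0 * d) by (field; lra). lra. }
    destruct (Rle_lt_dec (d / (4 * M)) ta) as [C|C]; [|exact C].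
    pose proof (y_slope (d / (4 * M)) ta ltac:(lra) C ltac:(lra)) as K2.
    assert (0 <= g0 / 2 * (ta - d / (4 * M))) by (apply Rmult_le_pos; lra). lra. }
  intros t Ht. apply Hz. lra.
Qed.

Lemma y_negative_before t : - h <= t < ta -> y t < 0.
Proof.
  intro Ht. pose proof (y_slope t ta ltac:(lra) ltac:(lra) ltac:(lra)).
  assert (0 < g0 / 2 * (ta - t)) by (apply Rmult_lt_0_compat; lra). lra.
Qed.

(** If [x] stays negative the hit is tracked. Once [x >= 0] with [y < 0], the sign of [f(0, y, 0)]
    limits its later fall to the Lipschitz error, at most [d / 2] over the window. Truncation makes
    this valid even while [z] explodes. *)
Lemma hit_above : - d / 2 <= u -> - (3 / 4 * d) <= x ta.
Proof.
  intro Hu2.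
  destruct (classic (exists t1, - h <= t1 <= ta /\ 0 <= x t1)) as [[t1 [Ht1 Hxt1]]|Hno].
  2:{ destruct tracked_hit as [K _].
      - apply z_nonpos_until; [lra|]. intros t Ht. right.
        apply Rnot_le_lt. intro C. apply Hno. exists t. lra.
      - apply Rabs_le_between in K. lra. }
  set (om := d / (2 * (h + H))).
  assert (Hom : 0 < om) by (apply Rdiv_lt_0_compat; lra).
  assert (Hom2 : om * (h + H) = d / 2) by (unfold om; field; lra).
  assert (K : - x ta - om * (ta - t1) <= 0).
  { apply (barrier_nonpos (fun t => - x t - om * (t - t1))
      (fun t => - clipf kap f (x t) (y t) (z t) - om) t1 ta); [| |  |lra].
    - intros t _. apply (is_derive_minus (V := R_NormedModule)).
      + apply (is_derive_opp (V := R_NormedModule)). apply HS.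
      + auto_derive; [exact I|ring].
    - lra.
    - intros t Ht Hw _.
      assert (Hr : 0 <= om * (t - t1) <= d / 2).
      { split; [apply Rmult_le_pos; lra|]. rewrite <- Hom2. apply Rmult_le_compat_l; lra. }
      assert (Hxs : Rabs (x t) <= d / 2) by (apply Rabs_le; lra).
      pose proof (clipf_axis kap f L (x t) (y t) (z t) ltac:(lra) ltac:(lra) Hfl) as F.
      apply Rabs_le_between in F.
      assert (Hf : 0 < f 0 (y t) 0) by (apply Hfneg, y_negative_before; lra).
      assert (L * (2 * Rabs (x t) + kap) <= L * (2 * d)) by (apply Rmult_le_compat_l; lra).
      assert (L * (2 * d) < om); [|lra].
      apply Rmult_lt_reg_r with (h + H); [lra|]. rewrite Hom2.
      replace (L * (2 * d) * (h + H)) with (2 * d * (L * (h + H))) by ring. nra. }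
  assert (om * (ta - t1) <= d / 2); [|lra].
  rewrite <- Hom2. apply Rmult_le_compat_l; lra.
Qed.

Lemma hit_z_lower : - (2 * d) <= z ta.
Proof.
  destruct (Rle_lt_dec u (- d / 2)) as [C|C].
  - destruct (hit_below C) as [_ K]. apply Rabs_le_between in K. lra.
  - pose proof (hit_above ltac:(lra)). pose proof (Hlow ta ltac:(lra)). lra.
Qed.

(** For [u = d], [x] becomes nonnegative while [y <= - 2 * y1], and [y <= - y1] for a further time
    [y1 / M]. In that time [x] grows at least with speed [th], thanks to the lower bound [q] of
    [f(0, y, 0)]; [Heps2] says that [z] then has time to pass [B + 10 * d]. *)
Variables (q y1 th : R).
Hypothesis Hy1 : y1 = g0 * d / (32 * M).
Hypothesis Hqf : forall y, - B <= y <= - y1 -> q <= f 0 y 0.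
Hypothesis Hqk : L * kap <= q / 4.
Hypothesis Hth : 0 < th <= q / 4.
Hypothesis Hth2 : 2 * (L * (th * (h + H))) <= q / 4.
Hypothesis Heps2 : (B + 10 * d + nu) * eps <= th * (y1 / M) ^ 2 / 2.

Lemma hit_exploded : u = d -> 10 * d <= z ta.
Proof.
  intro Hud.
  assert (Hgm : g0 <= M).
  { specialize (Hgb 0 0 0). rewrite Hg00, Rabs_pos_eq in Hgb; lra. }
  assert (Hy1p : 0 < y1).
  { rewrite Hy1. apply Rdiv_lt_0_compat; [apply Rmult_lt_0_compat|]; lra. }
  assert (Hb : 0 < d / (4 * M) <= h / 4).
  { split; [apply Rdiv_lt_0_compat; lra|]. apply Rle_div_l; [lra|]. lra. }
  set (b := d / (4 * M)) in *.
  assert (Hyb : g0 * b = 8 * y1) by (rewrite Hy1; unfold b; field; lra).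
  assert (Hnuy : 10 * nu <= 8 * y1).
  { rewrite Hy1. apply Rmult_le_reg_l with (4 * M); [lra|].
    replace (4 * M * (8 * (g0 * d / (32 * M)))) with (g0 * d) by (field; lra). lra. }
  (* If [x] were negative up to [- b], then [z <= 0] and tracking would hold there, whereas
     [X (- b) >= 3 / 4 * d]. *)
  assert (Hex : exists t2, - h <= t2 <= - b /\ 0 <= x t2).
  { apply NNPP. intro Hno.
    assert (Hz : forall t, t0 <= t <= - b -> z t <= 0).
    { apply z_nonpos_until; [lra|]. intros t Ht. right.
      apply Rnot_le_lt. intro C. apply Hno. exists t. lra. }
    destruct (Htrack (- b) ltac:(lra) Hz) as [T _].
    pose proof (X_speed 0 (- b)) as K.
    rewrite HX0, Rminus_0_r, (Rabs_left (- b)) in K by lra.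
    replace (M * - - b) with (d / 4) in K by (unfold b; field; lra).
    apply Rabs_le_between in K. apply Rabs_le_between in T.
    apply Hno. exists (- b). lra. }
  destruct Hex as [t2 [Ht2 Hxt2]].
  destruct (first_nonneg x (fun t => clipf kap f (x t) (y t) (z t)) (- h) t2) as [t1 [Ht1 [Hxt1 Hbefore]]];
    [intros; apply HS|lra| |exact Hxt2|].
  { destruct track_start as [T _]. apply Rabs_le_between in T. specialize (HXc (- h) ltac:(lra)). lra. }
  assert (Hyt1 : y t1 <= - (2 * y1)).
  { destruct (Htrack t1 ltac:(lra)) as [_ [T _]].
    - apply z_nonpos_until; [lra|]. intros t Ht. right. apply Hbefore. lra.
    - pose proof (Y_slope t1 0 ltac:(lra) ltac:(lra) ltac:(lra)) as K. rewrite HY0 in K.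
      apply Rabs_le_between in T.
      assert (g0 / 2 * b <= g0 / 2 * (0 - t1)) by (apply Rmult_le_compat_l; lra). lra. }
  set (t3 := t1 + y1 / M).
  assert (Hyb2 : 0 < y1 / M).
  { apply Rdiv_lt_0_compat; lra. }
  assert (Ht3 : t1 < t3) by (unfold t3; lra).
  assert (Hyb3 : y1 / M <= b).
  { apply Rle_div_l; [lra|]. assert (g0 * b <= M * b) by (apply Rmult_le_compat_r; lra). lra. }
  assert (Hy3 : forall t, t1 <= t <= t3 -> - B <= y t <= - y1).
  { intros t Ht. destruct (xy_window t ltac:(unfold t3 in *; lra)) as [_ K]. apply Rabs_le_between in K.
    pose proof (y_speed t1 t) as K2. rewrite (Rabs_pos_eq (t - t1)) in K2 by lra.
    apply Rabs_le_between in K2.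
    assert (M * (t - t1) <= y1).
    { apply Rle_trans with (M * (y1 / M)); [apply Rmult_le_compat_l; unfold t3 in *; lra|].
      apply Req_le. field. lra. }
    lra. }
  assert (Hta3 : t3 < ta).
  { apply Rnot_le_lt. intro C. specialize (Hy3 t3 ltac:(unfold t3; lra)).
    pose proof (y_slope ta t3 ltac:(lra) C ltac:(unfold t3; lra)).
    assert (0 <= g0 / 2 * (t3 - ta)) by (apply Rmult_le_pos; lra). lra. }
  assert (Hx3 : forall t, t1 <= t <= t3 -> th * (t - t1) - x t <= 0).
  { apply (barrier_nonpos (fun t => th * (t - t1) - x t) (fun t => th - clipf kap f (x t) (y t) (z t))).
    - intros t _. apply (is_derive_minus (V := R_NormedModule)); [|apply HS].
      auto_derive; [exact I|ring].
    - lra.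
    - intros t Ht Hw _.
      assert (Hr : 0 <= th * (t - t1) <= th * (h + H)).
      { split; [apply Rmult_le_pos; lra|]. apply Rmult_le_compat_l; lra. }
      assert (Hxs : Rabs (x t) <= th * (h + H)) by (apply Rabs_le; lra).
      pose proof (clipf_axis kap f L (x t) (y t) (z t) ltac:(lra) ltac:(lra) Hfl) as F.
      apply Rabs_le_between in F.
      specialize (Hqf (y t) (Hy3 t ltac:(lra))).
      assert (L * (2 * Rabs (x t) + kap) <= L * (2 * (th * (h + H)) + kap)) by (apply Rmult_le_compat_l; lra).
      lra. }
  assert (Hz3 : B + 10 * d <= z t3).
  (* Linear growth of [x] forces at least quadratic growth of [z], with the large factor
     [1 / eps]. *)
  { assert (K : 0 * (t3 - t1) <= (z t3 - th / (2 * eps) * (t3 - t1) ^ 2) - (z t1 - th / (2 * eps) * (t1 - t1) ^ 2)).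
    { apply (mean_value_lower (fun t => z t - th / (2 * eps) * (t - t1) ^ 2)
       (fun t => fast eps (x t) (y t) (z t) - th / eps * (t - t1))); [unfold t3; lra| |].
      - intros t _. apply (is_derive_minus (V := R_NormedModule)); [apply HS|].
        auto_derive; [exact I|]. field. lra.
      - intros t Ht. specialize (Hx3 t ltac:(lra)). unfold fast.
        pose proof (Rabs_pos (z t)).
        replace ((x t + Rabs (z t)) / eps - th / eps * (t - t1)) with ((x t + Rabs (z t) - th * (t - t1)) / eps) by (field; lra).
        apply Rdiv_le_0_compat; lra. }
    pose proof (Hlow t1 ltac:(lra)).
    replace (t3 - t1) with (y1 / M) in K by (unfold t3; ring).
    rewrite Rminus_diag in K.
    assert (B + 10 * d + nu <= th / (2 * eps) * (y1 / M) ^ 2).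
    { replace (th / (2 * eps) * (y1 / M) ^ 2) with (th * (y1 / M) ^ 2 / 2 / eps) by (field; lra).
      apply Rle_div_r; lra. }
    lra. }
  (* Above the level [B] the variable [z] increases whatever the sign of [x], as [|x| <= B] in the
     window. *)
  assert (Hfin : B + 10 * d - z ta <= 0).
  { apply (barrier_nonpos (fun t => B + 10 * d - z t) (fun t => 0 - fast eps (x t) (y t) (z t)) t3 ta); [| | |lra].
    - intros t _. apply (is_derive_minus (V := R_NormedModule)); [|apply HS].
      apply (is_derive_const (V := R_NormedModule)).
    - lra.
    - intros t Ht Hw _. destruct (xy_window t ltac:(lra)) as [K _]. apply Rabs_le_between in K.
      pose proof B_pos. unfold fast. rewrite Rabs_pos_eq by lra.
      assert (0 < (x t + z t) / eps) by (apply Rdiv_lt_0_compat; lra). lra. }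
  pose proof B_pos. lra.
Qed.

End Window.

(** * Choice of the constants of the window *)

Lemma positive_min (F : R -> R) a b :
  (forall t, a <= t <= b -> continuity_pt F t) -> (forall t, a <= t <= b -> 0 < F t) ->
  exists q, 0 < q /\ forall t, a <= t <= b -> q <= F t.
Proof.
  intros HC HF. destruct (Rle_lt_dec a b) as [Hab|Hab].
  - destruct (continuity_ab_min F a b Hab HC) as [m [Hm1 Hm2]].
    exists (F m). split; [apply HF, Hm2|intros; apply Hm1; assumption].
  - exists 1. split; [lra|intros; lra].
Qed.

Lemma linear_small A b : 0 < b -> exists e1, 0 < e1 /\ forall e, 0 < e < e1 -> A * e <= b.
Proof.
  intro Hb. destruct (Rle_lt_dec A 0) as [C|C].
  - exists 1. split; [lra|]. intros. nra.
  - exists (b / A). split; [apply Rdiv_lt_0_compat; assumption|].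
    intros e He. apply Rle_trans with (A * (b / A)); [apply Rmult_le_compat_l; lra|apply Req_le; field; lra].
Qed.

(* [ta] is the time at which the trajectory meets [y = 0], [t0] its starting time and [u]
   the abscissa at which the planar trajectory through the same point meets [y = 0]. *)
Definition side_hit (h H d u g0 t0 ta : R) (x y z : R -> R) : Prop :=
  - h < ta < H /\ y ta = 0 /\
  (forall t, - h <= t <= H -> g0 / 2 * Rabs (t - ta) <= Rabs (y t)) /\
  (u = d -> 10 * d <= z ta) /\
  (u <= - d / 2 -> Rabs (x ta - u) <= d / 10 /\ Rabs (z ta - u) <= d / 10) /\
  (- d / 2 <= u -> - (3 / 4 * d) <= x ta) /\
  - (2 * d) <= z ta /\
  (forall t, t0 < t <= ta -> z t < 0 \/ x t0 < x t).

Lemma diagonal_lip F L : lip3 F L -> lip3 (fun x y _ => F x y x) (2 * L).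
Proof.
  intros HF a b c a' b' c'. pose proof (HF a b a a' b' a') as K.
  assert (0 <= L).
  { pose proof (HF 1 0 0 0 0 0) as K0. rewrite !Rminus_0_r, Rabs_R0, Rabs_R1 in K0.
    pose proof (Rabs_pos (F 1 0 0 - F 0 0 0)). lra. }
  eapply Rle_trans; [exact K|].
  pose proof (Rabs_pos (a - a')). pose proof (Rabs_pos (b - b')). pose proof (Rabs_pos (c - c')). nra.
Qed.

(** Planar systems are treated as spatial ones with a constant third component. *)
Lemma zero_lip L : 0 <= L -> lip3 (fun _ _ _ => 0) L.
Proof.
  intros HL a b c a' b' c'. rewrite Rminus_diag, Rabs_R0.
  pose proof (Rabs_pos (a - a')). pose proof (Rabs_pos (b - b')). pose proof (Rabs_pos (c - c')).
  apply Rmult_le_pos; lra.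
Qed.

Lemma planar_dist f g L X Y X' Y' :
  0 < L -> lip3 f L -> lip3 g L -> planar f g X Y -> planar f g X' Y' -> Y 0 = 0 -> Y' 0 = 0 ->
  forall t, Rabs (X t - X' t) <= Rabs (X 0 - X' 0) * exp (12 * L * Rabs t) /\
            Rabs (Y t - Y' t) <= Rabs (X 0 - X' 0) * exp (12 * L * Rabs t).
Proof.
  intros HL Hf Hg HP HP' HY HY' t.
  assert (SS : forall X Y, planar f g X Y -> sol3 (fun x y _ => f x y x) (fun x y _ => g x y x) (fun _ _ _ => 0) X Y (fun _ => 0)).
  { intros U V HUV s. destruct (HUV s) as [D1 D2]. split; [exact D1|split; [exact D2|]].
    apply (is_derive_const (V := R_NormedModule)). }
  pose proof (solutions_dist _ _ _ (2 * L) _ _ _ _ _ _ ltac:(lra) (diagonal_lip f L Hf) (diagonal_lip g L Hg) (zero_lip (2 * L) ltac:(lra)) (SS _ _ HP) (SS _ _ HP') 0 t) as E.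
  unfold sqdist in E. rewrite HY, HY', !Rminus_0_r in E.
  assert (Ex : exp (12 * (2 * L) * Rabs t) = exp (12 * L * Rabs t) ^ 2).
  { simpl. rewrite Rmult_1_r, <- exp_plus. f_equal. ring. }
  rewrite Ex in E. pose proof (exp_pos (12 * L * Rabs t)) as Ep.
  pose proof (Rabs_pos (X 0 - X' 0)) as Ap.
  pose proof (pow2_ge_0 (X t - X' t)). pose proof (pow2_ge_0 (Y t - Y' t)).
  assert (R2 : (Rabs (X 0 - X' 0) * exp (12 * L * Rabs t)) ^ 2 = (X 0 - X' 0) ^ 2 * exp (12 * L * Rabs t) ^ 2).
  { rewrite Rpow_mult_distr, pow2_abs. reflexivity. }
  split; (apply sq_le_abs; [apply Rmult_le_pos; lra|]); rewrite R2; simpl in *; lra.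
Qed.

(** The order of quantifiers is the content: the bound [e1] is independent of [s] and [u], so that
    one [eps] serves the whole parameter square, and [k] is chosen before [eps]. *)
Theorem forward_hit f g L M g0 xa ya Ta tau :
  0 < L -> 0 < M -> (forall x y z, Rabs (f x y z) <= M) -> (forall x y z, Rabs (g x y z) <= M) ->
  lip3 f L -> lip3 g L -> f 0 0 0 = 0 -> 0 < g0 -> g 0 0 0 = g0 ->
  (forall y, y < 0 -> 0 < f 0 y 0) ->
  planar f g xa ya -> xa 0 = 0 -> ya 0 = 0 -> Ta < tau < 0 -> (forall t, Ta < t < 0 -> xa t < 0) ->
  forall eta, 0 < eta ->
  exists h H s1 d1, 0 < h < eta /\ 0 < H < eta /\ 0 < s1 /\ 0 < d1 /\
  forall d, 0 < d <= d1 -> exists k1, 0 < k1 /\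
  forall k, 0 < k <= k1 -> exists e1, 0 < e1 /\
  forall eps, 0 < eps < e1 ->
  forall s u X Y x y z, Rabs s <= s1 -> - d <= u <= d ->
    planar f g X Y -> X 0 = u -> Y 0 = 0 ->
    sol3 (clipf k f) (clipf k g) (fast eps) x y z ->
    x (tau + s) = X (tau + s) -> y (tau + s) = Y (tau + s) -> z (tau + s) = 0 ->
    tau + s < - h /\ exists ta, side_hit h H d u g0 (tau + s) ta x y z.
Proof.
  intros HL HM Hfb Hgb Hf Hg Hf0 Hg0 Hg00 Hfneg Hpa Hxa0 Hya0 Htau Hxa eta Heta.
  assert (Hcx : forall t, continuity_pt xa t).
  { intro t. apply derivable_continuous_pt. exists (f (xa t) (ya t) (xa t)). apply is_derive_Reals, Hpa. }
  assert (Hneg : forall a b, Ta < a -> b < 0 -> exists c, 0 < c /\ forall t, a <= t <= b -> xa t <= - c).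
  { intros a b Ha Hb. destruct (positive_min (fun t => - xa t) a b) as [q [Hq Hqt]].
    - intros t _. apply continuity_pt_opp, Hcx.
    - intros t Ht. specialize (Hxa t ltac:(lra)). lra.
    - exists q. split; [exact Hq|]. intros t Ht. specialize (Hqt t Ht). simpl in Hqt. lra. }
  assert (Hmin2 : forall a b, 0 < a -> 0 < b -> exists m, 0 < m /\ m <= a /\ m <= b).
  { intros a b Ha Hb. exists (Rmin a b). split; [apply Rmin_pos; assumption|].
    split; [apply Rmin_l|apply Rmin_r]. }
  assert (Hdiv : forall a b, 0 < a -> 0 < b -> 0 < a / b) by (intros; apply Rdiv_lt_0_compat; assumption).
  destruct (Hmin2 ((tau - Ta) / 2) (- tau / 4)) as [s1 [Hs1 [Hs1a Hs1b]]]; [lra|lra|].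
  destruct (Hneg (tau - s1) (tau + s1) ltac:(lra) ltac:(lra)) as [c0 [Hc0 Hxc0]].
  assert (HLM : 0 < L * M) by (apply Rmult_lt_0_compat; assumption).
  (* [hm] will be the length [h + H] of the window. As [B <= 4 * M * hm], these bounds give
     [8 * L * B <= g0], [8 * L * hm <= 1] and [2 * B <= c0 / 2]; the last one, [eta / 2], localizes
     the hitting time. *)
  destruct (Hmin2 (g0 / (32 * (L * M))) (1 / (8 * L))) as [m1 [Hm1 [Hm1a Hm1b]]]; [apply Hdiv; lra|apply Hdiv; lra|].
  destruct (Hmin2 (c0 / (16 * M)) (eta / 2)) as [m2 [Hm2 [Hm2a Hm2b]]]; [apply Hdiv; lra|lra|].
  destruct (Hmin2 m1 m2 Hm1 Hm2) as [m3 [Hm3 [Hm3a Hm3b]]].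
  destruct (Hmin2 m3 (- tau / 4) Hm3 ltac:(lra)) as [hm [Hhm [Hhma Hhmb]]].
  assert (HMg : 0 < 4 * M / g0) by (apply Hdiv; lra).
  (* The splitting for which [h + H = hm] and [g0 / 2 * H = 2 * M * h]. *)
  set (h := hm / (1 + 4 * M / g0)).
  set (H := 4 * M / g0 * h).
  assert (Hh : 0 < h) by (apply Hdiv; lra).
  assert (HH : 0 < H) by (apply Rmult_lt_0_compat; assumption).
  assert (HhH : h + H = hm) by (unfold H, h; field; lra).
  assert (HHg : g0 / 2 * H = 2 * M * h) by (unfold H; field; lra).
  set (B := 3 * M * h + M * (h + H)).
  assert (HMh : 0 < M * h) by (apply Rmult_lt_0_compat; assumption).
  assert (HMH : 0 < M * H) by (apply Rmult_lt_0_compat; assumption).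
  assert (HBhm : B <= 4 * (M * hm)) by (unfold B; rewrite <- HhH; lra).
  assert (H1 : 32 * (L * M) * hm <= g0).
  { apply Rle_trans with (32 * (L * M) * (g0 / (32 * (L * M)))); [apply Rmult_le_compat_l; lra|].
    apply Req_le; field; lra. }
  assert (H2 : 8 * L * hm <= 1).
  { apply Rle_trans with (8 * L * (1 / (8 * L))); [apply Rmult_le_compat_l; lra|].
    apply Req_le; field; lra. }
  assert (H3 : 16 * M * hm <= c0).
  { apply Rle_trans with (16 * M * (c0 / (16 * M))); [apply Rmult_le_compat_l; lra|].
    apply Req_le; field; lra. }
  destruct (Hneg (tau - s1) (- h) ltac:(lra) ltac:(lra)) as [c2 [Hc2 Hxc2]].
  set (CG := exp (12 * L * - Ta)).
  assert (HCG : 0 < CG) by apply exp_pos.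
  (* On [[Ta, 0]] the trajectories with [|u| <= d] stay within [d * CG] of [xa], so they inherit
     half of its distance from [x = 0]. *)
  destruct (Hmin2 (c2 / 2 / CG) (c0 / 2 / CG)) as [d2 [Hd2 [Hd2a Hd2b]]]; [apply Hdiv; lra|apply Hdiv; lra|].
  destruct (Hmin2 d2 (M * h) Hd2 HMh) as [d1 [Hd1 [Hd1a Hd1b]]].
  exists h, H, s1, d1. split; [lra|]. split; [lra|]. split; [exact Hs1|]. split; [exact Hd1|].
  intros d Hd.
  set (y1 := g0 * d / (32 * M)).
  assert (Hg0d : 0 < g0 * d) by (apply Rmult_lt_0_compat; lra).
  assert (Hy1 : 0 < y1) by (apply Hdiv; lra).
  destruct (positive_min (fun y => f 0 y 0) (- B) (- y1)) as [q [Hq Hqf]].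
  { intros t _. apply continuity_pt_filterlim.
    apply (lip3_continuous f L (fun _ => 0) (fun y => y) (fun _ => 0)); auto; try apply continuous_const; apply continuous_id. }
  { intros t Ht. apply Hfneg. lra. }
  destruct (Hmin2 d (q / (4 * L))) as [k1 [Hk1 [Hk1a Hk1b]]]; [lra|apply Hdiv; lra|].
  exists k1. split; [exact Hk1|]. intros k Hk.
  assert (Hqk : L * k <= q / 4).
  { apply Rle_trans with (L * (q / (4 * L))); [apply Rmult_le_compat_l; lra|].
    apply Req_le; field; lra. }
  destruct (Hmin2 (q / 4) (q / (8 * (L * hm)))) as [th [Hth [Htha Hthb]]].
  { lra. } { apply Hdiv; [lra|]. assert (0 < L * hm) by (apply Rmult_lt_0_compat; lra). lra. }
  assert (Hth2 : 2 * (L * (th * (h + H))) <= q / 4).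
  { rewrite HhH. apply Rle_trans with (2 * (L * (q / (8 * (L * hm)) * hm))).
    - apply Rmult_le_compat_l; [lra|]. apply Rmult_le_compat_l; [lra|]. apply Rmult_le_compat_r; lra.
    - apply Req_le. field. lra. }
  destruct (Hmin2 (c2 / 4) (d / 40)) as [n1 [Hn1 [Hn1a Hn1b]]]; [lra|lra|].
  destruct (Hmin2 n1 (g0 * d / (40 * M)) Hn1 ltac:(apply Hdiv; lra)) as [nu [Hnu [Hnua Hnub]]].
  assert (HnuM : 40 * (M * nu) <= g0 * d).
  { apply Rle_trans with (40 * (M * (g0 * d / (40 * M)))); [|apply Req_le; field; lra].
    apply Rmult_le_compat_l; [lra|]. apply Rmult_le_compat_l; lra. }
  assert (Hnu2 : 0 < nu ^ 2) by (apply pow_lt; exact Hnu).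
  set (P := d + M * - Ta).
  set (Lam := 2 * L).
  destruct (linear_small ((2 * Lam * P ^ 2 + M ^ 2) * exp (8 * Lam * (H - Ta))) (nu ^ 2) Hnu2) as [e1 [He1 He1']].
  (* [P] bounds [|X t0|]. The time elapsed before the window is at least [- tau / 2], because
     [t0 <= 3 / 4 * tau] and [h <= - tau / 4]. *)
  destruct (linear_small (M ^ 2 + P ^ 2 / (- tau / 2)) (nu ^ 2) Hnu2) as [e2 [He2 He2']].
  destruct (linear_small M nu Hnu) as [e3 [He3 He3']].
  destruct (linear_small (B + 10 * d + nu) (th * (y1 / M) ^ 2 / 2)) as [e4 [He4 He4']].
  { apply Hdiv; [|lra]. apply Rmult_lt_0_compat; [exact Hth|]. apply pow_lt, Hdiv; assumption. }
  destruct (Hmin2 e1 e2 He1 He2) as [e5 [He5 [He5a He5b]]].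
  destruct (Hmin2 e3 e4 He3 He4) as [e6 [He6 [He6a He6b]]].
  destruct (Hmin2 e5 e6 He5 He6) as [e7 [He7 [He7a He7b]]].
  destruct (Hmin2 e7 1 He7 ltac:(lra)) as [e8 [He8 [He8a He8b]]].
  exists e8. split; [exact He8|].
  intros eps Heps s u X Y x y z Hs Hu HP HX0 HY0 HS Hx Hy Hz.
  specialize (He1' eps ltac:(lra)). specialize (He2' eps ltac:(lra)).
  specialize (He3' eps ltac:(lra)). specialize (He4' eps ltac:(lra)).
  apply Rabs_le_between in Hs.
  set (t0 := tau + s) in *.
  assert (Ht0 : Ta < t0 <= 3 / 4 * tau) by (unfold t0; lra).
  assert (Ht0' : tau - s1 <= t0 <= tau + s1) by (unfold t0; lra).
  assert (Ht0h : t0 < - h) by lra.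
  assert (HXclose : forall t, Ta <= t <= 0 -> Rabs (X t - xa t) <= d * CG).
  { intros t Ht. destruct (planar_dist f g L X Y xa ya HL Hf Hg HP Hpa HY0 Hya0 t) as [K _].
    rewrite HX0, Hxa0, Rminus_0_r in K. eapply Rle_trans; [exact K|].
    apply Rmult_le_compat; [apply Rabs_pos|left; apply exp_pos|apply Rabs_le; lra|].
    apply exp_mono, Rmult_le_compat_l; [lra|]. rewrite Rabs_left1; lra. }
  assert (HdCG1 : d * CG <= c2 / 2).
  { apply Rle_trans with (c2 / 2 / CG * CG); [apply Rmult_le_compat_r; lra|apply Req_le; field; lra]. }
  assert (HdCG2 : d * CG <= c0 / 2).
  { apply Rle_trans with (c0 / 2 / CG * CG); [apply Rmult_le_compat_r; lra|apply Req_le; field; lra]. }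
  assert (HXc : forall t, t0 <= t <= - h -> X t <= - (c2 / 2)).
  { intros t Ht. specialize (HXclose t ltac:(lra)). apply Rabs_le_between in HXclose.
    specialize (Hxc2 t ltac:(lra)). lra. }
  assert (HXB : X t0 <= - (2 * B)).
  { specialize (HXclose t0 ltac:(lra)). apply Rabs_le_between in HXclose.
    specialize (Hxc0 t0 ltac:(lra)). lra. }
  assert (HXP : X t0 ^ 2 <= P ^ 2).
  { apply pow_maj_Rabs.
    pose proof (mean_value_abs X (fun t => f (X t) (Y t) (X t)) M (fun t => proj1 (HP t)) (fun t => Hfb _ _ _) 0 t0) as K.
    rewrite HX0, Rminus_0_r, (Rabs_left t0) in K by lra. apply Rabs_le_between in K.
    assert (M * - t0 <= M * - Ta) by (apply Rmult_le_compat_l; lra).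
    apply Rabs_le. unfold P. lra. }
  assert (HPk : planar (clipf k f) (clipf k g) X Y).
  { intro t. destruct (HP t) as [D1 D2]. rewrite !clipf_diag by lra. split; assumption. }
  assert (HLam : 0 < Lam) by (unfold Lam; lra).
  assert (Htrack : forall t1, t0 <= t1 <= H -> (forall t, t0 <= t <= t1 -> z t <= 0) ->
     Rabs (x t1 - X t1) <= nu /\ Rabs (y t1 - Y t1) <= nu /\ (- h <= t1 -> Rabs (z t1 - x t1) <= nu)).
  { intros t1 Ht1 Hzneg.
    destruct (slow_manifold_tracking (clipf k f) (clipf k g) Lam M eps X Y x y z t0 t1) as [T1 T2];
      [exact HLam|lra|lra|lra|apply clipf_lip; [lra|assumption]|apply clipf_lip; [lra|assumption]
      |intros; apply Hfb|exact HPk|exact HS|exact Hx|exact Hy|exact Hz|exact Hzneg|].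
    assert (T3 : (x t1 - X t1) ^ 2 + (y t1 - Y t1) ^ 2 <= nu ^ 2).
    { eapply Rle_trans; [exact T1|]. eapply Rle_trans; [|exact He1'].
      replace ((2 * Lam * P ^ 2 + M ^ 2) * exp (8 * Lam * (H - Ta)) * eps)
        with (eps * (2 * Lam * P ^ 2 + M ^ 2) * exp (8 * Lam * (H - Ta))) by ring.
      assert (0 <= X t0 ^ 2) by apply pow2_ge_0. assert (0 <= M ^ 2) by apply pow2_ge_0.
      assert (0 <= 2 * Lam * X t0 ^ 2) by (apply Rmult_le_pos; lra).
      apply Rmult_le_compat; [apply Rmult_le_pos; lra|left; apply exp_pos| |].
      - apply Rmult_le_compat_l; [lra|]. apply Rplus_le_compat_r. apply Rmult_le_compat_l; lra.
      - apply exp_mono. apply Rmult_le_compat_l; lra. }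
    pose proof (pow2_ge_0 (x t1 - X t1)). pose proof (pow2_ge_0 (y t1 - Y t1)).
    split; [apply sq_le_abs; lra|]. split; [apply sq_le_abs; lra|].
    intro Ht1h. specialize (T2 ltac:(lra)). apply sq_le_abs; [lra|].
    eapply Rle_trans; [exact T2|]. eapply Rle_trans; [|exact He2'].
    rewrite (Rmult_comm (M ^ 2 + P ^ 2 / (- tau / 2))). apply Rmult_le_compat_l; [lra|].
    apply Rplus_le_compat_l. unfold Rdiv at 1 2. apply Rmult_le_compat; [apply pow2_ge_0| |exact HXP|].
    - left. apply Rinv_0_lt_compat. lra.
    - apply Rinv_le_contravar; lra. }
  assert (Hlow : forall t, t0 <= t -> - nu <= z t - x t).
  { intros t Ht. pose proof (slow_manifold_lower (clipf k f) (clipf k g) M eps x y z t0 t) as K.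
    assert (0 < B) by (unfold B; lra).
    specialize (K ltac:(lra) Ht (fun _ _ _ => Hfb _ _ _) HS ltac:(lra)). lra. }
  assert (W1 : 3 * M * h + M * (h + H) <= B) by apply Rle_refl.
  assert (W2 : 8 * (L * B) <= g0).
  { assert (L * B <= L * (4 * (M * hm))) by (apply Rmult_le_compat_l; lra). lra. }
  assert (W3 : 8 * (L * (h + H)) <= 1) by (rewrite HhH; lra).
  assert (W4 : 2 * M * h <= g0 / 2 * H) by lra.
  assert (W5 : 0 < d <= M * h) by lra.
  assert (W6 : 0 < k <= d) by lra.
  assert (W7 : 0 < nu < c2 / 2) by lra.
  assert (W8 : nu <= d / 40) by lra.
  assert (W9 : 0 < eps) by lra.
  split; [exact Ht0h|].
  destruct (hitting_time f g L M HL HM Hfb Hgb Hg g0 Hg0 Hg00 t0 h H B (c2 / 2) d u k eps nu X Y x y z) as [ta [Hta [Hyta Hsl]]]; auto.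
  exists ta.
  split; [exact Hta|]. split; [exact Hyta|]. split; [exact Hsl|].
  split; [apply (hit_exploded f g L M HL HM Hfb Hgb Hf Hg g0 Hg0 Hg00 t0 h H B (c2 / 2) d u k eps nu X Y x y z)
    with (q := q) (y1 := y1) (th := th); auto; lra|].
  split; [apply (hit_below f g L M HL HM Hfb Hgb Hf Hg Hf0 g0 Hg0 Hg00 Hfneg t0 h H B (c2 / 2) d u k eps nu X Y x y z); auto|].
  split; [apply (hit_above f g L M HL HM Hfb Hgb Hf Hg g0 Hg0 Hg00 Hfneg t0 h H B (c2 / 2) d u k eps nu X Y x y z); auto|].
  split; [apply (hit_z_lower f g L M HL HM Hfb Hgb Hf Hg Hf0 g0 Hg0 Hg00 Hfneg t0 h H B (c2 / 2) d u k eps nu X Y x y z); auto|].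
  apply (leaves_start f g M HM Hfb Hgb g0 Hg0 t0 h H B (c2 / 2) d u k eps nu X Y x y z); auto.
Qed.

(** * Transversal crossing of two families of curves *)

(** An implicit function theorem for curves differentiable along themselves but only Lipschitz in
    the parameter, as trajectories of Lipschitz fields are. Applying the inverse of the linear part
    turns the difference of the curves into a map [(Phi1, Phi2)] close to the identity in [(s, t)];
    Poincare-Miranda gives its zero, and closeness to the identity makes the zero Lipschitz in
    [(u, v)]. *)
Lemma transversal_crossing (E1 E2 G1 G2 : R -> R -> R) (a1 a2 r1 r2 C : R) :
  a1 * r2 - a2 * r1 <> 0 -> 0 <= C ->
  (forall nu, 0 < nu -> exists rho, 0 < rho /\ forall u s s', Rabs u <= rho -> Rabs s <= rho -> Rabs s' <= rho ->
     Rabs (E1 u s - E1 u s' - a1 * (s - s')) <= nu * Rabs (s - s') /\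
     Rabs (E2 u s - E2 u s' - a2 * (s - s')) <= nu * Rabs (s - s') /\
     Rabs (G1 u s - G1 u s' - r1 * (s - s')) <= nu * Rabs (s - s') /\
     Rabs (G2 u s - G2 u s' - r2 * (s - s')) <= nu * Rabs (s - s')) ->
  (forall u u' s, Rabs s <= 1 ->
     Rabs (E1 u s - E1 u' s) <= C * Rabs (u - u') /\ Rabs (E2 u s - E2 u' s) <= C * Rabs (u - u') /\
     Rabs (G1 u s - G1 u' s) <= C * Rabs (u - u') /\ Rabs (G2 u s - G2 u' s) <= C * Rabs (u - u')) ->
  E1 0 0 = G1 0 0 -> E2 0 0 = G2 0 0 ->
  forall S, 0 < S -> exists d0 K (s t : R -> R -> R), 0 < d0 /\ 0 <= K /\
  (forall u v, Rabs u <= d0 -> Rabs v <= d0 -> Rabs (s u v) <= S /\ Rabs (t u v) <= S /\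
     E1 u (s u v) = G1 v (t u v) /\ E2 u (s u v) = G2 v (t u v)) /\
  (forall u v u' v', Rabs u <= d0 -> Rabs v <= d0 -> Rabs u' <= d0 -> Rabs v' <= d0 ->
     Rabs (s u v - s u' v') <= K * (Rabs (u - u') + Rabs (v - v')) /\
     Rabs (t u v - t u' v') <= K * (Rabs (u - u') + Rabs (v - v'))).
Proof.
  intros HA HC Hlin HLip H01 H02 S HS.
  set (A := a1 * r2 - a2 * r1) in *.
  assert (HAp : 0 < Rabs A) by (apply Rabs_pos_lt, HA).
  set (m := (Rabs a1 + Rabs a2 + Rabs r1 + Rabs r2) / Rabs A).
  assert (Hm : 0 <= m).
  { apply Rdiv_le_0_compat; [|exact HAp]. pose proof (Rabs_pos a1). pose proof (Rabs_pos a2).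
    pose proof (Rabs_pos r1). pose proof (Rabs_pos r2). lra. }
  (* [m] bounds the inverse of the linear part, so this accuracy leaves [Phi - id] with Lipschitz
     constant [1 / 4]. *)
  destruct (Hlin (/ (4 * (m + 1)))) as [rho [Hrho Hl]]; [apply Rinv_0_lt_compat; lra|].
  set (nu := / (4 * (m + 1))) in *.
  assert (Hmn : m * nu <= 1 / 4).
  { unfold nu. apply Rmult_le_reg_r with (4 * (m + 1)); [lra|]. rewrite Rmult_assoc, Rinv_l by lra. lra. }
  (* solution of [s (a1, a2) - t (r1, r2) = (p, q)] by Cramer's rule *)
  set (cr1 := fun p q => (p * r2 - q * r1) / A).
  set (cr2 := fun p q => (p * a2 - q * a1) / A).
  assert (Hcr : forall p q b, Rabs p <= b -> Rabs q <= b -> Rabs (cr1 p q) <= m * b /\ Rabs (cr2 p q) <= m * b).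
  { intros p q b Hp Hq.
    assert (0 <= b) by (eapply Rle_trans; [apply Rabs_pos|exact Hp]).
    assert (Hgen : forall r r', Rabs r + Rabs r' <= Rabs a1 + Rabs a2 + Rabs r1 + Rabs r2 ->
      Rabs ((p * r - q * r') / A) <= m * b).
    { intros r r' Hr. unfold Rdiv. rewrite Rabs_mult, Rabs_inv.
      replace (m * b) with ((Rabs a1 + Rabs a2 + Rabs r1 + Rabs r2) * b * / Rabs A) by (unfold m; field; lra).
      apply Rmult_le_compat_r; [left; apply Rinv_0_lt_compat, HAp|].
      eapply Rle_trans; [apply Rabs_triang|]. rewrite Rabs_Ropp, !Rabs_mult.
      pose proof (Rabs_pos r). pose proof (Rabs_pos r').
      assert (Rabs p * Rabs r <= b * Rabs r) by (apply Rmult_le_compat_r; lra).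
      assert (Rabs q * Rabs r' <= b * Rabs r') by (apply Rmult_le_compat_r; lra).
      assert (b * (Rabs r + Rabs r') <= b * (Rabs a1 + Rabs a2 + Rabs r1 + Rabs r2)) by (apply Rmult_le_compat_l; lra).
      lra. }
    pose proof (Rabs_pos a1). pose proof (Rabs_pos a2). pose proof (Rabs_pos r1). pose proof (Rabs_pos r2).
    split; apply Hgen; lra. }
  set (Phi1 := fun u v s t => cr1 (E1 u s - G1 v t) (E2 u s - G2 v t)).
  set (Phi2 := fun u v s t => cr2 (E1 u s - G1 v t) (E2 u s - G2 v t)).
  assert (HPst : forall u v s t s' t', Rabs u <= rho -> Rabs v <= rho -> Rabs s <= rho -> Rabs t <= rho ->
     Rabs s' <= rho -> Rabs t' <= rho ->
     Rabs (Phi1 u v s t - Phi1 u v s' t' - (s - s')) <= 1 / 4 * (Rabs (s - s') + Rabs (t - t')) /\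
     Rabs (Phi2 u v s t - Phi2 u v s' t' - (t - t')) <= 1 / 4 * (Rabs (s - s') + Rabs (t - t'))).
  { intros u v s t s' t' Hu Hv Hs Ht Hs' Ht'.
    destruct (Hl u s s' Hu Hs Hs') as [L1 [L2 _]]. destruct (Hl v t t' Hv Ht Ht') as [_ [_ [L3 L4]]].
    set (p := (E1 u s - E1 u s' - a1 * (s - s')) - (G1 v t - G1 v t' - r1 * (t - t'))).
    set (q := (E2 u s - E2 u s' - a2 * (s - s')) - (G2 v t - G2 v t' - r2 * (t - t'))).
    assert (Hp : Rabs p <= nu * (Rabs (s - s') + Rabs (t - t'))).
    { unfold p, Rminus at 1. eapply Rle_trans; [apply Rabs_triang|]. rewrite Rabs_Ropp. lra. }
    assert (Hq : Rabs q <= nu * (Rabs (s - s') + Rabs (t - t'))).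
    { unfold q, Rminus at 1. eapply Rle_trans; [apply Rabs_triang|]. rewrite Rabs_Ropp. lra. }
    destruct (Hcr p q _ Hp Hq) as [B1 B2].
    replace (Phi1 u v s t - Phi1 u v s' t' - (s - s')) with (cr1 p q)
      by (unfold Phi1, cr1, p, q, A; field; exact HA).
    replace (Phi2 u v s t - Phi2 u v s' t' - (t - t')) with (cr2 p q)
      by (unfold Phi2, cr2, p, q, A; field; exact HA).
    assert (m * (nu * (Rabs (s - s') + Rabs (t - t'))) <= 1 / 4 * (Rabs (s - s') + Rabs (t - t'))).
    { rewrite <- Rmult_assoc. apply Rmult_le_compat_r; [|exact Hmn].
      pose proof (Rabs_pos (s - s')). pose proof (Rabs_pos (t - t')). lra. }
    lra. }
  assert (HPuv : forall u v u' v' s t, Rabs s <= 1 -> Rabs t <= 1 ->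
     Rabs (Phi1 u v s t - Phi1 u' v' s t) <= m * C * (Rabs (u - u') + Rabs (v - v')) /\
     Rabs (Phi2 u v s t - Phi2 u' v' s t) <= m * C * (Rabs (u - u') + Rabs (v - v'))).
  { intros u v u' v' s t Hs Ht.
    destruct (HLip u u' s Hs) as [L1 [L2 _]]. destruct (HLip v v' t Ht) as [_ [_ [L3 L4]]].
    set (p := (E1 u s - E1 u' s) - (G1 v t - G1 v' t)).
    set (q := (E2 u s - E2 u' s) - (G2 v t - G2 v' t)).
    assert (Hp : Rabs p <= C * (Rabs (u - u') + Rabs (v - v'))).
    { unfold p, Rminus at 1. eapply Rle_trans; [apply Rabs_triang|]. rewrite Rabs_Ropp. lra. }
    assert (Hq : Rabs q <= C * (Rabs (u - u') + Rabs (v - v'))).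
    { unfold q, Rminus at 1. eapply Rle_trans; [apply Rabs_triang|]. rewrite Rabs_Ropp. lra. }
    destruct (Hcr p q _ Hp Hq) as [B1 B2].
    replace (Phi1 u v s t - Phi1 u' v' s t) with (cr1 p q) by (unfold Phi1, cr1, p, q, A; field; exact HA).
    replace (Phi2 u v s t - Phi2 u' v' s t) with (cr2 p q) by (unfold Phi2, cr2, p, q, A; field; exact HA).
    rewrite !Rmult_assoc. split; assumption. }
  assert (Hzero : forall u v s t, Phi1 u v s t = 0 -> Phi2 u v s t = 0 -> E1 u s = G1 v t /\ E2 u s = G2 v t).
  { intros u v s t P1 P2. unfold Phi1, cr1 in P1. unfold Phi2, cr2 in P2.
    set (p := E1 u s - G1 v t) in *. set (q := E2 u s - G2 v t) in *.
    assert (Hp : p = a1 * ((p * r2 - q * r1) / A) - r1 * ((p * a2 - q * a1) / A)) by (unfold A; field; exact HA).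
    assert (Hq : q = a2 * ((p * r2 - q * r1) / A) - r2 * ((p * a2 - q * a1) / A)) by (unfold A; field; exact HA).
    rewrite P1, P2 in Hp, Hq. unfold p, q in Hp, Hq. lra. }
  set (S' := Rmin S (Rmin rho 1)).
  assert (HS' : 0 < S' /\ S' <= S /\ S' <= rho /\ S' <= 1).
  { unfold S'. pose proof (Rmin_l S (Rmin rho 1)). pose proof (Rmin_r S (Rmin rho 1)).
    pose proof (Rmin_l rho 1). pose proof (Rmin_r rho 1). split; [|lra].
    repeat apply Rmin_pos; lra. }
  assert (HmC : 0 <= m * C) by (apply Rmult_le_pos; assumption).
  (* Makes [|Phi (0, 0)| <= S' / 4]. On the square of half side [S'] this gives
     [|Phi - id| <= S' / 4 + 2 * S' / 4 < S'], hence the signs on the sides. *)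
  set (d0 := Rmin rho (S' / (8 * (m * C + 1)))).
  assert (Hd0 : 0 < d0 /\ d0 <= rho /\ m * C * (2 * d0) <= S' / 4).
  { split; [|split].
    - apply Rmin_pos; [exact Hrho|apply Rdiv_lt_0_compat; lra].
    - apply Rmin_l.
    - assert (K : d0 <= S' / (8 * (m * C + 1))) by apply Rmin_r.
      assert (0 < d0) by (apply Rmin_pos; [exact Hrho|apply Rdiv_lt_0_compat; lra]).
      apply Rle_trans with ((m * C + 1) * (2 * (S' / (8 * (m * C + 1))))); [apply Rmult_le_compat; lra|].
      apply Req_le; field; lra. }
  assert (Hsolve : forall u v, exists st, Rabs u <= d0 -> Rabs v <= d0 ->
     Rabs (fst st) <= S' /\ Rabs (snd st) <= S' /\ Phi1 u v (fst st) (snd st) = 0 /\ Phi2 u v (fst st) (snd st) = 0).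
  { intros u v. destruct (classic (Rabs u <= d0 /\ Rabs v <= d0)) as [[Hu Hv]|Hn].
    2:{ exists (0, 0). tauto. }
    set (pt := fun a => - S' + 2 * S' * a).
    assert (Hpt : forall a, 0 <= a <= 1 -> Rabs (pt a) <= S').
    { intros a Ha. unfold pt. apply Rabs_le. nra. }
    assert (Hptd : forall a b, Rabs (pt a - pt b) = 2 * S' * Rabs (a - b)).
    { intros a b. unfold pt. replace (- S' + 2 * S' * a - (- S' + 2 * S' * b)) with (2 * S' * (a - b)) by ring.
      rewrite Rabs_mult, (Rabs_pos_eq (2 * S')) by lra. reflexivity. }
    assert (Hcont : cont_square (fun a b => Phi1 u v (pt a) (pt b)) /\ cont_square (fun a b => Phi2 u v (pt a) (pt b))).
    { assert (Hgen : forall a b a' b', 0 <= a <= 1 -> 0 <= b <= 1 -> 0 <= a' <= 1 -> 0 <= b' <= 1 ->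
        Rabs (Phi1 u v (pt a') (pt b') - Phi1 u v (pt a) (pt b)) <= 4 * S' * (Rabs (a' - a) + Rabs (b' - b)) /\
        Rabs (Phi2 u v (pt a') (pt b') - Phi2 u v (pt a) (pt b)) <= 4 * S' * (Rabs (a' - a) + Rabs (b' - b))).
      { intros a b a' b' Ha Hb Ha' Hb'.
        pose proof (Hpt a Ha). pose proof (Hpt b Hb). pose proof (Hpt a' Ha'). pose proof (Hpt b' Hb').
        destruct (HPst u v (pt a') (pt b') (pt a) (pt b)) as [Q1 Q2]; try lra.
        rewrite !Hptd in Q1, Q2.
        pose proof (Hptd a' a) as D1. pose proof (Hptd b' b) as D2.
        assert (0 <= S' * Rabs (a' - a)) by (apply Rmult_le_pos; [lra|apply Rabs_pos]).
        assert (0 <= S' * Rabs (b' - b)) by (apply Rmult_le_pos; [lra|apply Rabs_pos]).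
        split.
        - replace (Phi1 u v (pt a') (pt b') - Phi1 u v (pt a) (pt b)) with
            ((Phi1 u v (pt a') (pt b') - Phi1 u v (pt a) (pt b) - (pt a' - pt a)) + (pt a' - pt a)) by ring.
          eapply Rle_trans; [apply Rabs_triang|]. lra.
        - replace (Phi2 u v (pt a') (pt b') - Phi2 u v (pt a) (pt b)) with
            ((Phi2 u v (pt a') (pt b') - Phi2 u v (pt a) (pt b) - (pt b' - pt b)) + (pt b' - pt b)) by ring.
          eapply Rle_trans; [apply Rabs_triang|]. lra. }
      assert (Hfin : forall e, 0 < e -> 0 < e / (8 * S')) by (intros; apply Rdiv_lt_0_compat; lra).
      assert (Hfin2 : forall e p q, p < e / (8 * S') -> q < e / (8 * S') -> 4 * S' * (p + q) < e).
      { intros e p q Hp Hq. replace e with (4 * S' * (e / (8 * S') + e / (8 * S'))) by (field; lra).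
        apply Rmult_lt_compat_l; lra. }
      split; intros a b Ha Hb e He; exists (e / (8 * S')); (split; [apply Hfin, He|]);
      intros a' b' Ha' Hb' Da Db; destruct (Hgen a b a' b' Ha Hb Ha' Hb') as [Q1 Q2];
      (eapply Rle_lt_trans; [eassumption|apply Hfin2; assumption]). }
    assert (Hbase : Rabs (Phi1 u v 0 0) <= S' / 4 /\ Rabs (Phi2 u v 0 0) <= S' / 4).
    { destruct (HPuv u v 0 0 0 0) as [Q1 Q2]; try (rewrite Rabs_R0; lra).
      assert (Z1 : Phi1 0 0 0 0 = 0) by (unfold Phi1, cr1; rewrite H01, H02; field; exact HA).
      assert (Z2 : Phi2 0 0 0 0 = 0) by (unfold Phi2, cr2; rewrite H01, H02; field; exact HA).
      rewrite Z1, !Rminus_0_r in Q1. rewrite Z2, !Rminus_0_r in Q2.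
      assert (m * C * (Rabs u + Rabs v) <= m * C * (2 * d0)) by (apply Rmult_le_compat_l; lra). lra. }
    assert (Hside : forall s t, Rabs s <= S' -> Rabs t <= S' ->
       Rabs (Phi1 u v s t - s) <= 3 / 4 * S' /\ Rabs (Phi2 u v s t - t) <= 3 / 4 * S').
    { intros s t Hs Ht. destruct (HPst u v s t 0 0) as [Q1 Q2]; try lra; try (rewrite Rabs_R0; lra).
      rewrite !Rminus_0_r in Q1, Q2. destruct Hbase as [B1 B2].
      apply Rabs_le_between in Q1. apply Rabs_le_between in Q2.
      apply Rabs_le_between in B1. apply Rabs_le_between in B2.
      split; apply Rabs_le; lra. }
    destruct (poincare_miranda (fun a b => Phi1 u v (pt a) (pt b)) (fun a b => Phi2 u v (pt a) (pt b)))
      as [a [b [Ha [Hb [Z1 Z2]]]]]; [apply Hcont|apply Hcont| | | | |].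
    - intros y Hy. destruct (Hside (pt 0) (pt y) (Hpt 0 ltac:(lra)) (Hpt y Hy)) as [Q _].
      apply Rabs_le_between in Q. unfold pt in *. lra.
    - intros y Hy. destruct (Hside (pt 1) (pt y) (Hpt 1 ltac:(lra)) (Hpt y Hy)) as [Q _].
      apply Rabs_le_between in Q. unfold pt in *. lra.
    - intros y Hy. destruct (Hside (pt y) (pt 0) (Hpt y Hy) (Hpt 0 ltac:(lra))) as [_ Q].
      apply Rabs_le_between in Q. unfold pt in *. lra.
    - intros y Hy. destruct (Hside (pt y) (pt 1) (Hpt y Hy) (Hpt 1 ltac:(lra))) as [_ Q].
      apply Rabs_le_between in Q. unfold pt in *. lra.
    - exists (pt a, pt b). intros _ _. simpl. auto. }
  destruct (functional_choice (fun p st => Rabs (fst p) <= d0 -> Rabs (snd p) <= d0 ->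
     Rabs (fst st) <= S' /\ Rabs (snd st) <= S' /\ Phi1 (fst p) (snd p) (fst st) (snd st) = 0
     /\ Phi2 (fst p) (snd p) (fst st) (snd st) = 0) (fun p => Hsolve (fst p) (snd p))) as [st Hst].
  (* Adding the bounds for [s] and [t], half of [|s - s'| + |t - t'|] is at most [2 * m * C] times
     the parameter distance. *)
  exists d0, (4 * (m * C)), (fun u v => fst (st (u, v))), (fun u v => snd (st (u, v))).
  split; [lra|]. split; [lra|]. split.
  - intros u v Hu Hv. destruct (Hst (u, v) Hu Hv) as [B1 [B2 [Z1 Z2]]].
    split; [lra|]. split; [lra|]. apply Hzero; assumption.
  - intros u v u' v' Hu Hv Hu' Hv'.
    destruct (Hst (u, v) Hu Hv) as [B1 [B2 [Z1 Z2]]]. destruct (Hst (u', v') Hu' Hv') as [B1' [B2' [Z1' Z2']]].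
    simpl in *. set (s := fst (st (u, v))) in *. set (t := snd (st (u, v))) in *.
    set (s' := fst (st (u', v'))) in *. set (t' := snd (st (u', v'))) in *.
    destruct (HPst u v s t s' t') as [Q1 Q2]; try lra.
    destruct (HPuv u v u' v' s' t') as [Q3 Q4]; try lra.
    rewrite Z1 in Q1. rewrite Z2 in Q2. rewrite Z1', Rminus_0_r in Q3. rewrite Z2', Rminus_0_r in Q4.
    assert (K1 : Rabs (s - s') <= 1 / 4 * (Rabs (s - s') + Rabs (t - t')) + m * C * (Rabs (u - u') + Rabs (v - v'))).
    { apply Rabs_le_between in Q1. apply Rabs_le_between in Q3. apply Rabs_le. lra. }
    assert (K2 : Rabs (t - t') <= 1 / 4 * (Rabs (s - s') + Rabs (t - t')) + m * C * (Rabs (u - u') + Rabs (v - v'))).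
    { apply Rabs_le_between in Q2. apply Rabs_le_between in Q4. apply Rabs_le. lra. }
    pose proof (Rabs_pos (s - s')). pose proof (Rabs_pos (t - t')). lra.
Qed.

(** * Time reversal *)

(* The change of variables [(t, y, z) -> (-t, -y, -z)] turns the system for [(f, g)] into
   the one for [(hatf f, hatg g)] and exchanges the attracting and the repelling branch. *)
Definition hatf (F : R -> R -> R -> R) (x y z : R) : R := - F x (- y) (- z).
Definition hatg (G : R -> R -> R -> R) (x y z : R) : R := G x (- y) (- z).

Lemma lip3_mono F L L' : L <= L' -> lip3 F L -> lip3 F L'.
Proof.
  intros HL HF x y z x' y' z'. eapply Rle_trans; [apply HF|].
  apply Rmult_le_compat_r; [|exact HL].
  pose proof (Rabs_pos (x - x')). pose proof (Rabs_pos (y - y')). pose proof (Rabs_pos (z - z')). lra.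
Qed.

Lemma hatg_lip G L : lip3 G L -> lip3 (hatg G) L.
Proof.
  intros HG x y z x' y' z'. unfold hatg. eapply Rle_trans; [apply HG|].
  replace (- y - - y') with (- (y - y')) by ring. replace (- z - - z') with (- (z - z')) by ring.
  rewrite !Rabs_Ropp. lra.
Qed.

Lemma hatf_lip F L : lip3 F L -> lip3 (hatf F) L.
Proof.
  intros HF x y z x' y' z'. unfold hatf.
  replace (- F x (- y) (- z) - - F x' (- y') (- z')) with (- (hatg F x y z - hatg F x' y' z')) by (unfold hatg; ring).
  rewrite Rabs_Ropp. apply hatg_lip, HF.
Qed.

Lemma fast_lip eps : 0 < eps -> lip3 (fast eps) (/ eps).
Proof.
  intros He x y z x' y' z'. unfold fast.
  replace ((x + Rabs z) / eps - (x' + Rabs z') / eps) with (/ eps * ((x - x') + (Rabs z - Rabs z'))) by (field; lra).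
  assert (0 < / eps) by (apply Rinv_0_lt_compat, He).
  rewrite Rabs_mult, (Rabs_pos_eq (/ eps)) by lra. apply Rmult_le_compat_l; [lra|].
  eapply Rle_trans; [apply Rabs_triang|]. pose proof (Rabs_triang_inv2 z z'). pose proof (Rabs_pos (y - y')). lra.
Qed.

Lemma is_derive_reverse (w : R -> R) t l : is_derive w (- t) l -> is_derive (fun t => w (- t)) t (- l).
Proof.
  intro H. replace (- l) with (scal (-1) l) by (unfold scal; simpl; unfold mult; simpl; ring).
  apply (is_derive_comp w (fun s => - s)); [exact H|]. auto_derive; [exact I|ring].
Qed.

Lemma is_derive_reverse_opp (w : R -> R) t l : is_derive w (- t) l -> is_derive (fun t => - w (- t)) t l.
Proof.
  intro H. replace l with (opp (- l)) by (unfold opp; simpl; ring).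
  apply (is_derive_opp (V := R_NormedModule)), is_derive_reverse, H.
Qed.

Lemma sol3_reverse k F G eps x y z : 0 <= k -> sol3 (clipf k F) (clipf k G) (fast eps) x y z ->
  sol3 (clipf k (hatf F)) (clipf k (hatg G)) (fast eps)
    (fun t => x (- t)) (fun t => - y (- t)) (fun t => - z (- t)).
Proof.
  intros Hk HS t. destruct (HS (- t)) as [D1 [D2 D3]].
  assert (Hr : 0 <= Rabs (x (- t)) + k) by (pose proof (Rabs_pos (x (- t))); lra).
  unfold clipf, hatf, hatg, fast. rewrite clip_opp, !Ropp_involutive, Rabs_Ropp by exact Hr.
  split; [apply is_derive_reverse, D1|]. split; apply is_derive_reverse_opp; assumption.
Qed.

Lemma is_derive_shift (w : R -> R) t0 t l : is_derive w (t - t0) l -> is_derive (fun t => w (t - t0)) t l.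
Proof.
  intro H. replace l with (scal 1 l) by (unfold scal; simpl; unfold mult; simpl; ring).
  apply (is_derive_comp w (fun s => s - t0)); [exact H|]. auto_derive; [exact I|ring].
Qed.

Lemma sol3_shift F1 F2 F3 x y z t0 : sol3 F1 F2 F3 x y z ->
  sol3 F1 F2 F3 (fun t => x (t - t0)) (fun t => y (t - t0)) (fun t => z (t - t0)).
Proof.
  intros HS t. destruct (HS (t - t0)) as [D1 [D2 D3]].
  split; [apply is_derive_shift, D1|]. split; apply is_derive_shift; assumption.
Qed.

(** * Planar trajectories parametrized by their point on y = 0 *)

Lemma planar_exists f g L u : 0 < L -> lip3 f L -> lip3 g L ->
  exists XY : (R -> R) * (R -> R), planar f g (fst XY) (snd XY) /\ fst XY 0 = u /\ snd XY 0 = 0.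
Proof.
  intros HL Hf Hg.
  destruct (global_solution _ _ _ (2 * L) 0 u 0 0 ltac:(lra) (diagonal_lip f L Hf) (diagonal_lip g L Hg) (zero_lip (2 * L) ltac:(lra))) as [X [Y [Z [HS [H1 [H2 _]]]]]].
  exists (X, Y). split; [|split; assumption]. intro t. destruct (HS t) as [D1 [D2 _]]. split; assumption.
Qed.

Lemma planar_unique f g L X Y X' Y' : 0 < L -> lip3 f L -> lip3 g L ->
  planar f g X Y -> planar f g X' Y' -> X 0 = X' 0 -> Y 0 = 0 -> Y' 0 = 0 ->
  forall t, X t = X' t /\ Y t = Y' t.
Proof.
  intros HL Hf Hg HP HP' H0 HY HY' t.
  destruct (planar_dist f g L X Y X' Y' HL Hf Hg HP HP' HY HY' t) as [K1 K2].
  rewrite H0, Rminus_diag, Rabs_R0, Rmult_0_l in K1, K2.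
  apply Rabs_le_between in K1. apply Rabs_le_between in K2. lra.
Qed.

Section Family.
Variables (f g : R -> R -> R -> R) (L M c : R) (X Y : R -> R -> R).
Hypothesis HL : 0 < L.
Hypothesis HM : 0 < M.
Hypothesis Hfb : forall x y z, Rabs (f x y z) <= M.
Hypothesis Hgb : forall x y z, Rabs (g x y z) <= M.
Hypothesis Hf : lip3 f L.
Hypothesis Hg : lip3 g L.
Hypothesis HP : forall u, planar f g (X u) (Y u).
Hypothesis HX0 : forall u, X u 0 = u.
Hypothesis HY0 : forall u, Y u 0 = 0.

Lemma family_lipschitz u u' s : Rabs s <= 1 ->
  Rabs (X u (c + s) - X u' (c + s)) <= exp (12 * L * (Rabs c + 1)) * Rabs (u - u') /\
  Rabs (Y u (c + s) - Y u' (c + s)) <= exp (12 * L * (Rabs c + 1)) * Rabs (u - u').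
Proof.
  intro Hs. destruct (planar_dist f g L _ _ _ _ HL Hf Hg (HP u) (HP u') (HY0 u) (HY0 u') (c + s)) as [K1 K2].
  rewrite !HX0 in K1, K2. rewrite Rmult_comm in K1, K2.
  assert (exp (12 * L * Rabs (c + s)) * Rabs (u - u') <= exp (12 * L * (Rabs c + 1)) * Rabs (u - u')).
  { apply Rmult_le_compat_r; [apply Rabs_pos|]. apply exp_mono, Rmult_le_compat_l; [lra|].
    eapply Rle_trans; [apply Rabs_triang|]. lra. }
  lra.
Qed.

Lemma mean_value_near (w dw : R -> R) l nu rho : (forall t, is_derive w t (dw t)) ->
  (forall t, Rabs t <= rho -> Rabs (dw t - l) <= nu) ->
  forall s s', Rabs s <= rho -> Rabs s' <= rho -> Rabs (w s - w s' - l * (s - s')) <= nu * Rabs (s - s').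
Proof.
  intros Hd Hn.
  assert (H : forall s s', s' <= s -> Rabs s <= rho -> Rabs s' <= rho -> Rabs (w s - w s' - l * (s - s')) <= nu * Rabs (s - s')).
  { intros s s' Hss Hs Hs'. destruct (mean_value w dw s' s Hss (fun t _ => Hd t)) as [m [Hm ->]].
    replace (dw m * (s - s') - l * (s - s')) with ((dw m - l) * (s - s')) by ring.
    rewrite Rabs_mult. apply Rmult_le_compat_r; [apply Rabs_pos|]. apply Hn.
    apply Rabs_le_between in Hs. apply Rabs_le_between in Hs'. apply Rabs_le. lra. }
  intros s s' Hs Hs'. destruct (Rle_lt_dec s' s) as [C|C]; [apply H; assumption|].
  replace (w s - w s' - l * (s - s')) with (- (w s' - w s - l * (s' - s))) by ring.
  rewrite Rabs_Ropp, (Rabs_minus_sym s s'). apply H; [lra|assumption|assumption].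
Qed.

(** The velocity is a Lipschitz field evaluated at a point that moves little with [u] and [s], so it
    stays within [nu] of its value on the trajectory [u = 0] at time [c]. This supplies the
    differentiability hypothesis of [transversal_crossing]. *)
Lemma family_near_linear nu : 0 < nu -> exists rho, 0 < rho /\
  forall u s s', Rabs u <= rho -> Rabs s <= rho -> Rabs s' <= rho ->
  Rabs (X u (c + s) - X u (c + s') - f (X 0 c) (Y 0 c) (X 0 c) * (s - s')) <= nu * Rabs (s - s') /\
  Rabs (Y u (c + s) - Y u (c + s') - g (X 0 c) (Y 0 c) (X 0 c) * (s - s')) <= nu * Rabs (s - s').
Proof.
  intro Hnu. set (CG := exp (12 * L * (Rabs c + 1))).
  assert (HCG : 0 < CG) by apply exp_pos.
  assert (Hden : 0 < 3 * L * (CG + M)) by (apply Rmult_lt_0_compat; lra).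
  set (rho := Rmin 1 (nu / (3 * L * (CG + M)))).
  assert (Hrho : 0 < rho) by (apply Rmin_pos; [lra|apply Rdiv_lt_0_compat; assumption]).
  assert (Hrho1 : rho <= 1) by apply Rmin_l.
  assert (Hrho2 : L * (3 * ((CG + M) * rho)) <= nu).
  { apply Rle_trans with (L * (3 * ((CG + M) * (nu / (3 * L * (CG + M)))))).
    - apply Rmult_le_compat_l; [lra|]. apply Rmult_le_compat_l; [lra|]. apply Rmult_le_compat_l; [lra|apply Rmin_r].
    - apply Req_le. field. lra. }
  exists rho. split; [exact Hrho|]. intros u s s' Hu Hs Hs'.
  assert (Hpt : forall t, Rabs t <= rho -> Rabs (X u (c + t) - X 0 c) <= (CG + M) * rho /\ Rabs (Y u (c + t) - Y 0 c) <= (CG + M) * rho).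
  { intros t Ht. destruct (family_lipschitz u 0 t ltac:(lra)) as [K1 K2]. fold CG in K1, K2. rewrite !Rminus_0_r in K1, K2.
    pose proof (mean_value_abs (X 0) (fun t => f (X 0 t) (Y 0 t) (X 0 t)) M (fun t => proj1 (HP 0 t)) (fun t => Hfb _ _ _) c (c + t)) as K3.
    pose proof (mean_value_abs (Y 0) (fun t => g (X 0 t) (Y 0 t) (X 0 t)) M (fun t => proj2 (HP 0 t)) (fun t => Hgb _ _ _) c (c + t)) as K4.
    replace (c + t - c) with t in K3, K4 by ring.
    assert (CG * Rabs u <= CG * rho) by (apply Rmult_le_compat_l; lra).
    assert (M * Rabs t <= M * rho) by (apply Rmult_le_compat_l; lra).
    apply Rabs_le_between in K1. apply Rabs_le_between in K2. apply Rabs_le_between in K3. apply Rabs_le_between in K4.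
    split; apply Rabs_le; lra. }
  assert (Hfield : forall F, lip3 F L -> forall t, Rabs t <= rho ->
    Rabs (F (X u (c + t)) (Y u (c + t)) (X u (c + t)) - F (X 0 c) (Y 0 c) (X 0 c)) <= nu).
  { intros F HF t Ht. destruct (Hpt t Ht) as [K1 K2]. eapply Rle_trans; [apply HF|]. eapply Rle_trans; [|exact Hrho2].
    apply Rmult_le_compat_l; lra. }
  assert (Hsh : forall (w : R -> R) t l, is_derive w (c + t) l -> is_derive (fun t => w (c + t)) t l).
  { intros w t l H. replace l with (scal 1 l) by (unfold scal; simpl; unfold mult; simpl; ring).
    apply (is_derive_comp w (fun s => c + s)); [exact H|]. auto_derive; [exact I|ring]. }
  split.
  - apply (mean_value_near (fun t => X u (c + t)) (fun t => f (X u (c + t)) (Y u (c + t)) (X u (c + t))) _ nu rho); auto.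
    intro t. apply Hsh, HP.
  - apply (mean_value_near (fun t => Y u (c + t)) (fun t => g (X u (c + t)) (Y u (c + t)) (X u (c + t))) _ nu rho); auto.
    intro t. apply Hsh, HP.
Qed.

End Family.

(** * Continuity of the hit point in the parameters *)

Definition in_box (d u v : R) : Prop := Rabs u <= d /\ Rabs v <= d.

Definition cont_box (d : R) (Fn : R -> R -> R) : Prop :=
  forall u v, in_box d u v -> forall e, 0 < e -> exists del, 0 < del /\
  forall u' v', in_box d u' v' -> Rabs (u' - u) < del -> Rabs (v' - v) < del -> Rabs (Fn u' v' - Fn u v) < e.

(** Solutions start at time [0] here and are shifted by [t0]. [w] selects the parameter governing
    the hit, [u] for the forward and [v] for the backward flow. *)
Lemma hit_continuous F1 F2 F3 K0 Kp h H d g0 (w t0 px py : R -> R -> R) (x y z : R -> R -> R -> R) :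
  0 < K0 -> 0 < Kp -> 0 < g0 -> lip3 F1 K0 -> lip3 F2 K0 -> lip3 F3 K0 ->
  (forall u v, sol3 F1 F2 F3 (x u v) (y u v) (z u v)) ->
  (forall u v, x u v 0 = px u v /\ y u v 0 = py u v /\ z u v 0 = 0) ->
  (forall u v u' v', in_box d u v -> in_box d u' v' ->
    Rabs (px u' v' - px u v) <= Kp * (Rabs (u' - u) + Rabs (v' - v)) /\
    Rabs (py u' v' - py u v) <= Kp * (Rabs (u' - u) + Rabs (v' - v)) /\
    Rabs (t0 u' v' - t0 u v) <= Kp * (Rabs (u' - u) + Rabs (v' - v))) ->
  (forall u v, in_box d u v -> exists ta, side_hit h H d (w u v) g0 (t0 u v) ta
     (fun t => x u v (t - t0 u v)) (fun t => y u v (t - t0 u v)) (fun t => z u v (t - t0 u v))) ->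
  exists ta : R -> R -> R,
  (forall u v, in_box d u v -> side_hit h H d (w u v) g0 (t0 u v) (ta u v)
     (fun t => x u v (t - t0 u v)) (fun t => y u v (t - t0 u v)) (fun t => z u v (t - t0 u v))) /\
  cont_box d (fun u v => x u v (ta u v - t0 u v)) /\
  cont_box d (fun u v => z u v (ta u v - t0 u v)).
Proof.
  intros HK0 HKp Hg0 L1 L2 L3 HS Hinit HLip Hex.
  destruct (functional_choice (fun p ta => in_box d (fst p) (snd p) -> side_hit h H d (w (fst p) (snd p)) g0 (t0 (fst p) (snd p)) ta
     (fun t => x (fst p) (snd p) (t - t0 (fst p) (snd p))) (fun t => y (fst p) (snd p) (t - t0 (fst p) (snd p)))
     (fun t => z (fst p) (snd p) (t - t0 (fst p) (snd p))))) as [ta0 Hta0].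
  { intros [u v]. simpl. destruct (classic (in_box d u v)) as [C|C].
    - destruct (Hex u v C) as [ta Hta]. exists ta. intros _. exact Hta.
    - exists 0. intro. contradiction. }
  set (ta := fun u v => ta0 (u, v)).
  assert (Hta : forall u v, in_box d u v -> side_hit h H d (w u v) g0 (t0 u v) (ta u v)
     (fun t => x u v (t - t0 u v)) (fun t => y u v (t - t0 u v)) (fun t => z u v (t - t0 u v))).
  { intros u v C. exact (Hta0 (u, v) C). }
  exists ta. split; [exact Hta|].
  assert (Hmain : forall u v, in_box d u v -> forall e, 0 < e -> exists del, 0 < del /\
     forall u' v', in_box d u' v' -> Rabs (u' - u) < del -> Rabs (v' - v) < del ->
     Rabs (x u' v' (ta u' v' - t0 u' v') - x u v (ta u v - t0 u v)) < e /\
     Rabs (z u' v' (ta u' v' - t0 u' v') - z u v (ta u v - t0 u v)) < e).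
  { intros u v Huv e He.
    destruct (Hta u v Huv) as [Hw [Hyz _]].
    set (r := ta u v - t0 u v) in *.
    destruct (HS u v r) as [Dx [_ Dz]].
    destruct (is_derive_cont _ _ _ Dx (e / 2) ltac:(lra)) as [ex [Hex' Cx]].
    destruct (is_derive_cont _ _ _ Dz (e / 2) ltac:(lra)) as [ez [Hez' Cz]].
    set (Q := 2 * Kp * exp (6 * K0 * (Rabs r + 1))).
    assert (HQ : 0 < Q) by (apply Rmult_lt_0_compat; [lra|apply exp_pos]).
    assert (Hclose : forall u' v' r', in_box d u' v' -> Rabs r' <= Rabs r + 1 ->
       Rabs (x u' v' r' - x u v r') <= Q * (Rabs (u' - u) + Rabs (v' - v)) /\
       Rabs (y u' v' r' - y u v r') <= Q * (Rabs (u' - u) + Rabs (v' - v)) /\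
       Rabs (z u' v' r' - z u v r') <= Q * (Rabs (u' - u) + Rabs (v' - v))).
    { intros u' v' r' Huv' Hr'.
      pose proof (solutions_dist F1 F2 F3 K0 _ _ _ _ _ _ HK0 L1 L2 L3 (HS u' v') (HS u v) 0 r') as E.
      unfold sqdist in E. destruct (Hinit u v) as [I1 [I2 I3]]. destruct (Hinit u' v') as [J1 [J2 J3]].
      rewrite I1, I2, I3, J1, J2, J3 in E.
      destruct (HLip u v u' v' Huv Huv') as [P1 [P2 _]].
      set (Dl := Rabs (u' - u) + Rabs (v' - v)) in *.
      assert (HDl : 0 <= Dl) by (unfold Dl; pose proof (Rabs_pos (u' - u)); pose proof (Rabs_pos (v' - v)); lra).
      assert (HKD : 0 <= Kp * Dl) by (apply Rmult_le_pos; lra).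
      assert (S1 : (px u' v' - px u v) ^ 2 <= (Kp * Dl) ^ 2) by (apply pow_maj_Rabs; exact P1).
      assert (S2 : (py u' v' - py u v) ^ 2 <= (Kp * Dl) ^ 2) by (apply pow_maj_Rabs; exact P2).
      assert (Ee : exp (12 * K0 * Rabs (r' - 0)) <= exp (6 * K0 * (Rabs r + 1)) ^ 2).
      { simpl. rewrite Rmult_1_r, <- exp_plus. apply exp_mono. rewrite Rminus_0_r.
        assert (K0 * Rabs r' <= K0 * (Rabs r + 1)) by (apply Rmult_le_compat_l; lra). lra. }
      assert (Hsq : (Q * Dl) ^ 2 = 4 * (Kp * Dl) ^ 2 * exp (6 * K0 * (Rabs r + 1)) ^ 2) by (unfold Q; ring).
      pose proof (exp_pos (12 * K0 * Rabs (r' - 0))) as Ep.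
      assert (T : ((px u' v' - px u v) ^ 2 + (py u' v' - py u v) ^ 2 + (0 - 0) ^ 2) * exp (12 * K0 * Rabs (r' - 0)) <= (Q * Dl) ^ 2).
      { rewrite Hsq. pose proof (pow2_ge_0 (px u' v' - px u v)). pose proof (pow2_ge_0 (py u' v' - py u v)).
        apply Rmult_le_compat; [|lra| |exact Ee]; rewrite Rminus_diag; simpl in *; lra. }
      pose proof (pow2_ge_0 (x u' v' r' - x u v r')). pose proof (pow2_ge_0 (y u' v' r' - y u v r')).
      pose proof (pow2_ge_0 (z u' v' r' - z u v r')).
      assert (HQD : 0 <= Q * Dl) by (apply Rmult_le_pos; lra).
      split; [|split]; (apply sq_le_abs; [exact HQD|]); lra. }
    set (gap := Rmin (ta u v + h) (H - ta u v)).
    assert (Hgap : 0 < gap) by (apply Rmin_pos; lra).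
    set (m := Rmin 1 (Rmin ex ez)).
    assert (Hm : 0 < m /\ m <= 1 /\ m <= ex /\ m <= ez).
    { unfold m. pose proof (Rmin_l 1 (Rmin ex ez)). pose proof (Rmin_r 1 (Rmin ex ez)).
      pose proof (Rmin_l ex ez). pose proof (Rmin_r ex ez). split; [repeat apply Rmin_pos; lra|lra]. }
    assert (Hsm : forall A b, 0 < A -> 0 < b -> exists del, 0 < del /\ forall p q, p < del -> q < del -> A * (p + q) < b).
    { intros A b HA Hb. exists (b / (2 * A)). split; [apply Rdiv_lt_0_compat; lra|].
      intros p q Hp Hq. replace b with (A * (b / (2 * A) + b / (2 * A))) at 1 by (field; lra).
      apply Rmult_lt_compat_l; lra. }
    destruct (Hsm Kp gap HKp Hgap) as [d1 [Hd1 Hs1]].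
    destruct (Hsm Q (g0 / 2 * m) HQ ltac:(apply Rmult_lt_0_compat; lra)) as [d2 [Hd2 Hs2]].
    destruct (Hsm Q (e / 2) HQ ltac:(lra)) as [d3 [Hd3 Hs3]].
    exists (Rmin d1 (Rmin d2 d3)). split; [repeat apply Rmin_pos; assumption|].
    intros u' v' Huv' Hu' Hv'.
    apply Rmin_Rgt in Hu'. destruct Hu' as [Hu1 Hu']. apply Rmin_Rgt in Hu'. destruct Hu' as [Hu2 Hu3].
    apply Rmin_Rgt in Hv'. destruct Hv' as [Hv1 Hv']. apply Rmin_Rgt in Hv'. destruct Hv' as [Hv2 Hv3].
    specialize (Hs1 _ _ Hu1 Hv1). specialize (Hs2 _ _ Hu2 Hv2). specialize (Hs3 _ _ Hu3 Hv3).
    destruct (Hta u' v' Huv') as [Hw' [_ [Hslope _]]].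
    set (r' := ta u' v' - t0 u' v') in *.
    (* At the old elapsed time [r] the new [y] is small by continuous dependence; the slope
       inequality of [side_hit], available as [r + t0 u' v'] still lies in the window, bounds
       [|r' - r|] by it. *)
    assert (Hrr : Rabs (r' - r) < m).
    { destruct (HLip u v u' v' Huv Huv') as [_ [_ P3]].
      assert (Hin : - h <= r + t0 u' v' <= H).
      { assert (Hlt : Rabs (t0 u' v' - t0 u v) < gap) by lra. apply Rabs_def2 in Hlt.
        pose proof (Rmin_l (ta u v + h) (H - ta u v)). pose proof (Rmin_r (ta u v + h) (H - ta u v)).
        fold gap in H0, H1. unfold r. lra. }
      specialize (Hslope _ Hin). simpl in Hslope.
      replace (r + t0 u' v' - t0 u' v') with r in Hslope by ring.
      replace (r + t0 u' v' - ta u' v') with (- (r' - r)) in Hslope by (unfold r'; ring).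
      rewrite Rabs_Ropp in Hslope.
      destruct (Hclose u' v' r Huv' ltac:(lra)) as [_ [K _]]. rewrite Hyz, Rminus_0_r in K.
      apply Rmult_lt_reg_l with (g0 / 2); lra. }
    assert (Hr'b : Rabs r' <= Rabs r + 1).
    { replace r' with (r + (r' - r)) by ring. eapply Rle_trans; [apply Rabs_triang|]. lra. }
    destruct (Hclose u' v' r' Huv' Hr'b) as [K1 [_ K3]].
    specialize (Cx r' ltac:(lra)). specialize (Cz r' ltac:(lra)).
    split.
    - replace (x u' v' r' - x u v r) with ((x u' v' r' - x u v r') + (x u v r' - x u v r)) by ring.
      eapply Rle_lt_trans; [apply Rabs_triang|]. lra.
    - replace (z u' v' r' - z u v r) with ((z u' v' r' - z u v r') + (z u v r' - z u v r)) by ring.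
      eapply Rle_lt_trans; [apply Rabs_triang|]. lra. }
  split; intros u v Huv e He; destruct (Hmain u v Huv e He) as [del [Hdel Hd]]; exists del;
    (split; [exact Hdel|]); intros u' v' Huv' D1 D2; destruct (Hd u' v' Huv' D1 D2); assumption.
Qed.

(** If [x + z > k] with [z > 0], then [z] rises faster than [k / eps > M], which [x] cannot
    compensate, so the inequality persists. Over one period [z] would gain at least [M * T]. *)
Lemma periodic_no_explosion F G M eps k x y z T :
  0 < eps -> 0 < M -> eps * M < k -> 0 < T -> (forall x y z, Rabs (F x y z) <= M) ->
  sol3 F G (fast eps) x y z -> (forall t, z (t + T) = z t) ->
  forall t, 0 < z t -> x t + z t <= k.
Proof.
  intros He HM Hk HT HFM HS Hper t0 Hz. apply Rnot_lt_le. intro Hgt.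
  assert (HMk : M < k / eps) by (apply Rlt_div_r; lra).
  assert (K : z t0 + M * (t0 + T - t0) - z (t0 + T) <= 0).
  { apply (barrier_nonpos (fun t => z t0 + M * (t - t0) - z t) (fun t => M - fast eps (x t) (y t) (z t)) t0 (t0 + T)).
    - intros t _. apply (is_derive_minus (V := R_NormedModule)); [|apply HS].
      auto_derive; [exact I|ring].
    - lra.
    - intros t Ht Hw _.
      assert (0 <= M * (t - t0)) by (apply Rmult_le_pos; lra).
      pose proof (mean_value_abs x _ M (fun s => proj1 (HS s)) (fun s => HFM _ _ _) t0 t) as Kx.
      rewrite (Rabs_pos_eq (t - t0)) in Kx by lra. apply Rabs_le_between in Kx.
      unfold fast. rewrite Rabs_pos_eq by lra.
      assert (k / eps < (x t + z t) / eps); [|lra].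
      apply Rmult_lt_compat_r; [apply Rinv_0_lt_compat, He|]. lra.
    - lra. }
  rewrite Hper in K. replace (t0 + T - t0) with T in K by ring.
  assert (0 < M * T) by (apply Rmult_lt_0_compat; assumption). lra.
Qed.

(** * Matching the forward and the backward flow *)

(* [corner_path d b m] is a coordinate of the point at parameter [b] on a segment from the
   corner [(-d, -d)] of the square; taking [m = Rmin 1 (2 - 2 a)] and [m = Rmin 1 (2 a)]
   for the two coordinates, its other end runs over the two sides opposite to that corner. *)
Definition corner_path (d b m : R) : R := - d + 2 * d * (b * m).

Lemma corner_path_box d b m : 0 < d -> 0 <= b <= 1 -> 0 <= m <= 1 -> Rabs (corner_path d b m) <= d.
Proof.
  intros Hd Hb Hm. unfold corner_path. assert (0 <= b * m <= 1) by nra. apply Rabs_le. nra.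
Qed.

Lemma corner_path_lip d b m b' m' : 0 < d -> 0 <= b <= 1 -> 0 <= m' <= 1 ->
  Rabs (corner_path d b' m' - corner_path d b m) <= 2 * d * (Rabs (b' - b) + Rabs (m' - m)).
Proof.
  intros Hd Hb Hm'. unfold corner_path.
  replace (- d + 2 * d * (b' * m') - (- d + 2 * d * (b * m))) with (2 * d * ((b' - b) * m' + b * (m' - m))) by ring.
  rewrite Rabs_mult, (Rabs_pos_eq (2 * d)) by lra. apply Rmult_le_compat_l; [lra|].
  eapply Rle_trans; [apply Rabs_triang|]. rewrite !Rabs_mult, (Rabs_pos_eq m'), (Rabs_pos_eq b) by lra.
  pose proof (Rabs_pos (b' - b)). pose proof (Rabs_pos (m' - m)). nra.
Qed.

Lemma Rmin_1_bounds p q : 0 <= p -> 0 <= q ->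
  0 <= Rmin 1 p <= 1 /\ Rabs (Rmin 1 q - Rmin 1 p) <= Rabs (q - p).
Proof.
  intros Hp Hq. unfold Rmin, Rabs. repeat (destruct Rle_dec || destruct Rcase_abs); lra.
Qed.

Lemma cont_square_comp d Fn : 0 < d -> cont_box d Fn ->
  cont_square (fun b a => Fn (corner_path d b (Rmin 1 (2 - 2 * a))) (corner_path d b (Rmin 1 (2 * a)))).
Proof.
  intros Hd HF b a Hb Ha e He.
  destruct (Rmin_1_bounds (2 - 2 * a) (2 - 2 * a) ltac:(lra) ltac:(lra)) as [M1 _].
  destruct (Rmin_1_bounds (2 * a) (2 * a) ltac:(lra) ltac:(lra)) as [M2 _].
  destruct (HF (corner_path d b (Rmin 1 (2 - 2 * a))) (corner_path d b (Rmin 1 (2 * a)))) with (e := e) as [del [Hdel Hc]];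
    [split; apply corner_path_box; assumption|exact He|].
  exists (del / (6 * d)). split; [apply Rdiv_lt_0_compat; lra|].
  intros b' a' Hb' Ha' Db Da.
  destruct (Rmin_1_bounds (2 - 2 * a) (2 - 2 * a') ltac:(lra) ltac:(lra)) as [_ N1].
  destruct (Rmin_1_bounds (2 * a) (2 * a') ltac:(lra) ltac:(lra)) as [_ N2].
  destruct (Rmin_1_bounds (2 - 2 * a') (2 - 2 * a') ltac:(lra) ltac:(lra)) as [M1' _].
  destruct (Rmin_1_bounds (2 * a') (2 * a') ltac:(lra) ltac:(lra)) as [M2' _].
  replace (2 - 2 * a' - (2 - 2 * a)) with (- (2 * (a' - a))) in N1 by ring.
  replace (2 * a' - 2 * a) with (2 * (a' - a)) in N2 by ring.
  rewrite Rabs_Ropp in N1. rewrite Rabs_mult, (Rabs_pos_eq 2) in N1, N2 by lra.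
  assert (Hlt : forall N, N <= 2 * Rabs (a' - a) -> 2 * d * (Rabs (b' - b) + N) < del).
  { intros N HN. replace del with (2 * d * (del / (6 * d) + 2 * (del / (6 * d)))) by (field; lra).
    apply Rmult_lt_compat_l; lra. }
  apply Hc.
  - split; apply corner_path_box; assumption.
  - eapply Rle_lt_trans; [apply corner_path_lip; assumption|apply Hlt, N1].
  - eapply Rle_lt_trans; [apply corner_path_lip; assumption|apply Hlt, N2].
Qed.

Lemma cont_square_plus P Q : cont_square P -> cont_square Q -> cont_square (fun b a => P b a + Q b a).
Proof.
  intros HP HQ b a Hb Ha e He.
  destruct (HP b a Hb Ha (e / 2) ltac:(lra)) as [d1 [Hd1 H1]].
  destruct (HQ b a Hb Ha (e / 2) ltac:(lra)) as [d2 [Hd2 H2]].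
  exists (Rmin d1 d2). split; [apply Rmin_pos; assumption|].
  intros b' a' Hb' Ha' Db Da. apply Rmin_Rgt in Db. apply Rmin_Rgt in Da.
  specialize (H1 b' a' Hb' Ha' ltac:(lra) ltac:(lra)). specialize (H2 b' a' Hb' Ha' ltac:(lra) ltac:(lra)).
  replace (P b' a' + Q b' a' - (P b a + Q b a)) with ((P b' a' - P b a) + (Q b' a' - Q b a)) by ring.
  eapply Rle_lt_trans; [apply Rabs_triang|]. lra.
Qed.

Lemma cont_square_opp P : cont_square P -> cont_square (fun b a => - P b a).
Proof.
  intros HP b a Hb Ha e He. destruct (HP b a Hb Ha e He) as [d1 [Hd1 H1]].
  exists d1. split; [exact Hd1|]. intros b' a' Hb' Ha' Db Da.
  replace (- P b' a' - - P b a) with (- (P b' a' - P b a)) by ring. rewrite Rabs_Ropp. apply H1; assumption.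
Qed.

Lemma cont_square_negpart P : cont_square P ->
  cont_square (fun b a => Rmax 0 (- P b a) * (2 * a - 1)).
Proof.
  intros HP b a Hb Ha e He. destruct (HP b a Hb Ha (e / 2) ltac:(lra)) as [d1 [Hd1 H1]].
  set (N := Rmax 0 (- P b a)).
  assert (HN : 0 <= N) by apply Rmax_l.
  set (d2 := e / (4 * (N + 1))).
  assert (Hd2 : 0 < d2) by (apply Rdiv_lt_0_compat; lra).
  exists (Rmin d1 d2). split; [apply Rmin_pos; assumption|].
  intros b' a' Hb' Ha' Db Da. apply Rmin_Rgt in Db. apply Rmin_Rgt in Da.
  specialize (H1 b' a' Hb' Ha' ltac:(lra) ltac:(lra)).
  set (N' := Rmax 0 (- P b' a')).
  assert (HNN : Rabs (N' - N) < e / 2).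
  { eapply Rle_lt_trans; [|exact H1]. unfold N, N', Rmax, Rabs.
    repeat (destruct Rle_dec || destruct Rcase_abs); lra. }
  replace (N' * (2 * a' - 1) - N * (2 * a - 1)) with ((N' - N) * (2 * a' - 1) + 2 * N * (a' - a)) by ring.
  eapply Rle_lt_trans; [apply Rabs_triang|]. rewrite !Rabs_mult.
  rewrite (Rabs_pos_eq 2), (Rabs_pos_eq N) by lra.
  assert (A1 : Rabs (2 * a' - 1) <= 1) by (apply Rabs_le; lra).
  assert (A2 : Rabs (N' - N) * Rabs (2 * a' - 1) <= Rabs (N' - N)).
  { pose proof (Rabs_pos (N' - N)). pose proof (Rabs_pos (2 * a' - 1)). nra. }
  assert (A3 : 2 * N * Rabs (a' - a) <= e / 2); [|lra].
  apply Rle_trans with (2 * (N + 1) * d2).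
  - apply Rmult_le_compat; [lra|apply Rabs_pos|lra|lra].
  - unfold d2. apply Req_le. field. lra.
Qed.

(** The index [h] refers to reversed time, where [z] has changed sign; matching therefore asks for
    zeros of [Za + Zh] and [Xh - Xa]. *)
Lemma opposite_hits_match d (Za Zh Xa Xh : R -> R -> R) :
  0 < d -> cont_box d Za -> cont_box d Zh -> cont_box d Xa -> cont_box d Xh ->
  (forall u v, in_box d u v ->
     (u = d -> 10 * d <= Za u v) /\
     (u <= - d / 2 -> Rabs (Xa u v - u) <= d / 10 /\ Rabs (Za u v - u) <= d / 10) /\
     (- d / 2 <= u -> - (3 / 4 * d) <= Xa u v) /\ - (2 * d) <= Za u v) ->
  (forall u v, in_box d u v ->
     (v = d -> 10 * d <= Zh u v) /\
     (v <= - d / 2 -> Rabs (Xh u v - v) <= d / 10 /\ Rabs (Zh u v - v) <= d / 10) /\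
     (- d / 2 <= v -> - (3 / 4 * d) <= Xh u v) /\ - (2 * d) <= Zh u v) ->
  exists u v, in_box d u v /\ Za u v = - Zh u v /\ Xa u v = Xh u v.
Proof.
  intros Hd CZa CZh CXa CXh HSa HSh.
  set (U := fun b a => corner_path d b (Rmin 1 (2 - 2 * a))).
  set (V := fun b a => corner_path d b (Rmin 1 (2 * a))).
  set (F1 := fun b a => Za (U b a) (V b a) + Zh (U b a) (V b a)).
  assert (C1 : cont_square F1).
  { apply (cont_square_plus (fun b a => Za (U b a) (V b a)) (fun b a => Zh (U b a) (V b a)));
    apply cont_square_comp; assumption. }
  (* Where [u = - d] or [v = - d], either [F1 < 0] or the sign of [Xh - Xa] is known; the
     last term, which vanishes with [F1], makes the sign of [F2] known in both cases. *)
  set (F2 := fun b a => (Xh (U b a) (V b a) + - Xa (U b a) (V b a)) + Rmax 0 (- F1 b a) * (2 * a - 1)).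
  assert (C2 : cont_square F2).
  { apply (cont_square_plus (fun b a => Xh (U b a) (V b a) + - Xa (U b a) (V b a))).
    - apply (cont_square_plus (fun b a => Xh (U b a) (V b a)) (fun b a => - Xa (U b a) (V b a)));
      [apply cont_square_comp; assumption|].
      apply (cont_square_opp (fun b a => Xa (U b a) (V b a))). apply cont_square_comp; assumption.
    - apply cont_square_negpart, C1. }
  assert (HUV : forall b a, 0 <= b <= 1 -> 0 <= a <= 1 -> in_box d (U b a) (V b a)).
  { intros b a Hb Ha. destruct (Rmin_1_bounds (2 - 2 * a) (2 - 2 * a) ltac:(lra) ltac:(lra)) as [M1 _].
    destruct (Rmin_1_bounds (2 * a) (2 * a) ltac:(lra) ltac:(lra)) as [M2 _].
    split; apply corner_path_box; assumption. }
  assert (Hbnd : forall u, Rabs u <= d -> - d <= u <= d) by (intros u Hu; apply Rabs_le_between, Hu).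
  destruct (poincare_miranda F1 F2 C1 C2) as [b [a [Hb [Ha [Z1 Z2]]]]].
  - intros a Ha. pose proof (HUV 0 a ltac:(lra) Ha) as Hbox.
    destruct (HSa _ _ Hbox) as [_ [A2 _]]. destruct (HSh _ _ Hbox) as [_ [B2 _]].
    assert (EU : U 0 a = - d) by (unfold U, corner_path; ring).
    assert (EV : V 0 a = - d) by (unfold V, corner_path; ring).
    unfold F1. rewrite EU, EV in *. destruct (A2 ltac:(lra)) as [_ A3]. destruct (B2 ltac:(lra)) as [_ B3].
    apply Rabs_le_between in A3. apply Rabs_le_between in B3. lra.
  (* For [b = 1] one of [u], [v] equals [d], and its explosion to [10 * d] outweighs the bound
     [- 2 * d] for the other hit. *)
  - intros a Ha. pose proof (HUV 1 a ltac:(lra) Ha) as Hbox.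
    destruct (HSa _ _ Hbox) as [A1 [_ [_ A4]]]. destruct (HSh _ _ Hbox) as [B1 [_ [_ B4]]].
    unfold F1. destruct (Rle_lt_dec a (1 / 2)) as [C|C].
    + assert (EU : U 1 a = d) by (unfold U, corner_path; rewrite Rmin_left by lra; ring).
      specialize (A1 EU). lra.
    + assert (EV : V 1 a = d) by (unfold V, corner_path; rewrite Rmin_left by lra; ring).
      specialize (B1 EV). lra.
  (* Here [v = - d], so [Xh] is close to [- d]. If [u >= - d / 2], then [Xa] is larger. Otherwise
     both [z] are negative, the correction equals [Za + Zh], and the contributions of [u] to it and
     to [- Xa] cancel, leaving about [- 2 * d]. *)
  - intros b Hb. pose proof (HUV b 0 Hb ltac:(lra)) as Hbox.
    destruct (HSa _ _ Hbox) as [_ [A2 [A3 A4]]]. destruct (HSh _ _ Hbox) as [_ [B2 _]].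
    assert (EV : V b 0 = - d) by (unfold V, corner_path; rewrite Rmin_right by lra; ring).
    destruct Hbox as [HbU _]. specialize (Hbnd _ HbU).
    unfold F2, F1. rewrite EV in *. destruct (B2 ltac:(lra)) as [B3 B5].
    apply Rabs_le_between in B3. apply Rabs_le_between in B5.
    pose proof (Rmax_l 0 (- (Za (U b 0) (- d) + Zh (U b 0) (- d)))).
    pose proof (Rmax_r 0 (- (Za (U b 0) (- d) + Zh (U b 0) (- d)))).
    destruct (Rle_lt_dec (- d / 2) (U b 0)) as [C|C].
    + specialize (A3 C). lra.
    + destruct (A2 ltac:(lra)) as [A5 A6]. apply Rabs_le_between in A5. apply Rabs_le_between in A6. lra.
  - intros b Hb. pose proof (HUV b 1 Hb ltac:(lra)) as Hbox.
    destruct (HSa _ _ Hbox) as [_ [A2 _]]. destruct (HSh _ _ Hbox) as [_ [B2 [B3 B4]]].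
    assert (EU : U b 1 = - d) by (unfold U, corner_path; rewrite Rmin_right by lra; ring).
    destruct Hbox as [_ HbV]. specialize (Hbnd _ HbV).
    unfold F2, F1. rewrite EU in *. destruct (A2 ltac:(lra)) as [A3 A5].
    apply Rabs_le_between in A3. apply Rabs_le_between in A5.
    pose proof (Rmax_l 0 (- (Za (- d) (V b 1) + Zh (- d) (V b 1)))).
    pose proof (Rmax_r 0 (- (Za (- d) (V b 1) + Zh (- d) (V b 1)))).
    destruct (Rle_lt_dec (- d / 2) (V b 1)) as [C|C].
    + specialize (B3 C). lra.
    + destruct (B2 ltac:(lra)) as [B5 B6]. apply Rabs_le_between in B5. apply Rabs_le_between in B6. lra.
  - exists (U b a), (V b a). split; [apply HUV; assumption|].
    unfold F2 in Z2. rewrite Z1, Ropp_0, Rmax_left, Rmult_0_l in Z2 by lra. unfold F1 in Z1. lra.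
Qed.

Lemma solution_periodic F1 F2 F3 K x y z p q : 0 < K -> lip3 F1 K -> lip3 F2 K -> lip3 F3 K ->
  sol3 F1 F2 F3 x y z -> x p = x q -> y p = y q -> z p = z q -> is_period3 x y z (q - p).
Proof.
  intros HK L1 L2 L3 HS Ex Ey Ez t.
  pose proof (sol3_shift _ _ _ _ _ _ (p - q) HS) as HS'.
  pose proof (solutions_dist F1 F2 F3 K _ _ _ _ _ _ HK L1 L2 L3 HS' HS p t) as E.
  unfold sqdist in E. replace (p - (p - q)) with q in E by ring.
  rewrite <- Ex, <- Ey, <- Ez, !Rminus_diag in E.
  replace (t - (p - q)) with (t + (q - p)) in E by ring.
  replace ((0 ^ 2 + 0 ^ 2 + 0 ^ 2) * exp (12 * K * Rabs (t - p))) with 0 in E by ring.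
  assert (Z : forall a b, (a - b) ^ 2 <= 0 -> a = b).
  { intros a b Hab. pose proof (sq_le_abs (a - b) 0 (Rle_refl _) ltac:(lra)) as Q.
    apply Rabs_le_between in Q. lra. }
  pose proof (pow2_ge_0 (x (t + (q - p)) - x t)). pose proof (pow2_ge_0 (y (t + (q - p)) - y t)).
  pose proof (pow2_ge_0 (z (t + (q - p)) - z t)).
  repeat split; apply Z; lra.
Qed.

(** * Periodic orbits *)

Lemma clipped_periodic_is_solution f g M k eps x y z T :
  0 < eps -> 0 < M -> eps * M < k -> 0 < T -> (forall x y z, Rabs (f x y z) <= M) ->
  sol3 (clipf k f) (clipf k g) (fast eps) x y z -> is_period3 x y z T ->
  slowfast_solution f g eps x y z.
Proof.
  intros He HM Hk HT Hfb HS Hper.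
  assert (Hk0 : 0 < k) by (pose proof (Rmult_lt_0_compat _ _ He HM); lra).
  assert (Hup : forall t, 0 < z t -> x t + z t <= k).
  { apply (periodic_no_explosion (clipf k f) (clipf k g) M eps k x y z T); auto.
    - intros; apply Hfb.
    - intro t. apply Hper. }
  assert (Hlo : forall t, 0 < - z t -> x t + - z t <= k).
  { intros t Hz.
    pose proof (periodic_no_explosion (clipf k (hatf f)) (clipf k (hatg g)) M eps k
      (fun t => x (- t)) (fun t => - y (- t)) (fun t => - z (- t)) T He HM Hk HT) as K.
    specialize (K ltac:(intros; unfold clipf, hatf; rewrite Rabs_Ropp; apply Hfb)
      (sol3_reverse k f g eps x y z ltac:(lra) HS)).
    specialize (K ltac:(intro s; simpl; f_equal; destruct (Hper (- (s + T))) as [_ [_ Q]];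
      rewrite <- Q; f_equal; ring) (- t)).
    simpl in K. rewrite Ropp_involutive in K. apply K, Hz. }
  intro t. destruct (HS t) as [D1 [D2 D3]].
  assert (Hz : Rabs (z t) <= Rabs (x t) + k).
  { specialize (Hup t). specialize (Hlo t). pose proof (Rle_abs (- x t)) as Q. rewrite Rabs_Ropp in Q.
    unfold Rabs at 1. destruct (Rcase_abs (z t)).
    - specialize (Hlo ltac:(lra)). lra.
    - destruct (Req_dec (z t) 0) as [E|E]; [pose proof (Rabs_pos (x t)); lra|].
      specialize (Hup ltac:(lra)). lra. }
  unfold clipf in D1, D2. rewrite clip_id in D1, D2 by exact Hz. auto.
Qed.

(** [(xh, yh)] is the repelling trajectory in reversed coordinates, so that [forward_hit] applies to
    both halves of the orbit. *)
Lemma periodic_orbit f g L M g0 xa ya xh yh Ta Tr tau sigma :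
  0 < L -> 0 < M -> (forall x y z, Rabs (f x y z) <= M) -> (forall x y z, Rabs (g x y z) <= M) ->
  lip3 f L -> lip3 g L -> f 0 0 0 = 0 -> 0 < g0 -> g 0 0 0 = g0 ->
  (forall y, y <> 0 -> y * f 0 y 0 < 0) ->
  planar f g xa ya -> xa 0 = 0 -> ya 0 = 0 -> Ta < tau < 0 -> (forall t, Ta < t < 0 -> xa t < 0) ->
  planar (hatf f) (hatg g) xh yh -> xh 0 = 0 -> yh 0 = 0 -> - Tr < - sigma < 0 ->
  (forall t, - Tr < t < 0 -> xh t < 0) ->
  xa tau = xh (- sigma) -> ya tau = - yh (- sigma) ->
  f (xa tau) (ya tau) (xa tau) * g (xa tau) (ya tau) (- xa tau)
    - f (xa tau) (ya tau) (- xa tau) * g (xa tau) (ya tau) (xa tau) <> 0 ->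
  forall eta, 0 < eta -> exists e1, 0 < e1 /\ forall eps, 0 < eps < e1 ->
  exists T x y z, slowfast_solution f g eps x y z /\ minimal_period3 x y z T /\ Rabs (T - (sigma - tau)) < eta.
Proof.
  intros HL HM Hfb Hgb Hf Hg Hf0 Hg0 Hg00 Hfy Hpa Hxa0 Hya0 Htau Hxa Hph Hxh0 Hyh0 Hsig Hxh Hx Hy HA eta Heta.
  pose proof (hatf_lip f L Hf) as Hhf. pose proof (hatg_lip g L Hg) as Hhg.
  assert (Hhfb : forall x y z, Rabs (hatf f x y z) <= M) by (intros; unfold hatf; rewrite Rabs_Ropp; apply Hfb).
  assert (Hhgb : forall x y z, Rabs (hatg g x y z) <= M) by (intros; apply Hgb).
  assert (Hhf0 : hatf f 0 0 0 = 0) by (unfold hatf; rewrite Ropp_0, Hf0; ring).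
  assert (Hhg0 : hatg g 0 0 0 = g0) by (unfold hatg; rewrite Ropp_0; exact Hg00).
  assert (Hfneg : forall y, y < 0 -> 0 < f 0 y 0) by (intros y Hyy; specialize (Hfy y ltac:(lra)); nra).
  assert (Hhfneg : forall y, y < 0 -> 0 < hatf f 0 y 0).
  { intros y Hyy. specialize (Hfy (- y) ltac:(lra)). unfold hatf. rewrite Ropp_0. nra. }
  destruct (functional_choice _ (fun u => planar_exists f g L u HL Hf Hg)) as [WA HWA].
  destruct (functional_choice _ (fun v => planar_exists (hatf f) (hatg g) L v HL Hhf Hhg)) as [WH HWH].
  set (XA := fun u => fst (WA u)). set (YA := fun u => snd (WA u)).
  set (XH := fun u => fst (WH u)). set (YH := fun u => snd (WH u)).
  assert (PA : forall u, planar f g (XA u) (YA u)) by (intro u; apply HWA).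
  assert (PA0 : forall u, XA u 0 = u) by (intro u; apply HWA).
  assert (PA1 : forall u, YA u 0 = 0) by (intro u; apply HWA).
  assert (PH : forall u, planar (hatf f) (hatg g) (XH u) (YH u)) by (intro u; apply HWH).
  assert (PH0 : forall u, XH u 0 = u) by (intro u; apply HWH).
  assert (PH1 : forall u, YH u 0 = 0) by (intro u; apply HWH).
  destruct (planar_unique f g L (XA 0) (YA 0) xa ya HL Hf Hg (PA 0) Hpa ltac:(rewrite PA0; auto) (PA1 0) Hya0 tau) as [EA1 EA2].
  destruct (planar_unique (hatf f) (hatg g) L (XH 0) (YH 0) xh yh HL Hhf Hhg (PH 0) Hph ltac:(rewrite PH0; auto) (PH1 0) Hyh0 (- sigma)) as [EH1 EH2].
  clearbody XA YA XH YH. clear WA WH HWA HWH.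
  destruct (forward_hit f g L M g0 xa ya Ta tau HL HM Hfb Hgb Hf Hg Hf0 Hg0 Hg00 Hfneg Hpa Hxa0 Hya0 Htau Hxa (eta / 8) ltac:(lra))
    as [h [H [s1 [d1 [Hh [HH [Hs1 [Hd1 FA]]]]]]]].
  destruct (forward_hit (hatf f) (hatg g) L M g0 xh yh (- Tr) (- sigma) HL HM Hhfb Hhgb Hhf Hhg Hhf0 Hg0 Hhg0 Hhfneg Hph Hxh0 Hyh0 Hsig Hxh (eta / 8) ltac:(lra))
    as [h' [H' [s1' [d1' [Hh' [HH' [Hs1' [Hd1' FH]]]]]]]].
  set (CA := exp (12 * L * (Rabs tau + 1))). set (CH := exp (12 * L * (Rabs (- sigma) + 1))).
  assert (HCA : 0 < CA) by apply exp_pos. assert (HCH : 0 < CH) by apply exp_pos.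
  (* The period deviates from [sigma - tau] by the two shifts [s], [t] and the two hitting times,
     each below [eta / 8] in absolute value. *)
  set (S := Rmin (Rmin s1 s1') (Rmin (eta / 8) 1)).
  assert (HS0 : 0 < S) by (repeat apply Rmin_pos; lra).
  assert (HSle : S <= s1 /\ S <= s1' /\ S <= eta / 8 /\ S <= 1).
  { unfold S. pose proof (Rmin_l (Rmin s1 s1') (Rmin (eta / 8) 1)). pose proof (Rmin_r (Rmin s1 s1') (Rmin (eta / 8) 1)).
    pose proof (Rmin_l s1 s1'). pose proof (Rmin_r s1 s1').
    pose proof (Rmin_l (eta / 8) 1). pose proof (Rmin_r (eta / 8) 1). lra. }
  (* The signs bring the reversed family back to original coordinates and time, where it passes the
     crossing at time [sigma + t]; the determinant becomes that of [HA]. *)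
  destruct (transversal_crossing (fun u s => XA u (tau + s)) (fun u s => YA u (tau + s))
     (fun v t => XH v (- sigma + - t)) (fun v t => - YH v (- sigma + - t))
     (f (XA 0 tau) (YA 0 tau) (XA 0 tau)) (g (XA 0 tau) (YA 0 tau) (XA 0 tau))
     (- hatf f (XH 0 (- sigma)) (YH 0 (- sigma)) (XH 0 (- sigma)))
     (hatg g (XH 0 (- sigma)) (YH 0 (- sigma)) (XH 0 (- sigma))) (CA + CH))
    with (S := S) as [d0 [K [s [t [Hd0 [HK [Hst HstL]]]]]]].
  - unfold hatf, hatg. rewrite EA1, EA2, EH1, EH2, <- Hx, <- Hy. rewrite Ropp_involutive. lra.
  - lra.
  - intros nu Hnu.
    destruct (family_near_linear f g L M tau XA YA HL HM Hfb Hgb Hf Hg PA PA0 PA1 nu Hnu) as [r1 [Hr1 N1]].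
    destruct (family_near_linear (hatf f) (hatg g) L M (- sigma) XH YH HL HM Hhfb Hhgb Hhf Hhg PH PH0 PH1 nu Hnu) as [r2 [Hr2 N2]].
    exists (Rmin r1 r2). split; [apply Rmin_pos; assumption|]. intros u p p' Hu Hp Hp'.
    pose proof (Rmin_l r1 r2). pose proof (Rmin_r r1 r2).
    destruct (N1 u p p' ltac:(lra) ltac:(lra) ltac:(lra)) as [Q1 Q2].
    destruct (N2 u (- p) (- p') ltac:(lra) ltac:(rewrite Rabs_Ropp; lra) ltac:(rewrite Rabs_Ropp; lra)) as [Q3 Q4].
    replace (- p - - p') with (- (p - p')) in Q3, Q4 by ring. rewrite Rabs_Ropp in Q3, Q4.
    split; [exact Q1|]. split; [exact Q2|]. split.
    + replace (- hatf f (XH 0 (- sigma)) (YH 0 (- sigma)) (XH 0 (- sigma)) * (p - p')) with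
       (hatf f (XH 0 (- sigma)) (YH 0 (- sigma)) (XH 0 (- sigma)) * - (p - p')) by ring. exact Q3.
    + rewrite <- Rabs_Ropp. eapply Rle_trans; [|exact Q4]. apply Req_le. f_equal. ring.
  - intros u u' p Hp.
    destruct (family_lipschitz f g L tau XA YA HL Hf Hg PA PA0 PA1 u u' p Hp) as [Q1 Q2].
    destruct (family_lipschitz (hatf f) (hatg g) L (- sigma) XH YH HL Hhf Hhg PH PH0 PH1 u u' (- p) ltac:(rewrite Rabs_Ropp; exact Hp)) as [Q3 Q4].
    fold CA in Q1, Q2. fold CH in Q3, Q4. pose proof (Rabs_pos (u - u')).
    assert (0 <= CA * Rabs (u - u')) by (apply Rmult_le_pos; lra).
    assert (0 <= CH * Rabs (u - u')) by (apply Rmult_le_pos; lra).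
    replace (- YH u (- sigma + - p) - - YH u' (- sigma + - p)) with (- (YH u (- sigma + - p) - YH u' (- sigma + - p))) by ring.
    rewrite Rabs_Ropp. lra.
  - rewrite Ropp_0, !Rplus_0_r, EA1, EH1. exact Hx.
  - rewrite Ropp_0, !Rplus_0_r, EA2, EH2. exact Hy.
  - exact HS0.
  - simpl in Hst.
    set (d2 := Rmin d0 1).
    assert (Hd2 : 0 < d2 /\ d2 <= d0) by (split; [apply Rmin_pos; lra|apply Rmin_l]).
    set (d := Rmin d2 (Rmin d1 d1')).
    assert (Hd : 0 < d) by (repeat apply Rmin_pos; lra).
    assert (Hdle : d <= d0 /\ d <= d1 /\ d <= d1').
    { unfold d. pose proof (Rmin_l d2 (Rmin d1 d1')). pose proof (Rmin_r d2 (Rmin d1 d1')).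
      pose proof (Rmin_l d1 d1'). pose proof (Rmin_r d1 d1'). lra. }
    destruct (FA d ltac:(lra)) as [k1 [Hk1 FA1]]. destruct (FH d ltac:(lra)) as [k1' [Hk1' FH1]].
    set (k := Rmin k1 k1').
    assert (Hk : 0 < k /\ k <= k1 /\ k <= k1').
    { unfold k. split; [apply Rmin_pos; assumption|]. split; [apply Rmin_l|apply Rmin_r]. }
    destruct (FA1 k ltac:(lra)) as [e1 [He1 FA2]]. destruct (FH1 k ltac:(lra)) as [e1' [He1' FH2]].
    clear FA FH FA1 FH1.
    exists (Rmin (k / M) (Rmin e1 e1')).
    split; [repeat apply Rmin_pos; try assumption; apply Rdiv_lt_0_compat; lra|].
    intros eps [Heps Heps2]. apply Rmin_Rgt in Heps2. destruct Heps2 as [HepsM Heps2].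
    apply Rmin_Rgt in Heps2. destruct Heps2 as [Heps1 Heps1'].
    apply Rlt_div_r in HepsM; [|exact HM].
    set (K0 := 2 * L + / eps).
    assert (HK0 : 0 < / eps) by (apply Rinv_0_lt_compat, Heps).
    assert (L1 : lip3 (clipf k f) K0) by (apply (lip3_mono _ (2 * L)); [unfold K0; lra|apply clipf_lip; [lra|exact Hf]]).
    assert (L2 : lip3 (clipf k g) K0) by (apply (lip3_mono _ (2 * L)); [unfold K0; lra|apply clipf_lip; [lra|exact Hg]]).
    assert (L1h : lip3 (clipf k (hatf f)) K0) by (apply (lip3_mono _ (2 * L)); [unfold K0; lra|apply clipf_lip; [lra|exact Hhf]]).
    assert (L2h : lip3 (clipf k (hatg g)) K0) by (apply (lip3_mono _ (2 * L)); [unfold K0; lra|apply clipf_lip; [lra|exact Hhg]]).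
    assert (L3 : lip3 (fast eps) K0) by (apply (lip3_mono _ (/ eps)); [unfold K0; lra|apply fast_lip, Heps]).
    assert (HK0p : 0 < K0) by (unfold K0; lra).
    set (px := fun u v => XA u (tau + s u v)). set (py := fun u v => YA u (tau + s u v)).
    destruct (functional_choice (fun (p : R * R) (c : (R -> R) * (R -> R) * (R -> R)) =>
       sol3 (clipf k f) (clipf k g) (fast eps) (fst (fst c)) (snd (fst c)) (snd c) /\
       fst (fst c) 0 = px (fst p) (snd p) /\ snd (fst c) 0 = py (fst p) (snd p) /\ snd c 0 = 0)) as [c Hc].
    { intros [u v]. destruct (global_solution _ _ _ K0 0 (px u v) (py u v) 0 HK0p L1 L2 L3) as [x [y [z Hxyz]]].
      exists (x, y, z). exact Hxyz. }
    set (x := fun u v => fst (fst (c (u, v)))). set (y := fun u v => snd (fst (c (u, v)))). set (z := fun u v => snd (c (u, v))).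
    assert (HS : forall u v, sol3 (clipf k f) (clipf k g) (fast eps) (x u v) (y u v) (z u v)) by (intros u v; apply (Hc (u, v))).
    assert (Hinit : forall u v, x u v 0 = px u v /\ y u v 0 = py u v /\ z u v 0 = 0) by (intros u v; apply (Hc (u, v))).
    clearbody x y z. clear c Hc.
    set (Kp := CA + M * K + K).
    assert (HMK : 0 <= M * K) by (apply Rmult_le_pos; lra).
    assert (HKp : 0 < Kp) by (unfold Kp; lra).
    assert (Hstart : forall u v u' v', in_box d u v -> in_box d u' v' ->
      Rabs (px u' v' - px u v) <= Kp * (Rabs (u' - u) + Rabs (v' - v)) /\
      Rabs (py u' v' - py u v) <= Kp * (Rabs (u' - u) + Rabs (v' - v)) /\
      Rabs (s u' v' - s u v) <= Kp * (Rabs (u' - u) + Rabs (v' - v)) /\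
      Rabs (t u' v' - t u v) <= Kp * (Rabs (u' - u) + Rabs (v' - v))).
    { intros u v u' v' [Hu Hv] [Hu' Hv'].
      destruct (HstL u' v' u v ltac:(lra) ltac:(lra) ltac:(lra) ltac:(lra)) as [Q1 Q2].
      set (Dl := Rabs (u' - u) + Rabs (v' - v)) in *.
      assert (HDu : 0 <= Rabs (u' - u) <= Dl) by (unfold Dl; pose proof (Rabs_pos (u' - u)); pose proof (Rabs_pos (v' - v)); lra).
      assert (R1 : 0 <= CA * Dl) by (apply Rmult_le_pos; lra).
      assert (R2 : 0 <= M * K * Dl) by (apply Rmult_le_pos; lra).
      assert (R3 : 0 <= K * Dl) by (apply Rmult_le_pos; lra).
      assert (R4 : M * Rabs (s u' v' - s u v) <= M * (K * Dl)) by (apply Rmult_le_compat_l; lra).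
      assert (Hsb : Rabs (s u' v') <= S) by (apply Hst; lra).
      assert (T1 : forall W W' : R -> R, (forall p, Rabs p <= 1 -> Rabs (W' (tau + p) - W (tau + p)) <= CA * Rabs (u' - u)) -> 
         (forall a b, Rabs (W b - W a) <= M * Rabs (b - a)) ->
         Rabs (W' (tau + s u' v') - W (tau + s u v)) <= Kp * Dl).
      { intros W W' A1 A2. specialize (A1 (s u' v') ltac:(lra)). specialize (A2 (tau + s u v) (tau + s u' v')).
        replace (tau + s u' v' - (tau + s u v)) with (s u' v' - s u v) in A2 by ring.
        replace (W' (tau + s u' v') - W (tau + s u v)) with ((W' (tau + s u' v') - W (tau + s u' v')) + (W (tau + s u' v') - W (tau + s u v))) by ring.
        eapply Rle_trans; [apply Rabs_triang|].
        assert (CA * Rabs (u' - u) <= CA * Dl) by (apply Rmult_le_compat_l; lra).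
        unfold Kp. lra. }
      split; [|split; [|unfold Kp; lra]].
      - apply (T1 (XA u) (XA u')).
        + intros p Hp. apply (family_lipschitz f g L tau XA YA HL Hf Hg PA PA0 PA1 u' u p Hp).
        + intros a b. apply (mean_value_abs (XA u) _ M (fun r => proj1 (PA u r)) (fun r => Hfb _ _ _)).
      - apply (T1 (YA u) (YA u')).
        + intros p Hp. apply (family_lipschitz f g L tau XA YA HL Hf Hg PA PA0 PA1 u' u p Hp).
        + intros a b. apply (mean_value_abs (YA u) _ M (fun r => proj2 (PA u r)) (fun r => Hgb _ _ _)). }
    assert (Hopp : forall a b, Rabs (- a - - b) = Rabs (a - b)).
    { intros a b. replace (- a - - b) with (- (a - b)) by ring. apply Rabs_Ropp. }
    destruct (hit_continuous (clipf k f) (clipf k g) (fast eps) K0 Kp h H d g0 (fun u _ => u)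
      (fun u v => tau + s u v) px py x y z HK0p HKp Hg0 L1 L2 L3 HS Hinit) as [ta [Hta [CXa CZa]]].
    { intros u v u' v' Huv Huv'. destruct (Hstart u v u' v' Huv Huv') as [Q1 [Q2 [Q3 _]]].
      replace (tau + s u' v' - (tau + s u v)) with (s u' v' - s u v) by ring. auto. }
    { intros u v [Hu Hv]. destruct (Hinit u v) as [I1 [I2 I3]].
      destruct (Hst u v ltac:(lra) ltac:(lra)) as [B1 _].
      apply (FA2 eps ltac:(lra) (s u v) u (XA u) (YA u)); auto; try (rewrite Rminus_diag; assumption).
      - lra.
      - apply Rabs_le_between, Hu.
      - apply sol3_shift, HS. }
    destruct (hit_continuous (clipf k (hatf f)) (clipf k (hatg g)) (fast eps) K0 Kp h' H' d g0 (fun _ v => v)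
      (fun u v => - sigma + - t u v) px (fun u v => - py u v) (fun u v r => x u v (- r)) (fun u v r => - y u v (- r))
      (fun u v r => - z u v (- r)) HK0p HKp Hg0 L1h L2h L3) as [th [Hth [CXh CZh]]].
    { intros u v. apply (sol3_reverse k f g eps); [lra|apply HS]. }
    { intros u v. destruct (Hinit u v) as [I1 [I2 I3]]. rewrite Ropp_0, I1, I2, I3. rewrite Ropp_0. auto. }
    { intros u v u' v' Huv Huv'. destruct (Hstart u v u' v' Huv Huv') as [Q1 [Q2 [_ Q3]]].
      replace (- sigma + - t u' v' - (- sigma + - t u v)) with (- t u' v' - - t u v) by ring. rewrite !Hopp. auto. }
    { intros u v [Hu Hv]. destruct (Hinit u v) as [I1 [I2 I3]].
      destruct (Hst u v ltac:(lra) ltac:(lra)) as [_ [B2 [EX EY]]].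
      apply (FH2 eps ltac:(lra) (- t u v) v (XH v) (YH v)); auto; try rewrite Rminus_diag, Ropp_0.
      - rewrite Rabs_Ropp. lra.
      - apply Rabs_le_between, Hv.
      - apply (sol3_shift _ _ _ (fun r => x u v (- r)) (fun r => - y u v (- r)) (fun r => - z u v (- r))).
        apply (sol3_reverse k f g eps); [lra|apply HS].
      - rewrite I1. exact EX.
      - rewrite I2. unfold py. rewrite EY. ring.
      - rewrite I3. ring. }
    assert (Hstart0 : forall u v, in_box d u v -> tau + s u v < - h /\ - sigma + - t u v < - h').
    { intros u v [Hu Hv]. destruct (Hinit u v) as [I1 [I2 I3]].
      destruct (Hst u v ltac:(lra) ltac:(lra)) as [B1 [B2 [EX EY]]]. split.
      - apply (FA2 eps ltac:(lra) (s u v) u (XA u) (YA u) (fun r => x u v (r - (tau + s u v)))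
          (fun r => y u v (r - (tau + s u v))) (fun r => z u v (r - (tau + s u v)))); auto; try (rewrite Rminus_diag; assumption).
        + lra.
        + apply Rabs_le_between, Hu.
        + apply sol3_shift, HS.
      - apply (FH2 eps ltac:(lra) (- t u v) v (XH v) (YH v) (fun r => x u v (- (r - (- sigma + - t u v))))
          (fun r => - y u v (- (r - (- sigma + - t u v)))) (fun r => - z u v (- (r - (- sigma + - t u v)))));
          auto; try rewrite Rminus_diag, Ropp_0.
        + rewrite Rabs_Ropp. lra.
        + apply Rabs_le_between, Hv.
        + apply (sol3_shift _ _ _ (fun r => x u v (- r)) (fun r => - y u v (- r)) (fun r => - z u v (- r))).
          apply (sol3_reverse k f g eps); [lra|apply HS].
        + rewrite I1. exact EX.
        + rewrite I2. unfold py. rewrite EY. ring.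
        + rewrite I3. ring. }
    destruct (opposite_hits_match d _ _ _ _ Hd CZa CZh CXa CXh) as [u [v [Huv [EZ EX]]]].
    { intros u v Huv. destruct (Hta u v Huv) as [_ [_ [_ [Q1 [Q2 [Q3 [Q4 _]]]]]]]. auto. }
    { intros u v Huv. destruct (Hth u v Huv) as [_ [_ [_ [Q1 [Q2 [Q3 [Q4 _]]]]]]]. auto. }
    destruct (Hta u v Huv) as [Wa [Ya [_ [_ [_ [_ [_ Na]]]]]]].
    destruct (Hth u v Huv) as [Wh [Yh [_ [_ [_ [_ [_ Nh]]]]]]].
    destruct (Hstart0 u v Huv) as [Ba Bh]. destruct (Hinit u v) as [I1 [I2 I3]].
    destruct Huv as [Hu Hv]. destruct (Hst u v ltac:(lra) ltac:(lra)) as [B1 [B2 _]].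
    simpl in *.
    set (ra := ta u v - (tau + s u v)) in *. set (rh := th u v - (- sigma + - t u v)) in *.
    assert (Hra : 0 < ra) by (unfold ra; lra). assert (Hrh : 0 < rh) by (unfold rh; lra).
    (* The states at times [- rh] and [ra] both lie on [y = 0] and are matched in [x] and [z] by
       [EX] and [EZ]. *)
    assert (Hper : is_period3 (x u v) (y u v) (z u v) (ra - - rh)).
    { apply (solution_periodic _ _ _ K0 _ _ _ (- rh) ra HK0p L1 L2 L3 (HS u v)); lra. }
    exists (ra - - rh), (x u v), (y u v), (z u v).
    split; [|split].
    + apply (clipped_periodic_is_solution f g M k eps _ _ _ (ra - - rh)); auto; lra.
    (* At time [T'] the state would be the starting one again. For [T' <= ra] the forward half
       excludes it; otherwise [T'] minus the period lies between [- rh] and [0], and the backward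
       half does. *)
    + split; [lra|]. split; [exact Hper|]. intros T' HT' Hper'.
      destruct (Hper' 0) as [E1 [_ E3]]. rewrite Rplus_0_l in E1, E3. rewrite I3 in E3.
      destruct (Rle_lt_dec T' ra) as [C|C].
      * destruct (Na (T' + (tau + s u v)) ltac:(unfold ra in *; lra)) as [N|N];
        replace (T' + (tau + s u v) - (tau + s u v)) with T' in N by ring; [lra|].
        rewrite Rminus_diag in N. lra.
      * destruct (Hper (T' - (ra - - rh))) as [E4 [_ E6]].
        replace (T' - (ra - - rh) + (ra - - rh)) with T' in E4, E6 by ring.
        destruct (Nh ((ra - - rh) - T' + (- sigma + - t u v)) ltac:(unfold rh in *; lra)) as [N|N];
        replace (- ((ra - - rh) - T' + (- sigma + - t u v) - (- sigma + - t u v))) with (T' - (ra - - rh)) in N by ring; [lra|].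
        rewrite Rminus_diag, Ropp_0 in N. lra.
    + apply Rabs_le_between in B1. apply Rabs_le_between in B2. unfold ra, rh. apply Rabs_def1; lra.
Qed.

(** * Euclidean Lipschitz constants and selection of the period *)

Lemma norm3_le a b c : norm3 a b c <= Rabs a + Rabs b + Rabs c.
Proof.
  pose proof (Rabs_pos a). pose proof (Rabs_pos b). pose proof (Rabs_pos c).
  unfold norm3. rewrite <- (sqrt_pow2 (Rabs a + Rabs b + Rabs c)) by lra. apply sqrt_le_1_alt.
  rewrite <- (pow2_abs a), <- (pow2_abs b), <- (pow2_abs c).
  assert (0 <= Rabs a * Rabs b) by (apply Rmult_le_pos; assumption).
  assert (0 <= Rabs a * Rabs c) by (apply Rmult_le_pos; assumption).
  assert (0 <= Rabs b * Rabs c) by (apply Rmult_le_pos; assumption). nra.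
Qed.

(** The maximum with [1] guarantees a positive constant, by which later estimates divide. *)
Lemma lipschitz3_lip3 F lam : lipschitz3 F lam -> lip3 F (Rmax lam 1).
Proof.
  intros HF x y z x' y' z'. eapply Rle_trans; [apply HF|].
  apply Rle_trans with (Rmax lam 1 * norm3 (x - x') (y - y') (z - z')).
  - apply Rmult_le_compat_r; [apply sqrt_pos|apply Rmax_l].
  - apply Rmult_le_compat_l; [pose proof (Rmax_r lam 1); lra|apply norm3_le].
Qed.

(* Makes one choice of [Tmin eps] converge although the existence result depends on the
   required precision. *)
Lemma almost_closest (P : R -> Prop) D e : 0 < e -> (exists T, P T) ->
  exists T, P T /\ forall T', P T' -> Rabs (T - D) <= Rabs (T' - D) + e.
Proof.
  intros He [T0 HT0].
  destruct (completeness (fun r => exists T, P T /\ r = - Rabs (T - D))) as [m [Hm1 Hm2]].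
  - exists 0. intros r [T [_ ->]]. pose proof (Rabs_pos (T - D)). lra.
  - exists (- Rabs (T0 - D)), T0. auto.
  - apply NNPP. intro Hno. assert (m <= m - e); [|lra].
    apply Hm2. intros r [T [HT ->]]. apply Rnot_lt_le. intro Hlt. apply Hno.
    exists T. split; [exact HT|]. intros T' HT'.
    specialize (Hm1 (- Rabs (T' - D)) (ex_intro _ T' (conj HT' eq_refl))). lra.
Qed.

Theorem theorem1
  (f g : R -> R -> R -> R) (M lam : R)
  (Hfb : forall x y z : R, Rabs (f x y z) < M)
  (Hgb : forall x y z : R, Rabs (g x y z) < M)
  (Hfl : lipschitz3 f lam) (Hgl : lipschitz3 g lam)
  (Hf0 : f 0 0 0 = 0) (Hg0 : g 0 0 0 > 0)
  (Hfy : forall y : R, y <> 0 -> y * f 0 y 0 < 0)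
  (xa ya xr yr : R -> R)
  (Ha : planar_solution (fun x y => f x y x) (fun x y => g x y x) xa ya)
  (Ha0 : xa 0 = 0 /\ ya 0 = 0)
  (Hr : planar_solution (fun x y => f x y (- x)) (fun x y => g x y (- x)) xr yr)
  (Hr0 : xr 0 = 0 /\ yr 0 = 0)
  (Ta Tr : R) (HTa : Ta < 0) (HTr : 0 < Tr)
  (Hxa : forall t : R, Ta < t < 0 -> xa t < 0)
  (Hxr : forall t : R, 0 < t < Tr -> xr t < 0)
  (tau sigma : R) (Htau : Ta < tau < 0) (Hsigma : 0 < sigma < Tr)
  (Hx : xa tau = xr sigma) (Hy : ya tau = yr sigma)
  (HA : f (xa tau) (ya tau) (xa tau) * g (xa tau) (ya tau) (- xa tau)
        - f (xa tau) (ya tau) (- xa tau) * g (xa tau) (ya tau) (xa tau) <> 0) :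
  exists (eps0 : R) (Tmin : R -> R),
    0 < eps0 /\
    (forall eps : R, 0 < eps < eps0 ->
       exists x y z : R -> R,
         slowfast_solution f g eps x y z /\ minimal_period3 x y z (Tmin eps)) /\
    (forall eta : R, 0 < eta ->
       exists delta : R, 0 < delta /\
         forall eps : R, 0 < eps < Rmin delta eps0 ->
           Rabs (Tmin eps - (sigma - tau)) < eta).
Proof.
  set (L := Rmax lam 1).
  assert (HL : 0 < L) by (pose proof (Rmax_r lam 1); unfold L; lra).
  assert (HM : 0 < M) by (pose proof (Rabs_pos (f 0 0 0)); specialize (Hfb 0 0 0); lra).
  assert (Hnear : forall eta, 0 < eta -> exists e1, 0 < e1 /\ forall eps, 0 < eps < e1 ->
    exists T x y z, slowfast_solution f g eps x y z /\ minimal_period3 x y z T /\ Rabs (T - (sigma - tau)) < eta).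
  { apply (periodic_orbit f g L M (g 0 0 0) xa ya (fun t => xr (- t)) (fun t => - yr (- t)) Ta Tr);
      try (intros; left; auto; fail); try rewrite !Ropp_involutive; try rewrite !Ropp_0; try tauto; try lra.
    - apply lipschitz3_lip3, Hfl.
    - apply lipschitz3_lip3, Hgl.
    - intro t. destruct (Hr (- t)) as [D1 D2]. unfold hatf, hatg. rewrite Ropp_involutive.
      split; [apply is_derive_reverse, D1|apply is_derive_reverse_opp, D2].
    - intros t Ht. apply Hxr. lra. }
  destruct (Hnear 1 Rlt_0_1) as [eps0 [Heps0 Hex]].
  set (P := fun eps T => exists x y z, slowfast_solution f g eps x y z /\ minimal_period3 x y z T).
  destruct (functional_choice (fun eps T => 0 < eps < eps0 -> P eps T /\
    forall T', P eps T' -> Rabs (T - (sigma - tau)) <= Rabs (T' - (sigma - tau)) + eps)) as [Tmin HT].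
  { intro eps. destruct (classic (0 < eps < eps0)) as [C|C]; [|exists 0; tauto].
    destruct (almost_closest (P eps) (sigma - tau) eps) as [T HT].
    - lra.
    - destruct (Hex eps C) as [T [x [y [z [S1 [S2 _]]]]]]. exists T, x, y, z. auto.
    - exists T. auto. }
  exists eps0, Tmin. split; [exact Heps0|]. split.
  - intros eps C. destruct (HT eps C) as [K _]. exact K.
  (* Half of [eta] is the distance of some minimal period from [sigma - tau], the other half covers
     the slack [eps] in the choice of [Tmin eps]. *)
  - intros eta Heta. destruct (Hnear (eta / 2) ltac:(lra)) as [e1 [He1 Hclose]].
    exists (Rmin e1 (eta / 2)). split; [apply Rmin_pos; lra|].
    intros eps [C1 C2]. apply Rmin_Rgt in C2. destruct C2 as [C2 C3]. apply Rmin_Rgt in C2.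
    destruct (Hclose eps ltac:(lra)) as [T [x [y [z [S1 [S2 S3]]]]]].
    destruct (HT eps ltac:(lra)) as [_ K].
    specialize (K T (ex_intro _ x (ex_intro _ y (ex_intro _ z (conj S1 S2))))). lra.
Qed.
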